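(* Let (W) be any one of the properties (A1e)–(C2) listed in the context and let $\mathcal S$ be any one of the following classes: the class of partially ordered sets, of meet semilattices, of join semilattices, of lattices, of Boolean algebras, of Heyting algebras. In the last three cases (W) is also allowed to be (C3). Then the following hold. (1) If $\mathcal S^{(W)}$ is the class of structures obtained from members of $\mathcal S$ by adding a new operation satisfying (W), then $\mathcal S^{(W)}$ has the superamalgamation property, in particular, the strong amalgamation property. (2) More generally, the superamalgamation property is maintained if one adds families of operations satisfying possibly distinct properties from (A1e)–(C3) (with (C3) allowed only when $\mathcal S$ is the class of lattices, Boolean algebras or Heyting algebras). Further, one may possibly add comparability conditions among operations satisfying the same property. (3) For each class $\mathcal S^{(W)}$ as in (1), and for each class of expansions of members of $\mathcal S$ by families of operations as in (2) (possibly with comparability conditions), the class of its finite members has a Fraïssé limit, under the provisions that in (2) only a finite number of operations are added and that, in the case of Boolean and Heyting algebras, one considers a subclass of $\mathcal S^{(W)}$ (respectively, of the class of expansions as in (2)) consisting of structures having a fixed (modulo isomorphism) $\emptyset$-generated substructure.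
   Context: Embeddings are meant to preserve (and, for the order, reflect) all the operations and relations of the structures: e.g. lattice embeddings preserve $\vee$ and $\wedge$, Boolean and Heyting embeddings preserve all Boolean/Heyting operations, and the added operations are preserved. Classes are closed under isomorphism. For posets, semilattices and lattices (no constants in the language) the empty structure may be considered. $\mathbf A\subseteq\mathbf B$ means that $A\subseteq B$ and the inclusion is an embedding. A class has the strong amalgamation property if, whenever $\mathbf A,\mathbf B,\mathbf C$ are in the class, $\mathbf C\subseteq\mathbf A$, $\mathbf C\subseteq\mathbf B$ and $C=A\cap B$, there is $\mathbf D$ in the class such that $\mathbf A\subseteq\mathbf D$ and $\mathbf B\subseteq\mathbf D$. It has the superamalgamation property if, whenever $\mathbf A,\mathbf B,\mathbf C$ are in the class, $\mathbf C\subseteq\mathbf A$, $\mathbf C\subseteq\mathbf B$ and $C=A\cap B$, there is $\mathbf D$ in the class such that $\mathbf A\subseteq\mathbf D$ and $\mathbf B\subseteq\mathbf D$, with the additional property that, for every $a\in A\setminus B$ and $b\in B\setminus A$: (a) if $a\le_{\mathbf D}b$, then there is $c\in C$ such that $a\le_{\mathbf A}c$ and $c\le_{\mathbf B}b$; (b) if $b\le_{\mathbf D}a$, then there is $c\in C$ such that $b\le_{\mathbf B}c$ and $c\le_{\mathbf A}a$. A Fraïssé limit of a class $\mathcal H$ of finitely generated structures is a countable universal homogeneous structure of age $\mathcal H$. Properties of an operation on an ordered structure. For a unary operation $K$: (A1e) extensive ($x\le Kx$ for all $x$); (A1c) contractive ($Kx\le x$ for all $x$); (A2) idempotent ($KKx=Kx$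 for all $x$); (A2e) idempotent and extensive; (A2c) idempotent and contractive; (A3) involutive ($KKx=x$ for all $x$); (B1) isotone ($x\le y$ implies $Kx\le Ky$); (B1e) isotone and extensive; (B1c) isotone and contractive; (B2) isotone and idempotent; (B3) a closure operation (isotone, extensive and idempotent); (B4) an interior operation (isotone, contractive and idempotent); (B5) antitone ($x\le y$ implies $Ky\le Kx$). For an $n$-ary operation $F$ ($n\ge 1$, $i,j\ge 0$, $i+j\le n$): (C1)$_{i,j,n}$ $F$ is isotone on the first $i$ components and antitone on the last $j$ components (each component being varied with the other arguments fixed); (C2)$_{i,j,n,h}$ $F$ satisfies (C1)$_{i,j,n}$ and moreover $x_1\le F\bar x,\dots,x_h\le F\bar x$ for all $\bar x$, where $h\le i$ is fixed; (C3)$_{i,j,n,t}$ (for lattice-ordered structures, with embeddings being at least lattice-embeddings) $F$ satisfies (C1)$_{i,j,n}$ and moreover $t(x_1,\dots,x_i)\le F\bar x$ for all $\bar x$, where $t$ is a given lattice term. No additivity or multiplicativity is assumed for closure and interior operations. A comparability condition between two operations $H,K$ of the same arity is a condition of the form ''$H\bar x\le K\bar x$ for every $\bar x$''. *)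

(* Defs.v *)
From HB Require Import structures.
From mathcomp Require Import all_boot all_order.
From mathcomp Require Import boolp classical_sets functions cardinality.

Set Implicit Arguments.
Unset Strict Implicit.
Unset Printing Implicit Defensive.

Import Order.Theory.
Local Open Scope classical_set_scope.
Local Open Scope order_scope.

(* Heyting algebras: bounded lattices with a relative pseudo-complement. *)
HB.mixin Record hasHeytingImplication (d : Order.disp_t) T
    of Order.TBLattice d T := {
  himp : T -> T -> T;
  le_himp : forall x y z : T, (z <= himp x y) = (z `&` x <= y)
}.

#[short(type="heytingType")]
HB.structure Definition Heyting (d : Order.disp_t) :=
  { T of hasHeytingImplication d T & Order.TBLattice d T }.

(* The class S.  Nothing forces posets, semilattices and lattices to be
   nonempty; Boolean and Heyting algebras contain \bot and \top, which may
   coincide. *)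
Inductive kind :=
  | Posets | MeetSemilattices | JoinSemilattices | Lattices
  | BooleanAlgebras | HeytingAlgebras.

Definition lattice_ordered (k : kind) : bool :=
  match k with
  | Lattices | BooleanAlgebras | HeytingAlgebras => true
  | _ => false
  end.

Definition base (d : Order.disp_t) (k : kind) : Type :=
  match k with
  | Posets => porderType d
  | MeetSemilattices => meetSemilatticeType d
  | JoinSemilattices => joinSemilatticeType d
  | Lattices => latticeType d
  | BooleanAlgebras => ctbDistrLatticeType d
  | HeytingAlgebras => heytingType d
  end.

Definition base_porder (d : Order.disp_t) (k : kind) :
    base d k -> porderType d :=
  match k with
  | Posets => fun T : porderType d => T
  | MeetSemilattices => fun T : meetSemilatticeType d => T
  | JoinSemilattices => fun T : joinSemilatticeType d => T
  | Lattices => fun T : latticeType d => T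
  | BooleanAlgebras => fun T : ctbDistrLatticeType d => T
  | HeytingAlgebras => fun T : heytingType d => T
  end.

Coercion base_porder : base >-> Order.POrder.type.

Definition base_morphism (d : Order.disp_t) (k : kind) :
    forall A B : base d k, (A -> B) -> Prop :=
  match k with
  | Posets => fun (A B : porderType d) (f : A -> B) => True
  | MeetSemilattices => fun (A B : meetSemilatticeType d) (f : A -> B) =>
      {morph f : x y / x `&` y}
  | JoinSemilattices => fun (A B : joinSemilatticeType d) (f : A -> B) =>
      {morph f : x y / x `|` y}
  | Lattices => fun (A B : latticeType d) (f : A -> B) =>
      {morph f : x y / x `&` y} /\ {morph f : x y / x `|` y}
  | BooleanAlgebras => fun (A B : ctbDistrLatticeType d) (f : A -> B) =>
      [/\ {morph f : x y / x `&` y}, {morph f : x y / x `|` y},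
          {morph f : x / ~` x}, f \bot = \bot & f \top = \top]
  | HeytingAlgebras => fun (A B : heytingType d) (f : A -> B) =>
      [/\ {morph f : x y / x `&` y}, {morph f : x y / x `|` y},
          {morph f : x y / himp x y}, f \bot = \bot & f \top = \top]
  end.

Definition base_closed (d : Order.disp_t) (k : kind) :
    forall A : base d k, set A -> Prop :=
  match k with
  | Posets => fun (A : porderType d) (X : set A) => True
  | MeetSemilattices => fun (A : meetSemilatticeType d) (X : set A) =>
      forall x y, X x -> X y -> X (x `&` y)
  | JoinSemilattices => fun (A : joinSemilatticeType d) (X : set A) =>
      forall x y, X x -> X y -> X (x `|` y)
  | Lattices => fun (A : latticeType d) (X : set A) =>
      (forall x y, X x -> X y -> X (x `&` y)) /\
      (forall x y, X x -> X y -> X (x `|` y))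
  | BooleanAlgebras => fun (A : ctbDistrLatticeType d) (X : set A) =>
      [/\ forall x y, X x -> X y -> X (x `&` y),
          forall x y, X x -> X y -> X (x `|` y),
          forall x, X x -> X (~` x), X \bot & X \top]
  | HeytingAlgebras => fun (A : heytingType d) (X : set A) =>
      [/\ forall x y, X x -> X y -> X (x `&` y),
          forall x y, X x -> X y -> X (x `|` y),
          forall x y, X x -> X y -> X (himp x y), X \bot & X \top]
  end.

(* Lattice terms in the variables x_1, ..., x_i. *)
Inductive lterm (i : nat) :=
  | LVar of 'I_i
  | LMeet of lterm i & lterm i
  | LJoin of lterm i & lterm i.

Fixpoint lterm_eval (d : Order.disp_t) (L : latticeType d) (i : nat)
    (v : 'I_i -> L) (t : lterm i) : L :=
  match t with
  | LVar p => v p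
  | LMeet t1 t2 => lterm_eval v t1 `&` lterm_eval v t2
  | LJoin t1 t2 => lterm_eval v t1 `|` lterm_eval v t2
  end.

(* t(v) <= y; the last case is a dummy, excluded by [admissible] below. *)
Definition lterm_le (d : Order.disp_t) (k : kind) :
    forall (A : base d k) (i : nat), lterm i -> ('I_i -> A) -> A -> Prop :=
  match k with
  | Lattices => fun (A : latticeType d) i t (v : 'I_i -> A) y =>
      lterm_eval v t <= y
  | BooleanAlgebras => fun (A : ctbDistrLatticeType d) i t (v : 'I_i -> A) y =>
      lterm_eval v t <= y
  | HeytingAlgebras => fun (A : heytingType d) i t (v : 'I_i -> A) y =>
      lterm_eval v t <= y
  | _ => fun _ _ _ _ _ => False
  end.

Inductive property :=
  | A1e | A1c | A2 | A2e | A2c | A3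
  | B1 | B1e | B1c | B2 | B3 | B4 | B5
  | C1 (i j n : nat)
  | C2 (i j n h : nat)
  | C3 (i j n : nat) (le_i_n : (i <= n)%N) (t : lterm i).

Definition arity (w : property) : nat :=
  match w with
  | C1 _ _ n | C2 _ _ n _ | C3 _ _ n _ _ => n
  | _ => 1
  end.

(* The side conditions on the parameters, and the restriction of (C3) to the
   lattice-ordered classes. *)
Definition admissible (k : kind) (w : property) : bool :=
  match w with
  | C1 i j n => (0 < n)%N && (i + j <= n)%N
  | C2 i j n h => [&& (0 < n)%N, (i + j <= n)%N & (h <= i)%N]
  | C3 i j n _ _ => [&& (0 < n)%N, (i + j <= n)%N & lattice_ordered k]
  | _ => true
  end.

Section OperationProperties.
Variables (d : Order.disp_t) (T : porderType d).

Definition extensive (K : T -> T) := forall x, x <= K x.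
Definition contractive (K : T -> T) := forall x, K x <= x.
Definition isotone (K : T -> T) := {homo K : x y / x <= y}.
Definition antitone (K : T -> T) := {homo K : x y /~ x <= y}.

Definition isotone_at (n : nat) (F : n.-tuple T -> T) (p : 'I_n) :=
  forall x y : n.-tuple T,
    (forall q, q != p -> tnth x q = tnth y q) ->
    tnth x p <= tnth y p -> F x <= F y.

Definition antitone_at (n : nat) (F : n.-tuple T -> T) (p : 'I_n) :=
  forall x y : n.-tuple T,
    (forall q, q != p -> tnth x q = tnth y q) ->
    tnth x p <= tnth y p -> F y <= F x.

Definition monotone_pattern (i j n : nat) (F : n.-tuple T -> T) :=
  (forall p : 'I_n, (p < i)%N -> isotone_at F p) /\
  (forall p : 'I_n, (n - j <= p)%N -> antitone_at F p).

End OperationProperties.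

Definition satisfies (d : Order.disp_t) (k : kind) (A : base d k)
    (w : property) : ((arity w).-tuple A -> A) -> Prop :=
  match w with
  | A1e => fun F => let K x := F [tuple x] in extensive K
  | A1c => fun F => let K x := F [tuple x] in contractive K
  | A2 => fun F => let K x := F [tuple x] in idempotent_fun K
  | A2e => fun F => let K x := F [tuple x] in idempotent_fun K /\ extensive K
  | A2c => fun F => let K x := F [tuple x] in idempotent_fun K /\ contractive K
  | A3 => fun F => let K x := F [tuple x] in involutive K
  | B1 => fun F => let K x := F [tuple x] in isotone K
  | B1e => fun F => let K x := F [tuple x] in isotone K /\ extensive K
  | B1c => fun F => let K x := F [tuple x] in isotone K /\ contractive K
  | B2 => fun F => let K x := F [tuple x] in isotone K /\ idempotent_fun K
  | B3 => fun F => let K x := F [tuple x] in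
      [/\ isotone K, extensive K & idempotent_fun K]
  | B4 => fun F => let K x := F [tuple x] in
      [/\ isotone K, contractive K & idempotent_fun K]
  | B5 => fun F => let K x := F [tuple x] in antitone K
  | C1 i j n => fun F => monotone_pattern i j F
  | C2 i j n h => fun F => monotone_pattern i j F /\
      forall (x : n.-tuple A) (p : 'I_n), (p < h)%N -> tnth x p <= F x
  | C3 i j n le_i_n t => fun F => monotone_pattern i j F /\
      forall x : n.-tuple A, lterm_le t (fun p => tnth x (widen_ord le_i_n p)) (F x)
  end.

(* Expansions of members of the class k by a family of operations. *)
Record expansion (d : Order.disp_t) (k : kind) (I : Type) (ar : I -> nat) :=
  Expansion {
    reduct :> base d k;
    op : forall i : I, (ar i).-tuple reduct -> reduct
  }.

Arguments op {d k I ar} A i x : rename.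

Section Structures.
Variables (d : Order.disp_t) (k : kind) (I : Type) (ar : I -> nat).
Notation str := (expansion d k ar).
Implicit Types (A B C D M N E : str) (H : str -> Prop).

Definition embedding A B (f : A -> B) : Prop :=
  [/\ {mono f : x y / x <= y},
      base_morphism f &
      forall i (x : (ar i).-tuple A), f (op A i x) = op B i (map_tuple f x)].

Definition subuniverse A (X : set A) : Prop :=
  base_closed X /\
  forall i (x : (ar i).-tuple A), (forall p, X (tnth x p)) -> X (op A i x).

Definition generated A (G : set A) : set A := smallest (@subuniverse A) G.

Definition finitely_generated A : Prop :=
  exists G : set A, finite_set G /\ generated G = setT.

(* Inclusions are represented by embeddings: C \subseteq A and C \subseteq B
   by f and g, A \subseteq D and B \subseteq D by f' and g'.  The last clause
   says that inside D the sets A and B meet only in C. *)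
Definition amalgam A B C (f : C -> A) (g : C -> B)
    D (f' : A -> D) (g' : B -> D) : Prop :=
  [/\ embedding f', embedding g', f' \o f =1 g' \o g &
      forall a b, f' a = g' b -> exists c, f c = a /\ g c = b].

Definition strong_amalgamation H : Prop :=
  forall A B C (f : C -> A) (g : C -> B),
    H A -> H B -> H C -> embedding f -> embedding g ->
    exists D (f' : A -> D) (g' : B -> D), H D /\ amalgam f g f' g'.

Definition superamalgamation H : Prop :=
  forall A B C (f : C -> A) (g : C -> B),
    H A -> H B -> H C -> embedding f -> embedding g ->
    exists D (f' : A -> D) (g' : B -> D),
      [/\ H D, amalgam f g f' g' &
        forall a b, ~ range f a -> ~ range g b ->
          (f' a <= g' b -> exists c, a <= f c /\ g c <= b) /\
          (g' b <= f' a -> exists c, b <= g c /\ f c <= a)].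

Definition age M : str -> Prop := fun A =>
  finitely_generated A /\ exists f : A -> M, embedding f.

(* An isomorphism between finitely generated substructures of M is presented
   as a pair of embeddings of one structure A, namely f a |-> g a. *)
Definition homogeneous M : Prop :=
  forall A (f g : A -> M), finitely_generated A ->
    embedding f -> embedding g ->
    exists h : M -> M, [/\ embedding h, bijective h & h \o f =1 g].

Definition universal H M : Prop :=
  forall N, countable [set: N] -> (forall A, age N A -> H A) ->
    exists f : N -> M, embedding f.

Definition fraisse_limit H M : Prop :=
  [/\ countable [set: M], universal H M, homogeneous M &
      forall A, age M A <-> H A].

Definition has_fraisse_limit H : Prop := exists M, fraisse_limit H M.

Definition finite_members H : str -> Prop := fun A =>
  H A /\ finite_set [set: A].

(* The substructure of A generated by the empty set is isomorphic to E. *)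
Definition zero_generated_part E A : Prop :=
  exists f : E -> A, embedding f /\ range f = generated (set0 : set A).

Definition with_zero_generated_part E H : str -> Prop := fun A =>
  H A /\ zero_generated_part E A.

(* For Boolean and Heyting algebras the structure E is fixed beforehand; the
   nonemptiness proviso says that E does occur as the zero-generated part of
   some finite member (no structure has an empty age). *)
Definition finite_members_have_fraisse_limit H : Prop :=
  match k with
  | BooleanAlgebras | HeytingAlgebras =>
      forall E,
        (exists A, finite_members (with_zero_generated_part E H) A) ->
        has_fraisse_limit (finite_members (with_zero_generated_part E H))
  | _ => has_fraisse_limit (finite_members H)
  end.

End Structures.

(* The class of expansions of members of k by operations op_i, i : I, where
   op_i satisfies (W i), and op_i x <= op_j x for all x whenever cmp i j.
   Since the arities of op_i and op_j agree only propositionally, the common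
   argument is given by two tuples with the same underlying sequence. *)
Definition expansion_class (d : Order.disp_t) (k : kind) (I : Type)
    (W : I -> property) (cmp : I -> I -> Prop) :
    expansion d k (fun i => arity (W i)) -> Prop := fun A =>
  (forall i, @satisfies d k A (W i) (op A i)) /\
  (forall i j, cmp i j ->
     forall (x : (arity (W i)).-tuple A) (y : (arity (W j)).-tuple A),
       tval x = tval y -> op A i x <= op A j y).

(* S^(W): one added operation satisfying (W). *)
Definition single_class (d : Order.disp_t) (k : kind) (w : property) :
    expansion d k (fun _ : unit => arity w) -> Prop :=
  @expansion_class d k unit (fun _ => w) (fun _ _ => False).

(* Main.v *)
From HB Require Import structures.
Require Import Defs.
From mathcomp Require Import all_boot all_order.
From mathcomp Require Import boolp classical_sets functions cardinality.

(** Every operation of a base (meet, join, relative pseudocomplement, bottom,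
top, complement) is determined by the order.  So a base of a given kind is
just a partial order in which certain elements, described by the order, exist
([value_of], [realize]), and an embedding of bases is an order embedding that
preserves the descriptions.  Amalgams, substructures and unions of chains can
then be built as bare orders.

_Superamalgamation of the bases._  Let [C] embed in [A] and [B].  The disjoint
union of [A] and [B] carries the preorder where [a] lies below [b] iff some
element of [C] lies between them.  The embeddings of [A] and [B] in it keep the
meets and the joins that are operations of the kind, and the completion by cuts
keeps all meets and joins; this treats posets, semilattices and lattices
([cut_amalgam]).  For Boolean and Heyting algebras one takes instead the
upsets of the set of pairs of a prime filter of [A] and a prime filter of [B]
with the same trace on [C] ([upset_amalgam]).  In both cases the amalgam [D] is
a complete lattice, it is finite if [A] and [B] are, and an inequality in [D]
between elements of [A] and of [B] is witnessed by an element of [C].  This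
interpolation also gives that [A] and [B] meet only in [C]; completeness and
interpolation are what extending the operations takes.

_Extending operations._  If the property says nothing on monotonicity, the new
operation acts as given on [A] and on [B] and fixes every other element.
Otherwise an operation on [D] is obtained as the supremum of the values that
[A], [B] and the prescribed lower bounds force below it ([join_ext]); by
interpolation it takes the old values on [A] and on [B].  An idempotent
operation needs one more step: replace the value by the least element above it
that the operation does not raise ([closure_ext]).  These formulas depend
monotonically on the given operations, which takes care of the comparability
conditions ([extend_op_mono]).  All properties are brought to the same shape
for this purpose ([normal_form]).

_Limits._  There are only countably many finite structures up to isomorphism
when finitely many operations are added.  A chain of finite structures that
solves all amalgamation problems has a union with the extension property
([rich_limit]), and back-and-forth makes it homogeneous and universal
([fraisse]).  The joint embedding property is amalgamation over a structure
that embeds in all members: the empty structure if there are no constants, and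
the fixed part generated by the constants for Boolean and Heyting algebras. *)

Set Implicit Arguments.
Unset Strict Implicit.
Unset Printing Implicit Defensive.

Import Order.Theory.
Local Open Scope classical_set_scope.
Local Open Scope order_scope.

(** * The order of a base determines its operations *)

Inductive base_symbol := SMeet | SJoin | SImp | SBot | STop | SCompl.

(** A Boolean algebra also counts the implication among its symbols: it is
preserved by all Boolean embeddings, and its existence replaces the
distributive law. *)
Definition has_sym (k : kind) (s : base_symbol) : bool :=
  match k, s with
  | MeetSemilattices, SMeet | JoinSemilattices, SJoin
  | Lattices, (SMeet | SJoin) | BooleanAlgebras, _ => true
  | HeytingAlgebras, SCompl => false
  | HeytingAlgebras, _ => true
  | _, _ => false
  end.

Definition sym_arity (s : base_symbol) : nat :=
  match s with
  | SMeet | SJoin | SImp => 2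
  | SCompl => 1
  | SBot | STop => 0
  end.

(** The order-theoretic description of each operation.  The implication and
the complement are described without meets and bottoms, and the complement is
a pseudocomplement whose join with the given element is the top; stated so,
values are unique in every partial order. *)
Definition value_of (T : Type) (le : T -> T -> Prop) (s : base_symbol)
    (xs : seq T) (z : T) : Prop :=
  match s, xs with
  | SMeet, [:: x; y] => forall w, le w z <-> le w x /\ le w y
  | SJoin, [:: x; y] => forall w, le z w <-> le x w /\ le y w
  | SImp, [:: x; y] =>
      forall w, le w z <-> (forall v, le v w -> le v x -> le v y)
  | SBot, [::] => forall w, le z w
  | STop, [::] => forall w, le w z
  | SCompl, [:: x] =>
      (forall w, le w z <-> (forall v, le v w -> le v x -> forall u, le v u)) /\
      (forall w, le x w -> le z w -> forall u, le u w)
  | _, _ => False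
  end.

Definition has_values (T : Type) (le : T -> T -> Prop) (k : kind) : Prop :=
  forall s xs, has_sym k s -> size xs = sym_arity s ->
    exists z, value_of le s xs z.

Definition ole (d : Order.disp_t) (A : porderType d) (x y : A) : Prop := x <= y.
Arguments ole {d A} x y.

Record is_order (T : Type) (le : T -> T -> Prop) : Prop := IsOrder {
  ord_refl : forall x, le x x;
  ord_trans : forall y x z, le x y -> le y z -> le x z;
  ord_anti : forall x y, le x y -> le y x -> x = y }.

Lemma ole_order (d : Order.disp_t) (A : porderType d) : is_order (@ole d A).
Proof.
split=> [x|y x z|x y]; first exact: lexx; first exact: le_trans.
by rewrite /ole => xy yx; apply/le_anti/andP.
Qed.

Lemma value_of_size (T : Type) (le : T -> T -> Prop) s xs z :
  value_of le s xs z -> size xs = sym_arity s.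
Proof. by case: s; case: xs => [|x [|y [|? ?]]] //= []. Qed.

Lemma value_of_uniq (T : Type) (le : T -> T -> Prop) s xs z z' :
  is_order le -> value_of le s xs z -> value_of le s xs z' -> z = z'.
Proof.
move=> ord; have [r t a] := ord.
have down (P : T -> Prop) : (forall w, le w z <-> P w) ->
    (forall w, le w z' <-> P w) -> z = z'.
  by move=> h h'; apply: a; [apply/h'/h | apply/h/h'].
have up (P : T -> Prop) : (forall w, le z w <-> P w) ->
    (forall w, le z' w <-> P w) -> z = z'.
  by move=> h h'; apply: a; [apply/h/h' | apply/h'/h].
case: s; case: xs => [|x [|y [|? ?]]] //=; try (exact: down); try (exact: up).
- by move=> h h'; apply: a.
- by move=> h h'; apply: a.
- by case=> h _ [h' _]; exact: down h h'.
Qed.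

Section ExplicitValues.
Variable d : Order.disp_t.

Lemma meet_value (L : meetSemilatticeType d) (x y : L) :
  value_of ole SMeet [:: x; y] (x `&` y).
Proof. by move=> w; rewrite /ole lexI; split=> /andP. Qed.

Lemma join_value (L : joinSemilatticeType d) (x y : L) :
  value_of ole SJoin [:: x; y] (x `|` y).
Proof. by move=> w; rewrite /ole leUx; split=> /andP. Qed.

Lemma bot_value (L : bPOrderType d) : value_of ole SBot [::] (\bot : L).
Proof. by move=> w; exact: le0x. Qed.

Lemma top_value (L : tPOrderType d) : value_of ole STop [::] (\top : L).
Proof. by move=> w; exact: lex1. Qed.

Lemma residual_value (L : meetSemilatticeType d) (x y z : L) :
  (forall w, (w <= z) = (w `&` x <= y)) -> value_of ole SImp [:: x; y] z.
Proof.
move=> h w; rewrite /ole h; split=> [wxy v vw vx|]; last first.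
  by apply; [exact: leIl | exact: leIr].
by apply: le_trans wxy; rewrite lexI vw.
Qed.

Lemma himp_value (L : heytingType d) (x y : L) :
  value_of ole SImp [:: x; y] (himp x y).
Proof. by apply: residual_value => w; rewrite le_himp. Qed.

Lemma bool_residual (L : ctbDistrLatticeType d) (x y w : L) :
  (w <= ~` x `|` y) = (w `&` x <= y).
Proof.
apply/idP/idP => h.
  apply: (@le_trans _ _ ((~` x `|` y) `&` x)); first exact: leI2.
  by rewrite meetUl meetCx join0x leIl.
rewrite -[w]meetx1 -(joinxC x) meetUr leUx.
rewrite (le_trans h) ?leUr //=.
by apply: le_trans (leIr _ _) _; exact: leUl.
Qed.

(** In a Boolean algebra the material implication is residual to the meet. *)
Lemma bool_imp_value (L : ctbDistrLatticeType d) (x y : L) :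
  value_of ole SImp [:: x; y] (~` x `|` y).
Proof. by apply: residual_value => w; rewrite bool_residual. Qed.

Lemma compl_value (L : ctbDistrLatticeType d) (x : L) :
  value_of ole SCompl [:: x] (~` x).
Proof.
split=> w; rewrite /ole.
  rewrite -[~` x]joinx0 bool_residual; split=> [h v vw vx u|h].
    by apply: le_trans (le0x u); apply: le_trans h; rewrite lexI vw.
  by apply: h; [exact: leIl | exact: leIr].
move=> h h' u; apply: le_trans (lex1 u) _.
by rewrite -(joinxC x) leUx h.
Qed.

End ExplicitValues.

Section BaseAsOrder.
Variables (d : Order.disp_t) (k : kind).

Lemma base_has_values (A : base d k) : has_values (@ole d A) k.
Proof.
move: A; case: k => A s [|x [|y [|z xs]]]; case: s => //= _ _.
all: by eexists; (exact: meet_value || exact: join_value || exact: himp_value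
  || exact: bot_value || exact: top_value || exact: bool_imp_value
  || exact: compl_value).
Qed.

(** As values are unique, preserving the operations is the same as
preserving their order-theoretic descriptions. *)
Lemma base_morphismP (A B : base d k) (f : A -> B) :
  base_morphism f <->
  (forall s xs z, has_sym k s -> value_of ole s xs z ->
     value_of ole s (map f xs) (f z)).
Proof.
have toB (s : base_symbol) (xs : seq A) (z z0 : A) (w : B) :
    value_of ole s xs z0 -> value_of ole s (map f xs) w -> f z0 = w ->
    value_of ole s xs z -> value_of ole s (map f xs) (f z).
  by move=> h0 hw e h; rewrite (value_of_uniq (ole_order A) h h0) e.
have eqB (s : base_symbol) (xs : seq A) (z0 : A) (w : B) :
    value_of ole s xs z0 -> value_of ole s (map f xs) w ->
    (forall z, value_of ole s xs z -> value_of ole s (map f xs) (f z)) ->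
    f z0 = w.
  by move=> h0 hw h; apply: (value_of_uniq (ole_order B)) (h _ h0) hw.
move: A B f toB eqB; case: k => A B f toB eqB; split=> //=.
- move=> fM [] [|x [|y [|? ?]]] z //= _.
  by apply: (toB SMeet [:: x; y] z (x `&` y)); [exact: meet_value..|exact: fM].
- move=> h x y; apply: (eqB SMeet [:: x; y]); [exact: meet_value..|].
  by move=> z; apply: h.
- move=> fJ [] [|x [|y [|? ?]]] z //= _.
  by apply: (toB SJoin [:: x; y] z (x `|` y)); [exact: join_value..|exact: fJ].
- move=> h x y; apply: (eqB SJoin [:: x; y]); [exact: join_value..|].
  by move=> z; apply: h.
- move=> [fM fJ] [] [|x [|y [|? ?]]] z //= _.
    by apply: (toB SMeet [:: x; y] z (x `&` y)); [exact: meet_value..|exact: fM].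
  by apply: (toB SJoin [:: x; y] z (x `|` y)); [exact: join_value..|exact: fJ].
- move=> h; split=> x y.
    apply: (eqB SMeet [:: x; y]); [exact: meet_value..|].
    by move=> z; apply: h.
  apply: (eqB SJoin [:: x; y]); [exact: join_value..|].
  by move=> z; apply: h.
- move=> [fM fJ fC f0 f1] [] [|x [|y [|? ?]]] z //= _.
  + by apply: (toB SMeet [:: x; y] z (x `&` y)); [exact: meet_value..|exact: fM].
  + by apply: (toB SJoin [:: x; y] z (x `|` y)); [exact: join_value..|exact: fJ].
  + apply: (toB SImp [:: x; y] z (~` x `|` y)); [exact: bool_imp_value..|].
    by rewrite fJ fC.
  + by apply: (toB SBot [::] z _ _); [exact: bot_value..|exact: f0].
  + by apply: (toB STop [::] z _ _); [exact: top_value..|exact: f1].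
  + by apply: (toB SCompl [:: x] z (~` x)); [exact: compl_value..|exact: fC].
- move=> h; split=> [x y|x y|x||].
  + apply: (eqB SMeet [:: x; y]); [exact: meet_value..|].
    by move=> z; apply: h.
  + apply: (eqB SJoin [:: x; y]); [exact: join_value..|].
    by move=> z; apply: h.
  + apply: (eqB SCompl [:: x]); [exact: compl_value..|].
    by move=> z; apply: h.
  + apply: (eqB SBot [::]); [exact: bot_value..|].
    by move=> z; apply: (h SBot [::]).
  + apply: (eqB STop [::]); [exact: top_value..|].
    by move=> z; apply: (h STop [::]).
- move=> [fM fJ fI f0 f1] [] [|x [|y [|? ?]]] z //= _.
  + by apply: (toB SMeet [:: x; y] z (x `&` y)); [exact: meet_value..|exact: fM].
  + by apply: (toB SJoin [:: x; y] z (x `|` y)); [exact: join_value..|exact: fJ].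
  + by apply: (toB SImp [:: x; y] z (himp x y)); [exact: himp_value..|exact: fI].
  + by apply: (toB SBot [::] z _ _); [exact: bot_value..|exact: f0].
  + by apply: (toB STop [::] z _ _); [exact: top_value..|exact: f1].
- move=> h; split=> [x y|x y|x y||].
  + apply: (eqB SMeet [:: x; y]); [exact: meet_value..|].
    by move=> z; apply: h.
  + apply: (eqB SJoin [:: x; y]); [exact: join_value..|].
    by move=> z; apply: h.
  + apply: (eqB SImp [:: x; y]); [exact: himp_value..|].
    by move=> z; apply: h.
  + apply: (eqB SBot [::]); [exact: bot_value..|].
    by move=> z; apply: (h SBot [::]).
  + apply: (eqB STop [::]); [exact: top_value..|].
    by move=> z; apply: (h STop [::]).
Qed.

Lemma base_closedP (A : base d k) (X : set A) :
  base_closed X <->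
  (forall s xs z, has_sym k s -> value_of ole s xs z ->
     (forall x, x \in xs -> X x) -> X z).
Proof.
have toX (s : base_symbol) (xs : seq A) (z z0 : A) :
    value_of ole s xs z0 -> X z0 -> value_of ole s xs z -> X z.
  by move=> h0 Xz0 h; rewrite (value_of_uniq (ole_order A) h h0).
have two (x y : A) : X x -> X y -> forall u, u \in [:: x; y] -> X u.
  by move=> Xx Xy u; rewrite !inE => /orP[] /eqP->.
have one (x : A) : X x -> forall u, u \in [:: x] -> X u.
  by move=> Xx u; rewrite !inE => /eqP->.
have two' (x y : A) : (forall u, u \in [:: x; y] -> X u) -> X x /\ X y.
  by move=> h; split; apply: h; rewrite !inE eqxx ?orbT.
have one' (x : A) : (forall u, u \in [:: x] -> X u) -> X x.
  by apply; rewrite inE.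
move: A X toX two one two' one'; case: k => A X toX two one two' one'; split=> //=.
- move=> fM [] [|x [|y [|? ?]]] z //= _ hz /two'[Xx Xy].
  by apply: (toX SMeet [:: x; y] _ _ _ _ hz); [exact: meet_value|exact: fM].
- by move=> h x y /two /[apply]; apply: (h SMeet) => //; exact: meet_value.
- move=> fM [] [|x [|y [|? ?]]] z //= _ hz /two'[Xx Xy].
  by apply: (toX SJoin [:: x; y] _ _ _ _ hz); [exact: join_value|exact: fM].
- by move=> h x y /two /[apply]; apply: (h SJoin) => //; exact: join_value.
- move=> [fM fJ] [] [|x [|y [|? ?]]] z //= _ hz /two'[Xx Xy].
    by apply: (toX SMeet [:: x; y] _ _ _ _ hz); [exact: meet_value|exact: fM].
  by apply: (toX SJoin [:: x; y] _ _ _ _ hz); [exact: join_value|exact: fJ].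
- move=> h; split=> x y /two /[apply].
    by apply: (h SMeet) => //; exact: meet_value.
  by apply: (h SJoin) => //; exact: join_value.
- move=> [fM fJ fC f0 f1] [] [|x [|y [|? ?]]] z //= _ hz.
  + case/two'=> Xx Xy.
    by apply: (toX SMeet [:: x; y] _ _ _ _ hz); [exact: meet_value|exact: fM].
  + case/two'=> Xx Xy.
    by apply: (toX SJoin [:: x; y] _ _ _ _ hz); [exact: join_value|exact: fJ].
  + case/two'=> Xx Xy.
    apply: (toX SImp [:: x; y] _ _ _ _ hz); [exact: bool_imp_value|].
    by apply: fJ => //; exact: fC.
  + by move=> _; apply: (toX SBot [::] _ _ _ _ hz); [exact: bot_value|].
  + by move=> _; apply: (toX STop [::] _ _ _ _ hz); [exact: top_value|].
  + move/one'=> Xx.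
    by apply: (toX SCompl [:: x] _ _ _ _ hz); [exact: compl_value|exact: fC].
- move=> h; split=> [x y|x y|x||].
  + by move=> /two /[apply]; apply: (h SMeet) => //; exact: meet_value.
  + by move=> /two /[apply]; apply: (h SJoin) => //; exact: join_value.
  + by move=> /one; apply: (h SCompl) => //; exact: compl_value.
  + by apply: (h SBot [::]) => //; exact: bot_value.
  + by apply: (h STop [::]) => //; exact: top_value.
- move=> [fM fJ fI f0 f1] [] [|x [|y [|? ?]]] z //= _ hz.
  + case/two'=> Xx Xy.
    by apply: (toX SMeet [:: x; y] _ _ _ _ hz); [exact: meet_value|exact: fM].
  + case/two'=> Xx Xy.
    by apply: (toX SJoin [:: x; y] _ _ _ _ hz); [exact: join_value|exact: fJ].
  + case/two'=> Xx Xy.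
    by apply: (toX SImp [:: x; y] _ _ _ _ hz); [exact: himp_value|exact: fI].
  + by move=> _; apply: (toX SBot [::] _ _ _ _ hz); [exact: bot_value|].
  + by move=> _; apply: (toX STop [::] _ _ _ _ hz); [exact: top_value|].
- move=> h; split=> [x y|x y|x y||].
  + by move=> /two /[apply]; apply: (h SMeet) => //; exact: meet_value.
  + by move=> /two /[apply]; apply: (h SJoin) => //; exact: join_value.
  + by move=> /two /[apply]; apply: (h SImp) => //; exact: himp_value.
  + by apply: (h SBot [::]) => //; exact: bot_value.
  + by apply: (h STop [::]) => //; exact: top_value.
Qed.

End BaseAsOrder.

Section Realization.
Variables (d : Order.disp_t) (T : Type) (le : T -> T -> Prop).
Hypothesis ord : is_order le.

Let leb : rel T := fun x y => `[< le x y >].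

Let leb_refl : reflexive leb.
Proof. by move=> x; apply/asboolP; exact: ord_refl. Qed.

Let leb_anti : antisymmetric leb.
Proof. by move=> x y /andP[/asboolP xy /asboolP]; exact: ord_anti. Qed.

Let leb_trans : transitive leb.
Proof.
by move=> y x z /asboolP xy /asboolP yz; apply/asboolP; exact: ord_trans yz.
Qed.

Let TC : choiceType := HB.pack T (gen_eqMixin T) (gen_choiceMixin T).

Let P : porderType d :=
  HB.pack T TC (Order.Le_isPOrder.Build d TC leb_refl leb_anti leb_trans).

Let leP (x y : P) : reflect (le x y) (x <= y).
Proof. exact: asboolP. Qed.

Let opval (k : kind) (s : base_symbol) : has_values le k -> has_sym k s ->
  sym_arity s = 2 ->
  {op : P -> P -> P & forall x y, value_of le s [:: x; y] (op x y)}.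
Proof.
move=> ex ks s2; have [|op opP] :=
    @choice (P * P) P (fun p z => value_of le s [:: p.1; p.2] z).
  by move=> [x y]; apply: ex.
by exists (fun x y => op (x, y)) => x y; exact: opP (x, y).
Qed.

Let lexI_of (m : P -> P -> P) :
  (forall x y, value_of le SMeet [:: x; y] (m x y)) ->
  forall x y z, (x <= m y z) = (x <= y) && (x <= z).
Proof.
by move=> mP x y z; apply/leP/andP => [/mP[/leP ? /leP]|[/leP ? /leP ?]]//; apply/mP.
Qed.

Let leUx_of (j : P -> P -> P) :
  (forall x y, value_of le SJoin [:: x; y] (j x y)) ->
  forall x y z, (j x y <= z) = (x <= z) && (y <= z).
Proof.
by move=> jP x y z; apply/leP/andP => [/jP[/leP ? /leP]|[/leP ? /leP ?]]//; apply/jP.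
Qed.

(** The operations are chosen among the elements that exist by hypothesis.
The map [phi] stands for an identity: the carrier of the result is [T] for
each concrete kind, but this equality cannot be stated for a variable kind. *)
Lemma realize (k : kind) : has_values le k ->
  exists (A : base d k) (phi : T -> A),
    bijective phi /\ forall x y, ole (phi x) (phi y) <-> le x y.
Proof.
have bij : bijective (fun x : T => x) by exists id.
have eqv (x y : P) : ole x y <-> le x y by split=> /leP.
case: k => ex; have val s := @opval _ s ex.
- by exists P, id.
- have [m mP] := val SMeet erefl erefl.
  pose L : meetSemilatticeType d :=
    HB.pack T P (Order.POrder_isMeetSemilattice.Build d P (lexI_of mP)).
  by exists L, id.
- have [j jP] := val SJoin erefl erefl.
  pose L : joinSemilatticeType d :=
    HB.pack T P (Order.POrder_isJoinSemilattice.Build d P (leUx_of jP)).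
  by exists L, id.
- have [m mP] := val SMeet erefl erefl.
  have [j jP] := val SJoin erefl erefl.
  pose L : latticeType d :=
    HB.pack T P (Order.POrder_isMeetSemilattice.Build d P (lexI_of mP))
      (Order.POrder_isJoinSemilattice.Build d P (leUx_of jP)).
  by exists L, id.
- have [m mP] := val SMeet erefl erefl.
  have [j jP] := val SJoin erefl erefl.
  have [i iP] := val SImp erefl erefl.
  have [b bP] := ex SBot [::] erefl erefl.
  have [t tP] := ex STop [::] erefl erefl.
  have [c cP] := choice (fun x : P => ex SCompl [:: x] erefl erefl).
  have bP' x : (b : P) <= x by apply/leP/bP.
  have tP' x : x <= (t : P) by apply/leP/tP.
  pose L : tbLatticeType d :=
    HB.pack T P (Order.POrder_isMeetSemilattice.Build d P (lexI_of mP))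
      (Order.POrder_isJoinSemilattice.Build d P (leUx_of jP))
      (Order.hasBottom.Build d P bP') (Order.hasTop.Build d P tP').
  have res (x y w : L) : (w <= i x y) = (w `&` x <= y).
    apply/leP/idP => [/iP h|h].
      by apply/leP/h; apply/leP; [exact: (@leIl _ L) | exact: (@leIr _ L)].
    apply/iP => v /leP vw /leP vx; apply/leP; apply: le_trans h.
    by rewrite (@lexI _ L); apply/andP.
  have meetUl : @left_distributive L L Order.meet Order.join.
    move=> x y z; apply/le_anti/andP; split; last first.
      by rewrite leUx !leI2 ?leUl ?leUr.
    by rewrite -res leUx !res leUl leUr.
  pose D : tbDistrLatticeType d :=
    HB.pack T L (Order.Lattice_Meet_isDistrLattice.Build d L meetUl).
  have joinC (x : D) : x `|` c x = \top.
    apply: le_anti; rewrite lex1 /=; apply/leP.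
    by apply: (cP x).2; apply/leP; [exact: (@leUl _ D) | exact: (@leUr _ D)].
  have meetC (x : D) : x `&` c x = \bot.
    apply: le_anti; rewrite le0x andbT; apply/leP.
    have /((cP x).1 (c x)) h : le (c x) (c x) by exact: ord_refl.
    by apply: h; apply/leP; [exact: (@leIr _ D) | exact: (@leIl _ D)].
  pose B : ctbDistrLatticeType d :=
    HB.pack T D (Order.TBDistrLattice_hasComplement.Build d D joinC meetC).
  by exists B, id.
- have [m mP] := val SMeet erefl erefl.
  have [j jP] := val SJoin erefl erefl.
  have [i iP] := val SImp erefl erefl.
  have [b bP] := ex SBot [::] erefl erefl.
  have [t tP] := ex STop [::] erefl erefl.
  have bP' x : (b : P) <= x by apply/leP/bP.
  have tP' x : x <= (t : P) by apply/leP/tP.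
  pose L : tbLatticeType d :=
    HB.pack T P (Order.POrder_isMeetSemilattice.Build d P (lexI_of mP))
      (Order.POrder_isJoinSemilattice.Build d P (leUx_of jP))
      (Order.hasBottom.Build d P bP') (Order.hasTop.Build d P tP').
  have res (x y w : L) : (w <= i x y) = (w `&` x <= y).
    apply/leP/idP => [/iP h|h].
      by apply/leP/h; apply/leP; [exact: (@leIl _ L) | exact: (@leIr _ L)].
    apply/iP => v /leP vw /leP vx; apply/leP; apply: le_trans h.
    by rewrite (@lexI _ L); apply/andP.
  pose H : heytingType d :=
    HB.pack T L (hasHeytingImplication.Build d L res).
  by exists H, id.
Qed.

End Realization.

(** * Finite types *)

Local Open Scope classical_set_scope.

Section FiniteTypes.

Lemma finite_surj (T U : Type) (h : U -> T) :
  (forall t, exists u, h u = t) -> finite_set [set: U] -> finite_set [set: T].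
Proof.
move=> hs /(finite_image h); apply: sub_finite_set => t _.
by have [u <-] := hs t; exists u.
Qed.

Lemma finite_inj (T U : Type) (h : T -> U) :
  injective h -> finite_set [set: U] -> finite_set [set: T].
Proof.
move=> hi fU; have [[t0 _]|noT] := pselect (exists t : T, True); last first.
  by apply: sub_finite_set (finite_set0 T) => t; case: noT; exists t.
apply: (@finite_surj T U (fun u => if pselect (exists t, h t = u) is left e
   then projT1 (cid e) else t0)) fU => t; exists (h t).
case: pselect => [e|[]]; last by exists t.
by apply: hi; case: cid.
Qed.

Lemma finite_ordinal (T : Type) : finite_set [set: T] ->
  exists (n : nat) (h : 'I_n -> T), bijective h.
Proof.
elim/Pchoice: T => T /finite_seqP[s0 sT]; pose s := undup s0.
have sx x : x \in s by rewrite mem_undup; have : [set: T] x by []; rewrite sT.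
exists (size s), (tnth (in_tuple s)).
have si x : (index x s < size s)%N by rewrite index_mem.
exists (fun x => Ordinal (si x)) => [i|x].
  apply: val_inj => /=; rewrite (tnth_nth (tnth (in_tuple s) i)).
  by rewrite index_uniq ?undup_uniq.
by rewrite (tnth_nth x) /= nth_index.
Qed.

Lemma finite_sum (T U : Type) : finite_set [set: T] -> finite_set [set: U] ->
  finite_set [set: T + U].
Proof.
move=> fT fU; have : finite_set (inl @` [set: T] `|` inr @` [set: U] : set (T + U)).
  by rewrite finite_setU; split; exact: finite_image.
by apply: sub_finite_set => -[t|u] _; [left; exists t | right; exists u].
Qed.

Lemma finite_prod (T U : Type) : finite_set [set: T] -> finite_set [set: U] ->
  finite_set [set: T * U].
Proof. by move=> fT fU; rewrite -setXTT; exact: finite_setX. Qed.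

Lemma finite_powerset (T : Type) : finite_set [set: T] ->
  finite_set [set: set T].
Proof.
move=> /finite_ordinal[n [h [g gh hg]]].
apply: (@finite_surj _ {set 'I_n} (fun S => h @` [set` S])) => [X|]; last first.
  exact: finite_finset.
exists [set i | `[< X (h i) >]]%SET; apply/seteqP; split=> [_ [i iX <-]|x Xx].
  by move: iX; rewrite /= inE => /asboolP.
by exists (g x) => //=; rewrite inE hg; apply/asboolP.
Qed.

End FiniteTypes.

(** * Amalgams of ordered sets and their completion by cuts *)

Definition preserves_values (k : kind) (T U : Type) (leT : T -> T -> Prop)
    (leU : U -> U -> Prop) (f : T -> U) : Prop :=
  forall s xs z, has_sym k s -> value_of leT s xs z ->
    value_of leU s (map f xs) (f z).

Definition order_embedding (T U : Type) (leT : T -> T -> Prop)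
    (leU : U -> U -> Prop) (f : T -> U) : Prop :=
  forall x y, leU (f x) (f y) <-> leT x y.

Definition complete_order (T : Type) (le : T -> T -> Prop) : Prop :=
  forall X : set T, exists s, forall w, le s w <-> (forall x, X x -> le x w).

Lemma complete_inf (T : Type) (le : T -> T -> Prop) :
  is_order le -> complete_order le ->
  forall X : set T, exists i, forall w, le w i <-> (forall x, X x -> le w x).
Proof.
move=> [r t a] c X; have [i iP] := c [set w | forall x, X x -> le w x].
exists i => w; split=> [wi x Xx|wX].
  by apply: t wi _; apply/iP => v; apply.
by have /iP := r i; apply.
Qed.

(** An inequality between the two sides must pass through [C]; the
completeness is what makes room for extending operations. *)
Record base_amalgam (k : kind) (A B C : Type) (leA : A -> A -> Prop)
    (leB : B -> B -> Prop) (f : C -> A) (g : C -> B)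
    (D : Type) (le : D -> D -> Prop) (f' : A -> D) (g' : B -> D) : Prop :=
  BaseAmalgam {
    amalgam_order : is_order le;
    amalgam_values : has_values le k;
    amalgam_complete : complete_order le;
    amalgam_embl : order_embedding leA le f';
    amalgam_embr : order_embedding leB le g';
    amalgam_prel : preserves_values k leA le f';
    amalgam_prer : preserves_values k leB le g';
    amalgam_comm : forall c, f' (f c) = g' (g c);
    amalgam_interl : forall a b, le (f' a) (g' b) ->
      exists c, leA a (f c) /\ leB (g c) b;
    amalgam_interr : forall a b, le (g' b) (f' a) ->
      exists c, leB b (g c) /\ leA (f c) a;
    amalgam_finite : finite_set [set: A] -> finite_set [set: B] ->
      finite_set [set: D] }.

(** The Dedekind-MacNeille completion of a preorder; antisymmetry is not
assumed, so that amalgams need not be divided by an equivalence first. *)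
Section Cuts.
Variables (P : Type) (le : P -> P -> Prop).
Hypothesis le_refl : forall p, le p p.
Hypothesis le_trans : forall q p r, le p q -> le q r -> le p r.

Definition ubs (X : set P) : set P := [set u | forall x, X x -> le x u].
Definition lbs (X : set P) : set P := [set l | forall x, X x -> le l x].

Definition cut := {X : set P | lbs (ubs X) = X}.
Definition cut_le (X Y : cut) : Prop := sval X `<=` sval Y.

Lemma lbs_ubs_lbs (X : set P) : lbs (ubs (lbs X)) = lbs X.
Proof.
apply/seteqP; split=> [l lX x Xx|l lX u uX]; last exact: uX.
by apply: lX => v vX; exact: vX.
Qed.

Definition cut_lbs (X : set P) : cut := exist _ (lbs X) (lbs_ubs_lbs X).
Definition principal (p : P) : cut := cut_lbs (ubs [set p]).

Lemma principalP (p q : P) : sval (principal p) q <-> le q p.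
Proof.
split=> [|qp u /(_ p erefl) pu]; last exact: le_trans pu.
by apply=> x ->.
Qed.

Lemma cut_le_order : is_order cut_le.
Proof.
split=> [X //|Y X Z XY YZ x /XY /YZ //|[X cX] [Y cY] XY YX].
by apply: eq_exist; apply/seteqP.
Qed.

Lemma cut_inf (F : set cut) :
  exists i, forall W, cut_le W i <-> (forall X, F X -> cut_le W X).
Proof.
exists (cut_lbs [set u | exists X, F X /\ ubs (sval X) u]) => W; split.
  move=> Wi [X cX] FX x Wx /=; rewrite -cX => u uX.
  by apply: (Wi x Wx); exists (exist (fun X => lbs (ubs X) = X) X cX).
by move=> WX x Wx u [X [FX uX]]; apply: uX; exact: WX Wx.
Qed.

Lemma cut_complete : complete_order cut_le.
Proof.
move=> F; exists (cut_lbs (ubs [set x | exists X, F X /\ sval X x])) => W.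
split=> [sW X FX x Xx|FW].
  by apply: sW => u; apply; exists X.
case: W FW => W cW FW x xF; rewrite /= -cW => u uW.
by apply: xF => y [X [FX Xy]]; apply: uW; exact: (FW X FX y).
Qed.

Lemma principal_emb : order_embedding le cut_le principal.
Proof.
move=> p q; split=> [/(_ p)|pq x /principalP xp]; rewrite !principalP.
  by apply.
exact: le_trans pq.
Qed.

Lemma principal_meet x y z : value_of le SMeet [:: x; y] z ->
  value_of cut_le SMeet [:: principal x; principal y] (principal z).
Proof.
move=> zP W; split=> [Wz|[Wx Wy] w Ww].
  by split=> w /Wz; rewrite !principalP => /zP[].
apply/principalP/zP; split; apply/principalP; first exact: Wx.
exact: Wy.
Qed.

Lemma principal_join x y z : value_of le SJoin [:: x; y] z ->
  value_of cut_le SJoin [:: principal x; principal y] (principal z).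
Proof.
move=> zP W; split=> [zW|[xW yW] w /principalP wz].
  have [zx zy] : le x z /\ le y z by apply/zP.
  by split=> w /principalP ?; apply: zW; apply/principalP;
    [exact: le_trans zx | exact: le_trans zy].
case: W xW yW => W cW xW yW; rewrite /= -cW => u uW.
apply: le_trans wz _; apply/zP; split; apply: uW.
  by apply: xW; apply/principalP.
by apply: yW; apply/principalP.
Qed.

End Cuts.

Section CutAmalgam.
Variables (k : kind) (A B C : Type) (leA : A -> A -> Prop)
  (leB : B -> B -> Prop) (leC : C -> C -> Prop) (f : C -> A) (g : C -> B).
Hypotheses (ordA : is_order leA) (ordB : is_order leB).
Hypothesis kP : forall s, has_sym k s -> s = SMeet \/ s = SJoin.
Hypotheses (exC : has_values leC k).
Hypotheses (fe : order_embedding leC leA f) (ge : order_embedding leC leB g).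
Hypotheses (fp : preserves_values k leC leA f)
  (gp : preserves_values k leC leB g).

Definition sum_le (p q : A + B) : Prop :=
  match p, q with
  | inl a, inl a' => leA a a'
  | inr b, inr b' => leB b b'
  | inl a, inr b => exists c, leA a (f c) /\ leB (g c) b
  | inr b, inl a => exists c, leB b (g c) /\ leA (f c) a
  end.

Let rA := ord_refl ordA.
Let rB := ord_refl ordB.
Let tA := ord_trans ordA.
Let tB := ord_trans ordB.

Lemma sum_le_refl p : sum_le p p.
Proof. by case: p => /=. Qed.

Lemma sum_le_trans q p r : sum_le p q -> sum_le q r -> sum_le p r.
Proof.
case: p q r => [a|b] [a1|b1] [a2|b2] /=.
- exact: tA.
- by move=> aa1 [c [? ?]]; exists c; split=> //; exact: tA aa1 _.
- move=> [c [ac cb]] [c' [bc' c'a]]; apply: tA ac _; apply: tA c'a.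
  by apply/fe/ge; exact: tB bc'.
- by move=> [c [? cb]] bb; exists c; split=> //; exact: tB cb _.
- by move=> [c [? cb]] bb; exists c; split=> //; exact: tA cb _.
- move=> [c [ac cb]] [c' [bc' c'a]]; apply: tB ac _; apply: tB c'a.
  by apply/ge/fe; exact: tA bc'.
- by move=> aa1 [c [? ?]]; exists c; split=> //; exact: tB aa1 _.
- exact: tB.
Qed.

Let two (s : base_symbol) : s = SMeet \/ s = SJoin -> sym_arity s = 2.
Proof. by case=> ->. Qed.

Let exC2 s c c' : has_sym k s -> exists2 c'', value_of leA s [:: f c; f c'] (f c'')
  & value_of leB s [:: g c; g c'] (g c'').
Proof.
move=> ks; have [c'' h] := exC (xs := [:: c; c']) ks (esym (two (kP ks))).
by exists c''; [exact: (fp ks h) | exact: (gp ks h)].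
Qed.

(** An element of [B] below [x] and [y] lies below elements [c] and [c'] of
[C] that lie below [x] and [y]; then it lies below their meet in [C], which
both embeddings preserve. *)
Lemma inl_meet x y z : has_sym k SMeet -> value_of leA SMeet [:: x; y] z ->
  value_of sum_le SMeet [:: inl x; inl y] (inl z).
Proof.
move=> ks zP; have [zx zy] := (zP z).1 (rA z).
move=> [a|b] /=; first exact: zP.
split=> [[c [bc cz]]|[[c [bc cx]] [c' [bc' cy]]]].
  by split; exists c; split=> //; [exact: tA zx | exact: tA zy].
have [c'' fc gc] := exC2 c c' ks; exists c''; split; first exact/gc.
by apply/zP; have [/tA h /tA h'] := (fc _).1 (rA _); split; [exact: h|exact: h'].
Qed.

Lemma inr_meet x y z : has_sym k SMeet -> value_of leB SMeet [:: x; y] z ->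
  value_of sum_le SMeet [:: inr x; inr y] (inr z).
Proof.
move=> ks zP; have [zx zy] := (zP z).1 (rB z).
move=> [a|b] /=; last exact: zP.
split=> [[c [bc cz]]|[[c [bc cx]] [c' [bc' cy]]]].
  by split; exists c; split=> //; [exact: tB zx | exact: tB zy].
have [c'' fc gc] := exC2 c c' ks; exists c''; split; first exact/fc.
by apply/zP; have [/tB h /tB h'] := (gc _).1 (rB _); split; [exact: h|exact: h'].
Qed.

Lemma inl_join x y z : has_sym k SJoin -> value_of leA SJoin [:: x; y] z ->
  value_of sum_le SJoin [:: inl x; inl y] (inl z).
Proof.
move=> ks zP; have [zx zy] := (zP z).1 (rA z).
move=> [a|b] /=; first exact: zP.
split=> [[c [bc cz]]|[[c [bc cx]] [c' [bc' cy]]]].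
  by split; exists c; split=> //; [exact: tA zx _ | exact: tA zy _].
have [c'' fc gc] := exC2 c c' ks; exists c''; split; last exact/gc.
by apply/zP; have [h h'] := (fc _).1 (rA _); split; [exact: tA h|exact: tA h'].
Qed.

Lemma inr_join x y z : has_sym k SJoin -> value_of leB SJoin [:: x; y] z ->
  value_of sum_le SJoin [:: inr x; inr y] (inr z).
Proof.
move=> ks zP; have [zx zy] := (zP z).1 (rB z).
move=> [a|b] /=; last exact: zP.
split=> [[c [bc cz]]|[[c [bc cx]] [c' [bc' cy]]]].
  by split; exists c; split=> //; [exact: tB zx _ | exact: tB zy _].
have [c'' fc gc] := exC2 c c' ks; exists c''; split; last exact/fc.
by apply/zP; have [h h'] := (gc _).1 (rB _); split; [exact: tB h|exact: tB h'].
Qed.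

Lemma cut_amalgam : base_amalgam k leA leB f g (@cut_le _ sum_le)
  (fun a => principal sum_le (inl a)) (fun b => principal sum_le (inr b)).
Proof.
have pe := principal_emb sum_le_refl sum_le_trans.
have ord := cut_le_order sum_le.
split=> //.
- move=> s [|X [|Y [|? ?]]] ks; move: (ks) => /kP[] es; subst s => // _.
    have [i iP] := cut_inf [set Z | Z = X \/ Z = Y]; exists i => W; rewrite iP.
    by split=> [h|[? ?] Z [->|->]//]; split; apply: h; [left | right].
  have [i iP] := @cut_complete _ sum_le [set Z | Z = X \/ Z = Y].
  exists i => W; rewrite iP.
  by split=> [h|[? ?] Z [->|->]//]; split; apply: h; [left | right].
- exact: cut_complete.
- move=> s [|x [|y [|? ?]]] z ks; move: (ks) => /kP[] es; subst s => // zP.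
    apply: principal_meet (inl_meet ks zP); first exact: sum_le_refl.
    exact: sum_le_trans.
  apply: principal_join (inl_join ks zP); first exact: sum_le_refl.
  exact: sum_le_trans.
- move=> s [|x [|y [|? ?]]] z ks; move: (ks) => /kP[] es; subst s => // zP.
    apply: principal_meet (inr_meet ks zP); first exact: sum_le_refl.
    exact: sum_le_trans.
  apply: principal_join (inr_join ks zP); first exact: sum_le_refl.
  exact: sum_le_trans.
- by move=> c; apply: (ord_anti ord); apply/pe; exists c.
- by move=> a b /pe.
- by move=> a b /pe.
- move=> fA fB; apply: (@finite_inj _ _ (@sval _ _)); last first.
    exact/finite_powerset/finite_sum.
  by move=> [X cX] [Y cY] /= XY; exact: eq_exist.
Qed.

End CutAmalgam.

(** * Prime filters of Heyting algebras *)

Section PrimeFilters.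
Variables (T : Type) (le : T -> T -> Prop).

(** Filters and ideals are described by the order alone, with directedness
in place of closure under meets or joins, so that a prime filter is a filter
whose complement is an ideal. *)
Definition is_filter (F : set T) : Prop :=
  [/\ exists x, F x, forall x y, F x -> le x y -> F y &
      forall x y, F x -> F y -> exists z, [/\ F z, le z x & le z y]].

Definition is_ideal (I : set T) : Prop :=
  [/\ exists x, I x, forall x y, I y -> le x y -> I x &
      forall x y, I x -> I y -> exists z, [/\ I z, le x z & le y z]].

Definition is_prime (P : set T) : Prop := is_filter P /\ is_ideal (~` P).

Hypothesis ord : is_order le.
Let r := ord_refl ord.
Let t := ord_trans ord.

Lemma prime_meet P x y z : is_prime P -> value_of le SMeet [:: x; y] z ->
  P z <-> P x /\ P y.
Proof.
move=> [[_ up dir] _] zP; have [zx zy] := (zP z).1 (r z).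
split=> [Pz|[Px Py]]; first by split; apply: up Pz _.
by have [w [Pw wx wy]] := dir x y Px Py; apply: up Pw _; apply/zP.
Qed.

Lemma prime_join P x y z : is_prime P -> value_of le SJoin [:: x; y] z ->
  P z <-> P x \/ P y.
Proof.
move=> [[_ up _] [_ _ dir]] zP; have [zx zy] := (zP z).1 (r z).
split=> [Pz|[Px|Py]]; [|exact: up Px _|exact: up Py _].
apply: contrapT => /not_orP[nx ny].
by have [w [Pw xw yw]] := dir x y nx ny; apply: Pw; apply: up Pz _; apply/zP.
Qed.

Lemma prime_imp P x y z : is_prime P -> value_of le SImp [:: x; y] z ->
  P z -> P x -> P y.
Proof.
move=> [[_ up dir] _] zP Pz Px; have [w [Pw wz wx]] := dir z x Pz Px.
by apply: up Pw _; exact: (zP z).1 wx.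
Qed.

Lemma prime_bot P z : is_prime P -> value_of le SBot [::] z -> ~ P z.
Proof. by move=> [[_ up _] [[w nPw] _ _]] zP Pz; apply/nPw/(up _ _ Pz). Qed.

Lemma prime_top P z : is_prime P -> value_of le STop [::] z -> P z.
Proof. by move=> [[[w Pw] up _] _] zP; apply: up Pw _. Qed.

Lemma prime_compl P x z : is_prime P -> value_of le SCompl [:: x] z ->
  P z <-> ~ P x.
Proof.
move=> [[[w0 Pw0] up dir] [[w nPw] _ dirI]] [zP zT]; split=> [Pz Px|nPx].
  have [v [Pv vz vx]] := dir z x Pz Px; apply/nPw/(up _ _ Pv).
  exact: (zP z).1 vx _.
apply: contrapT => nPz; have [v [nPv xv zv]] := dirI x z nPx nPz.
by apply: nPv; apply: up Pw0 _; exact: zT.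
Qed.

Lemma principal_filter a : is_filter [set x | le a x].
Proof.
split=> [|x y ax xy|x y ax ay]; [by exists a; exact: r | exact: t xy |].
by exists a; split=> //; exact: r.
Qed.

Lemma principal_ideal a : is_ideal [set x | le x a].
Proof.
split=> [|x y ya xy|x y ax ay]; [by exists a; exact: r | exact: t ya |].
by exists a; split=> //; exact: r.
Qed.

(** The filter generated by [F] and [x], with the meet of [u] and [x]
replaced by its lower bounds. *)
Definition relative_upset (F : set T) (x : T) : set T :=
  [set w | exists2 u, F u & forall v, le v u -> le v x -> le v w].

Lemma relative_upset_sub F x : F `<=` relative_upset F x.
Proof. by move=> u Fu; exists u. Qed.

Lemma relative_upset_mem F x : (exists u, F u) -> relative_upset F x x.
Proof. by move=> [u Fu]; exists u. Qed.

Hypothesis meets : forall x y, exists z, value_of le SMeet [:: x; y] z.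
Hypothesis joins : forall x y, exists z, value_of le SJoin [:: x; y] z.
Hypothesis imps : forall x y, exists z, value_of le SImp [:: x; y] z.

Lemma relative_upset_filter F x : is_filter F -> is_filter (relative_upset F x).
Proof.
move=> [[u0 Fu0] up dir]; split=> [|w w' [u Fu uw] ww'|w w' [u Fu uw] [u' Fu' uw']].
- by exists u0; exact: relative_upset_sub.
- by exists u => // v vu vx; apply: t ww'; exact: uw.
have [z zP] := meets w w'; have [zw zw'] := (zP z).1 (r z).
exists z; split=> //; have [y [Fy yu yu']] := dir u u' Fu Fu'.
exists y => // v vy vx; apply/zP; split; [apply: uw => //|apply: uw' => //].
  exact: t yu.
exact: t yu'.
Qed.

(** A filter maximal among those that avoid [I] is prime: if neither [x]
nor [y] belongs to it, then some [s] in it satisfies [s /\ x <= e] and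
[s /\ y <= e] with [e] in [I], so [x] and [y], hence their join, lie below
the implication from [s] to [e]. *)
Lemma prime_filter_exists F I : is_filter F -> is_ideal I ->
  (forall x, F x -> I x -> False) ->
  exists P, [/\ is_prime P, F `<=` P & forall x, I x -> ~ P x].
Proof.
move=> fF [[i0 Ii0] downI dirI] FI.
(* Zorn's lemma is applied to sets that contain [F] after union with it, so that
   the empty chain is harmless. *)
pose Q (X : set T) := is_filter (F `|` X) /\ forall x, (F `|` X) x -> ~ I x.
have [|X [[fM MI] Xmax]] := @Zorn_bigcup T Q.
  move=> Z ZQ Ztot.
  (* Any two elements of the union of a chain belong to a single member. *)
  have one x y : (F `|` \bigcup_(X in Z) X) x -> (F `|` \bigcup_(X in Z) X) y ->
      exists X, [/\ Q X, (F `|` X) x, (F `|` X) y & F `|` X `<=` F `|` \bigcup_(X in Z) X].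
    have Q0 : Q set0 by split=> [|z [Fz|//]]; [rewrite setU0 | exact: FI].
    have sub X : Z X -> F `|` X `<=` F `|` \bigcup_(X in Z) X.
      by move=> ZX z [Fz|Xz]; [left | right; exists X].
    move=> [Fx|[X ZX Xx]] [Fy|[Y ZY Yy]].
    - by exists set0; split; [exact: Q0 | left | left | move=> z [|//]; left].
    - by exists Y; split; [exact: ZQ | left | right | exact: sub].
    - by exists X; split; [exact: ZQ | right | left | exact: sub].
    - have [XY|YX] := Ztot X Y ZX ZY.
        by exists Y; split; [exact: ZQ | right; exact: XY | right | exact: sub].
      by exists X; split; [exact: ZQ | right | right; exact: YX | exact: sub].
  split; last by move=> x Ux; have [X [[_ h] Xx _ _]] := one x x Ux Ux; exact: h.
  split=> [|x y Ux xy|x y Ux Uy].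
  - by have [[x Fx] _ _] := fF; exists x; left.
  - have [X [[[_ up _] _] Xx _ sub]] := one x x Ux Ux.
    by apply: sub; exact: up xy.
  - have [X [[[_ _ dir] _] Xx Xy sub]] := one x y Ux Uy.
    by have [z [Xz zx zy]] := dir x y Xx Xy; exists z; split=> //; exact: sub.
set M := F `|` X in fM MI; exists M.
have upM : forall x y, M x -> le x y -> M y by case: fM.
have hit x : ~ M x -> exists u i, [/\ M u, I i & forall v, le v u -> le v x -> le v i].
  move=> nMx; apply: contrapT => no.
  have fr := relative_upset_filter x fM.
  have MY : F `|` relative_upset M x = relative_upset M x.
    apply/seteqP; split=> [z [Fz|//]|z ?]; last by right.
    by apply: relative_upset_sub; left.
  apply: (Xmax (relative_upset M x)); last first.
    split=> [|z]; rewrite MY; first exact: fr.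
    by move=> [u Mu uz] Iz; apply: no; exists u, z.
  split=> [|sub]; first by move=> z Xz; apply: relative_upset_sub; right.
  apply: nMx; right; apply: sub; apply: relative_upset_mem.
  by case: fM.
split; last 2 first.
- by move=> x Fx; left.
- by move=> x Ix Mx; exact: MI Mx Ix.
split=> //; split=> [|x y nMy xy Mx|x y nMx nMy].
- by exists i0 => Mi0; exact: MI Mi0 Ii0.
- by apply: nMy; exact: upM xy.
have [j jP] := joins x y; have [xj yj] := (jP j).1 (r j).
exists j; split=> // Mj.
have [u [i [Mu Ii ui]]] := hit x nMx; have [u' [i' [Mu' Ii' ui']]] := hit y nMy.
have [_ _ dirM] := fM.
have [w [Mw wu wu']] := dirM u u' Mu Mu'; have [s [Ms sw sj]] := dirM w j Mw Mj.
have [e [Ie ie ie']] := dirI i i' Ii Ii'.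
have [h hP] := imps s e.
have jh : le j h.
  apply/jP; split; apply/hP => v vx vs.
    by apply: t ie; apply: ui => //; apply: t wu; exact: t sw.
  by apply: t ie'; apply: ui' => //; apply: t wu'; exact: t sw.
apply: (MI s Ms); apply: downI Ie _.
exact: ((hP h).1 (r h)) (t sj jh) (r s).
Qed.

End PrimeFilters.

Lemma binary_values (k : kind) (T : Type) (le : T -> T -> Prop) s :
  has_values le k -> has_sym k s -> sym_arity s = 2 ->
  forall x y, exists z, value_of le s [:: x; y] z.
Proof. by move=> ex ks s2 x y; apply: ex. Qed.

Section LiftPrime.
Variables (k : kind) (C B : Type) (leC : C -> C -> Prop) (leB : B -> B -> Prop).
Variable g : C -> B.
Hypotheses (ordC : is_order leC) (ordB : is_order leB).
Hypothesis kP : forall s, s <> SCompl -> has_sym k s.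
Hypotheses (exC : has_values leC k) (exB : has_values leB k).
Hypotheses (ge : order_embedding leC leB g) (gp : preserves_values k leC leB g).

Let kM : has_sym k SMeet. Proof. exact: kP. Qed.
Let kJ : has_sym k SJoin. Proof. exact: kP. Qed.
Let kI : has_sym k SImp. Proof. exact: kP. Qed.
Let kB : has_sym k SBot. Proof. exact: kP. Qed.
Let kT : has_sym k STop. Proof. exact: kP. Qed.

Lemma prime_preimage P : is_prime leB P -> is_prime leC (g @^-1` P).
Proof.
move=> pP; have [tp tpP] := exC (xs := [::]) kT erefl.
have [bt btP] := exC (xs := [::]) kB erefl.
have [[_ up _] [_ down _]] := pP.
split; split.
- by exists tp; apply: prime_top pP (gp kT tpP).
- by move=> x y Px xy; apply: up Px _; apply/ge.
- move=> x y Px Py.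
  have [z zP] := binary_values exC kM erefl x y.
  have [zx zy] := (zP z).1 (ord_refl ordC z).
  exists z; split=> //; apply/(prime_meet ordB pP (gp kM zP)) => //.
- by exists bt; exact: prime_bot pP (gp kB btP).
- by move=> x y nPy xy Px; apply: nPy; apply: up Px _; apply/ge.
- move=> x y nPx nPy.
  have [z zP] := binary_values exC kJ erefl x y.
  have [zx zy] := (zP z).1 (ord_refl ordC z).
  by exists z; split=> // /(prime_join ordB pP (gp kJ zP))[].
Qed.

(** The traces can be matched because an implication between elements of
[C] is the same in [B]: if [u /\ g c <= g c'] with [u] in [F], then the
implication from [c] to [c'] belongs to [p] by hypothesis, so [c'] belongs to
[p] as soon as [c] does. *)
Lemma lift_prime (F : set B) (p : set C) : is_filter leB F -> is_prime leC p ->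
  (forall c, F (g c) -> p c) ->
  exists y, [/\ is_prime leB y, F `<=` y & forall c, y (g c) <-> p c].
Proof.
move=> fF pp Fp; have [[[c0 pc0] upp dirp] [[n0 nn0] downp dirn]] := pp.
have [[u0 Fu0] upF dirF] := fF.
have [tB rB] := (ord_trans ordB, ord_refl ordB).
pose G := [set b | exists u c, [/\ F u, p c &
  forall v, leB v u -> leB v (g c) -> leB v b]].
pose I := [set b | exists2 c, ~ p c & leB b (g c)].
have fG : is_filter leB G.
  split=> [|b b' [u [c [Fu pc h]]] bb'|b b' [u [c [Fu pc h]]] [u' [c' [Fu' pc' h']]]].
  - by exists u0, u0, c0.
  - by exists u, c; split=> // v vu vc; apply: tB bb'; exact: h.
  have [z zP] := binary_values exB kM erefl b b'.
  have [zb zb'] := (zP z).1 (rB z).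
  have [w [Fw wu wu']] := dirF u u' Fu Fu'.
  have [e [pe ec ec']] := dirp c c' pc pc'.
  exists z; split=> //; exists w, e; split=> // v vw ve; apply/zP; split.
    by apply: h; [exact: tB wu | apply: tB ve _; apply/ge].
  by apply: h'; [exact: tB wu' | apply: tB ve _; apply/ge].
have iI : is_ideal leB I.
  split=> [|b b' [c nc h] bb'|b b' [c nc h] [c' nc' h']].
  - by exists (g n0), n0.
  - by exists c => //; exact: tB h.
  have [e [ne ce ce']] := dirn c c' nc nc'.
  exists (g e); split; first by exists e.
    by apply: tB h _; apply/ge.
  by apply: tB h' _; apply/ge.
have [||||y [py Gy Iy]] := prime_filter_exists ordB _ _ _ fG iI.
- exact: binary_values exB kM _.
- exact: binary_values exB kJ _.
- exact: binary_values exB kI _.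
- move=> b [u [c [Fu pc h]]] [c' nc' bc']; apply: nc'.
  have [e eP] := binary_values exC kI erefl c c'.
  apply: (prime_imp ordC pp eP) => //; apply: Fp; apply: upF Fu _.
  by apply/(gp kI eP) => // v vu vc; apply: tB bc'; exact: h.
exists y; split=> // [b Fb|c]; first by apply: Gy; exists b, c0.
split=> [yc|pc]; last by apply: Gy; exists u0, c.
by apply: contrapT => nc; apply: (Iy (g c)) yc; exists c.
Qed.

End LiftPrime.

(** * Algebras of upsets *)

Section Upsets.
Variables (Q : Type) (X : set Q) (R : Q -> Q -> Prop).

Definition is_upset (U : set Q) : Prop :=
  U `<=` X /\ forall q q', U q -> X q' -> R q q' -> U q'.
Definition upset := {U : set Q | is_upset U}.
Definition upset_le (U V : upset) : Prop := sval U `<=` sval V.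

Lemma upset_order : is_order upset_le.
Proof.
split=> [U //|V U W UV VW x /UV /VW //|[U hU] [V hV] UV VU].
by apply: eq_exist; apply/seteqP.
Qed.

Lemma upset_complete : complete_order upset_le.
Proof.
move=> F; have h : is_upset [set q | exists2 U, F U & sval U q].
  split=> [q [[U [UX h]] _ /UX //]|q q' [U FU Uq] Xq' qq'].
  by exists U => //; exact: ((svalP U).2 q).
exists (exist _ _ h) => W; split=> [hW U FU q Uq|hW q [U FU]]; last exact: hW.
by apply: hW; exists U.
Qed.

Hypothesis R_refl : forall q, R q q.
Hypothesis R_trans : forall q p r, R p q -> R q r -> R p r.

Lemma upset_meet_subproof (U V : upset) : is_upset (sval U `&` sval V).
Proof.
have [[UX hU] [_ hV]] := (svalP U, svalP V).
split=> [q [/UX //]|q q' [Uq Vq] Xq' qq'].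
by split; [exact: hU qq' | exact: hV qq'].
Qed.
Definition upset_meet U V : upset := exist _ _ (upset_meet_subproof U V).

Lemma upset_join_subproof (U V : upset) : is_upset (sval U `|` sval V).
Proof.
have [[UX hU] [VX hV]] := (svalP U, svalP V).
split=> [q [/UX //|/VX //]|q q' [Uq|Vq] Xq' qq'].
  by left; exact: hU qq'.
by right; exact: hV qq'.
Qed.
Definition upset_join U V : upset := exist _ _ (upset_join_subproof U V).

Lemma upset_imp_subproof (U V : upset) : is_upset [set q | X q /\
  forall q', X q' -> R q q' -> sval U q' -> sval V q'].
Proof.
split=> [q []//|q q' [Xq h] Xq' qq']; split=> // p Xp q'p; apply: h => //.
exact: R_trans q'p.
Qed.
Definition upset_imp U V : upset := exist _ _ (upset_imp_subproof U V).

Lemma upset_bot_subproof : is_upset set0. Proof. by split=> [q|q q'] []. Qed.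
Definition upset_bot : upset := exist _ _ upset_bot_subproof.

Lemma upset_top_subproof : is_upset X. Proof. by split=> q. Qed.
Definition upset_top : upset := exist _ _ upset_top_subproof.

(** When the order on the points is symmetric, complements of upsets are
upsets, and the algebra is Boolean. *)
Lemma upset_values (k : kind) :
  (has_sym k SCompl -> forall q q', X q -> X q' -> R q q' -> R q' q) ->
  has_values upset_le k.
Proof.
move=> sym [] [|U [|V [|? ?]]] //= ks _.
- exists (upset_meet U V) => W; split=> [h|[h h'] q Wq].
    by split=> q /h[].
  by split; [exact: h | exact: h'].
- exists (upset_join U V) => W; split=> [h|[h h'] q [/h|/h']//].
  by split=> q qU; apply: h; [left | right].
- exists (upset_imp U V) => W; split=> [h W' W'W W'U q W'q|h q Wq].
    have [Xq hq] := h q (W'W q W'q).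
    by apply: hq (W'U q W'q); last exact: R_refl.
  have [WX upW] := svalP W; split=> [|q' Xq' qq' Uq']; first exact: WX.
  by apply: (h (upset_meet W U)) => [p []//|p []//|]; split=> //; exact: upW qq'.
- by exists upset_bot => W q.
- by exists upset_top => W q; case: (svalP W) => + _; apply.
have hc : is_upset [set q | X q /\ ~ sval U q].
  split=> [q []//|q q' [Xq nUq] Xq' qq']; split=> // Uq'; apply: nUq.
  by apply: ((svalP U).2 q') => //; exact: sym.
exists (exist _ _ hc); split=> W.
  split=> [h V VW VU W' q Vq|h q Wq].
    by have [_ []] := h q (VW q Vq); exact: VU.
  split=> [|Uq]; first by case: (svalP W) => + _; apply.
  have: upset_le (upset_meet W U) upset_bot by apply: h => p [].
  by apply; split; [exact: Wq | exact: Uq].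
move=> UW cW V q Vq; have Xq : X q by case: (svalP V) => + _; apply.
by have [Uq|nUq] := pselect (sval U q); [exact: UW | exact: cW].
Qed.

(** Sending [a] to the points [q] with [a] in [val q] is a homomorphism when
the sets [val q] are prime filters, enough of them to separate elements, and
when the failure of an implication at a point is witnessed at a point above. *)
Section Representation.
Variables (k : kind) (A : Type) (leA : A -> A -> Prop) (val : Q -> set A).
Hypothesis ordA : is_order leA.
Hypothesis val_prime : forall q, X q -> is_prime leA (val q).
Hypothesis val_mono : forall q q', R q q' -> val q `<=` val q'.
Hypothesis val_sep : forall a a', ~ leA a a' ->
  exists q, [/\ X q, val q a & ~ val q a'].
Hypothesis val_imp : forall q a a' z, X q -> value_of leA SImp [:: a; a'] z ->
  ~ val q z -> exists q', [/\ X q', R q q', val q' a & ~ val q' a'].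

Lemma represent_subproof (a : A) : is_upset [set q | X q /\ val q a].
Proof.
by split=> [q []//|q q' [Xq qa] Xq' qq']; split=> //; exact: val_mono qq' _ qa.
Qed.
Definition represent a : upset := exist _ _ (represent_subproof a).

Lemma represent_emb : order_embedding leA upset_le represent.
Proof.
move=> a a'; split=> [h|aa' q [Xq qa]].
  apply: contrapT => /val_sep[q [Xq qa]]; apply.
  by have [|] := h q.
by split=> //; have [[_ up _] _] := val_prime Xq; exact: up aa'.
Qed.

Lemma represent_values : preserves_values k leA upset_le represent.
Proof.
move=> [] [|x [|y [|? ?]]] z //= ks zP.
- move=> W; split=> [h|[h h'] q Wq].
    by split=> q /h[Xq] /(prime_meet ordA (val_prime Xq) zP)[].
  have [[Xq qx] [_ qy]] := (h q Wq, h' q Wq).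
  by split=> //; apply/(prime_meet ordA (val_prime Xq) zP).
- move=> W; split=> [h|[h h'] q [Xq]].
    by split=> q [Xq qx]; apply: h; split=> //;
      apply/(prime_join ordA (val_prime Xq) zP); [left | right].
  by move=> /(prime_join ordA (val_prime Xq) zP)[qx|qy]; [exact: h | exact: h'].
- move=> W; split=> [h V VW Vx q Vq|h q Wq].
    have [[Xq qz] [_ qx]] := (h q (VW q Vq), Vx q Vq).
    by split=> //; exact: (prime_imp ordA (val_prime Xq) zP).
  have [WX upW] := svalP W; have Xq := WX q Wq; split=> //.
  apply: contrapT => /(val_imp Xq zP)[q' [Xq' qq' q'x]]; apply.
  have: upset_le (upset_meet W (represent x)) (represent y).
    by apply: h => p [].
  move=> /(_ q')[]//; split=> //; exact: upW qq'.
- by move=> W q [Xq] /(prime_bot (val_prime Xq)); case.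
- move=> W q Wq; have Xq : X q by case: (svalP W) => + _; apply.
  by split=> //; exact: prime_top (val_prime Xq) zP.
split=> W.
  split=> [h V VW Vx W' q Vq|h q Wq].
    have [[Xq] /(prime_compl ordA (val_prime Xq) zP) nqx [_ qx]] :=
      (h q (VW q Vq), Vx q Vq).
    by case: nqx.
  have Xq : X q by case: (svalP W) => + _; apply.
  split=> //; apply/(prime_compl ordA (val_prime Xq) zP) => qx.
  have: upset_le (upset_meet W (represent x)) upset_bot by apply: h => p [].
  by apply; split; [exact: Wq | split].
move=> hx hz V q Vq; have Xq : X q by case: (svalP V) => + _; apply.
have [qx|nqx] := pselect (val q x); first by apply: hx; split.
by apply: hz; split=> //; apply/(prime_compl ordA (val_prime Xq) zP).
Qed.

End Representation.
End Upsets.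

Section MatchingPrimes.
Variables (k : kind) (A B C : Type) (leA : A -> A -> Prop)
  (leB : B -> B -> Prop) (leC : C -> C -> Prop) (f : C -> A) (g : C -> B).
Hypotheses (ordA : is_order leA) (ordB : is_order leB) (ordC : is_order leC).
Hypothesis kP : forall s, s <> SCompl -> has_sym k s.
Hypotheses (exA : has_values leA k) (exB : has_values leB k)
  (exC : has_values leC k).
Hypotheses (fe : order_embedding leC leA f) (ge : order_embedding leC leB g).
Hypotheses (fp : preserves_values k leC leA f)
  (gp : preserves_values k leC leB g).

Definition matching (x : set A) (y : set B) : Prop :=
  [/\ is_prime leA x, is_prime leB y & forall c, x (f c) <-> y (g c)].

Let tA := ord_trans ordA.
Let mA := binary_values exA (@kP SMeet ltac:(by [])) erefl.
Let jA := binary_values exA (@kP SJoin ltac:(by [])) erefl.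
Let iA := binary_values exA (@kP SImp ltac:(by [])) erefl.
Let mB := binary_values exB (@kP SMeet ltac:(by [])) erefl.
Let jB := binary_values exB (@kP SJoin ltac:(by [])) erefl.
Let iB := binary_values exB (@kP SImp ltac:(by [])) erefl.

Lemma matching_extend (x : set A) (F : set B) : is_prime leA x ->
  is_filter leB F -> (forall c, F (g c) -> x (f c)) ->
  exists2 y, matching x y & F `<=` y.
Proof.
move=> px fF Fx; have pp := prime_preimage ordC ordA kP exC fe fp px.
have [y [py Fy yp]] := lift_prime ordC ordB kP exC exB ge gp fF pp Fx.
by exists y => //; split=> // c; split=> /yp.
Qed.

Lemma matching_separates a a' : ~ leA a a' ->
  exists x y, [/\ matching x y, x a & ~ x a'].
Proof.
move=> aa'; have [|x [px ax xa']] := prime_filter_exists ordA mA jA iA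
    (principal_filter ordA a) (principal_ideal ordA a').
  by move=> u /= au ua'; apply: aa'; exact: tA ua'.
have [tp tpP] := exB (xs := [::]) (@kP STop ltac:(by [])) erefl.
have fT := principal_filter ordB tp.
have [|y xy _] := matching_extend px fT.
  move=> c tc; have [[[u xu] up _] _] := px.
  have [tc' tcP] := exC (xs := [::]) (@kP STop ltac:(by [])) erefl.
  have h : leC tc' c by apply/ge; apply: (ord_trans ordB) tc; exact: tpP.
  apply: (up u) => //; apply: tA (fp (@kP STop ltac:(by [])) tcP u) _.
  exact/fe.
exists x, y; split=> //; first by apply: ax; exact: ord_refl.
by apply: xa'; exact: ord_refl.
Qed.

(** A prime filter that extends [x] and refutes the implication exists on
the side of [A]; its trace on [C] contains that of [y], so [y] extends to
match it. *)
Lemma matching_imp x y a a' z : matching x y -> value_of leA SImp [:: a; a'] z ->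
  ~ x z -> exists x' y', [/\ matching x' y', x `<=` x', y `<=` y', x' a & ~ x' a'].
Proof.
move=> [px py xy] zP nxz; have [fx _] := px.
have fF := relative_upset_filter ordA mA a fx.
have [|x' [px' Fx' x'a']] := prime_filter_exists ordA mA jA iA fF
    (principal_ideal ordA a').
  move=> u [v xv h] /= ua'; apply: nxz; have [_ up _] := fx; apply: up xv _.
  by apply/zP => w wv wa; apply: tA ua'; exact: h.
have xx' : x `<=` x' by move=> u xu; apply: Fx'; exact: relative_upset_sub.
have [|y' x'y' yy'] := matching_extend px' py.1.
  by move=> c /xy; exact: xx'.
exists x', y'; split=> //; last by apply: x'a'; exact: ord_refl.
by apply: Fx'; apply: relative_upset_mem; case: fx.
Qed.

(** A prime filter [y] of [B] is chosen first, avoiding [b] and containing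
all elements of [C] above [a].  Its trace then lifts to a prime filter of [A]
containing [a].  In the other order nothing would keep [b] out, as a Heyting
algebra has no dual implication. *)
Lemma matching_interpolation a b :
  ~ (exists c, leA a (f c) /\ leB (g c) b) ->
  exists x y, [/\ matching x y, x a & ~ y b].
Proof.
move=> no; pose F := [set u | exists c, leA a (f c) /\ leB (g c) u].
have [tc tcP] := exC (xs := [::]) (@kP STop ltac:(by [])) erefl.
have fF : is_filter leB F.
  split=> [|u v [c [ac cu]] uv|u v [c [ac cu]] [c' [ac' cv]]].
  - exists (g tc), tc; split; last exact: ord_refl.
    exact: (fp (@kP STop ltac:(by [])) tcP).
  - by exists c; split=> //; exact: (ord_trans ordB) uv.
  have kM : has_sym k SMeet by exact: kP.
  have [z zP] := binary_values exC kM erefl c c'.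
  have [zc zc'] := (zP z).1 (ord_refl ordC z).
  exists (g z); split.
  - exists z; split; last exact: ord_refl.
    by apply/(fp kM zP).
  - by apply: (ord_trans ordB) cu; apply/ge.
  - by apply: (ord_trans ordB) cv; apply/ge.
have [|y [py Fy yb]] := prime_filter_exists ordB mB jB iB fF
    (principal_ideal ordB b).
  move=> u [c [ac cu]] /= ub; apply: no; exists c; split=> //.
  exact: (ord_trans ordB) ub.
have pp := prime_preimage ordC ordB kP exC ge gp py.
have [|x [px ax xp]] := lift_prime ordC ordA kP exC exA fe fp
    (principal_filter ordA a) pp.
  by move=> c ac; apply: Fy; exists c; split=> //; exact: ord_refl.
exists x, y; split.
- by split=> // c; exact: xp.
- by apply: ax; exact: ord_refl.
- by apply: yb; exact: ord_refl.
Qed.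

End MatchingPrimes.

(** * Superamalgamation of the base classes *)

Lemma matching_swap (A B C : Type) (leA : A -> A -> Prop) (leB : B -> B -> Prop)
    (f : C -> A) (g : C -> B) x y :
  matching leA leB f g x y <-> matching leB leA g f y x.
Proof. by split=> -[px py h]; split=> // c; split=> /h. Qed.

Section UpsetAmalgam.
Variables (k : kind) (A B C : Type) (leA : A -> A -> Prop)
  (leB : B -> B -> Prop) (leC : C -> C -> Prop) (f : C -> A) (g : C -> B).
Hypotheses (ordA : is_order leA) (ordB : is_order leB) (ordC : is_order leC).
Hypothesis kP : forall s, s <> SCompl -> has_sym k s.
Hypotheses (exA : has_values leA k) (exB : has_values leB k)
  (exC : has_values leC k).
Hypotheses (fe : order_embedding leC leA f) (ge : order_embedding leC leB g).
Hypotheses (fp : preserves_values k leC leA f)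
  (gp : preserves_values k leC leB g).

Definition points : set (set A * set B) :=
  [set q | matching leA leB f g q.1 q.2].
Definition points_le (p q : set A * set B) : Prop :=
  p.1 `<=` q.1 /\ p.2 `<=` q.2.

(** If [a] were in [x'] only, its complement would be in [x], hence in [x']
too. *)
Lemma prime_incomparable (T : Type) (le : T -> T -> Prop) x x' :
  is_order le -> has_values le k -> has_sym k SCompl ->
  is_prime le x -> is_prime le x' -> x `<=` x' -> x' `<=` x.
Proof.
move=> ord ex ks px px' xx' a x'a; have [z zP] := ex SCompl [:: a] ks erefl.
apply: contrapT => nxa; have /xx' : x z by apply/(prime_compl ord px zP).
by move=> /(prime_compl ord px' zP).
Qed.

Lemma upset_amalgam : exists (f' : A -> upset points points_le) g',
  base_amalgam k leA leB f g (@upset_le _ points points_le) f' g'.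
Proof.
have R_refl q : points_le q q by split.
have R_trans q p r : points_le p q -> points_le q r -> points_le p r.
  by move=> [pq pq'] [qr qr']; split=> a; [move/pq/qr | move/pq'/qr'].
have pA q : points q -> is_prime leA q.1 by case.
have pB q : points q -> is_prime leB q.2 by case.
have mA q q' : points_le q q' -> q.1 `<=` q'.1 by case.
have mB q q' : points_le q q' -> q.2 `<=` q'.2 by case.
have sA a a' : ~ leA a a' -> exists q, [/\ points q, q.1 a & ~ q.1 a'].
  move=> /(matching_separates ordA ordB ordC kP exA exB exC fe ge fp gp).
  by move=> [x [y [xy xa xa']]]; exists (x, y).
have sB b b' : ~ leB b b' -> exists q, [/\ points q, q.2 b & ~ q.2 b'].
  move=> /(matching_separates ordB ordA ordC kP exB exA exC ge fe gp fp).
  by move=> [x [y [/matching_swap xy xa xa']]]; exists (y, x).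
have iA q a a' z : points q -> value_of leA SImp [:: a; a'] z -> ~ q.1 z ->
    exists q', [/\ points q', points_le q q', q'.1 a & ~ q'.1 a'].
  move=> qX zP nz.
  have [x [y [xy qx qy xa xa']]] :=
    matching_imp ordA ordB ordC kP exA exB exC fe ge fp gp qX zP nz.
  by exists (x, y).
have iB q b b' z : points q -> value_of leB SImp [:: b; b'] z -> ~ q.2 z ->
    exists q', [/\ points q', points_le q q', q'.2 b & ~ q'.2 b'].
  move=> /matching_swap qX zP nz.
  have [x [y [/matching_swap xy qx qy xa xa']]] :=
    matching_imp ordB ordA ordC kP exB exA exC ge fe gp fp qX zP nz.
  by exists (y, x).
exists (represent points mA), (represent points mB); split.
- exact: upset_order.
- apply: upset_values => // ks [x y] [x' y'] [px py _] [px' py' _] [xx' yy'].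
  by split; [exact: prime_incomparable ks px px' xx' |
             exact: prime_incomparable ks py py' yy'].
- exact: upset_complete.
- exact: represent_emb.
- exact: represent_emb.
- exact: represent_values.
- exact: represent_values.
- move=> c; apply: (ord_anti (upset_order _ _)) => q [] /= Xq h; split=> //;
  by have [_ _ e] := Xq; apply/e.
- move=> a b ab; apply: contrapT.
  move=> /(matching_interpolation ordA ordB ordC kP exA exB exC fe ge fp gp).
  by move=> [x [y [xy xa yb]]]; case: (ab (x, y)).
- move=> a b ab; apply: contrapT.
  move=> /(matching_interpolation ordB ordA ordC kP exB exA exC ge fe gp fp).
  by move=> [x [y [/matching_swap xy xa yb]]]; case: (ab (y, x)).
- move=> fA fB; apply: (@finite_inj _ _ (@sval _ _)).
    by move=> [U hU] [V hV] /= UV; exact: eq_exist.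
  by apply: finite_powerset; apply: finite_prod; exact: finite_powerset.
Qed.

End UpsetAmalgam.

Section BaseAmalgamation.
Variables (d : Order.disp_t) (k : kind).

Lemma value_of_iso (T U : Type) (le : T -> T -> Prop) (leU : U -> U -> Prop)
    (phi : T -> U) s xs z :
  bijective phi -> order_embedding le leU phi ->
  value_of le s xs z -> value_of leU s (map phi xs) (phi z).
Proof.
move=> [psi phiK psiK] e.
have all (P : U -> Prop) : (forall w, P w) <-> (forall w, P (phi w)).
  by split=> // h w; rewrite -(psiK w).
case: s; case: xs => [|x [|y [|? ?]]] //= zP.
- by apply/all => w; rewrite !e.
- by apply/all => w; rewrite !e.
- apply/all => w; rewrite !e zP; split=> [h|h v]; last by have := h (phi v); rewrite !e.
  by apply/all => v; rewrite !e; exact: h.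
- by apply/all => w; rewrite !e.
- by apply/all => w; rewrite !e.
- have [zP1 zP2] := zP; split; apply/all => w; rewrite !e.
    rewrite zP1; split=> [h|h v vw vx u].
      by apply/all => v; rewrite !e => vw vx; apply/all => u; rewrite !e; exact: h.
    by have := h (phi v); rewrite !e => /(_ vw vx (phi u)); rewrite e.
  by move=> xw zw; apply/all => u; rewrite !e; exact: zP2.
Qed.

Definition base_embedding (A B : base d k) (f : A -> B) : Prop :=
  order_embedding ole ole f /\ preserves_values k ole ole f.

(** The kinds split into those with at most meets and joins, and those with
all symbols but perhaps the complement. *)
Theorem base_superamalgamation (A B C : base d k) (f : C -> A) (g : C -> B) :
  base_embedding f -> base_embedding g ->
  exists (D : base d k) (f' : A -> D) (g' : B -> D),
    base_amalgam k ole ole f g ole f' g'.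
Proof.
move=> [fe fp] [ge gp].
have [ordA ordB ordC] := And3 (ole_order A) (ole_order B) (ole_order C).
have [exA exB exC] := And3 (@base_has_values d k A) (@base_has_values d k B)
  (@base_has_values d k C).
have [T [le [f' [g' am]]]] : exists (T : Type) (le : T -> T -> Prop) f' g',
    base_amalgam k (@ole d A) (@ole d B) f g le f' g'.
  have [lat|hey] : (forall s, has_sym k s -> s = SMeet \/ s = SJoin) \/
      (forall s, s <> SCompl -> has_sym k s).
    by case: k; [left|left|left|left|right|right]; case=> //; auto.
  - have am := cut_amalgam ordA ordB lat exC fe ge fp gp.
    by do 4 eexists; exact: am.
  - have [f' [g' am]] := upset_amalgam ordA ordB ordC hey exA exB exC fe ge fp gp.
    by do 4 eexists; exact: am.
have [D [phi [phib phie]]] := realize d (amalgam_order am) (amalgam_values am).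
have [psi phiK psiK] := phib.
exists D, (phi \o f'), (phi \o g'); split.
- exact: ole_order.
- exact: base_has_values.
- move=> X; have [s sP] := amalgam_complete am [set x | X (phi x)].
  exists (phi s) => w; rewrite -(psiK w) phie sP; split=> h x; last first.
    by move=> /h; rewrite phie.
  by rewrite -(psiK x) => /h; rewrite phie.
- by move=> x y; rewrite /= phie; exact: amalgam_embl am x y.
- by move=> x y; rewrite /= phie; exact: amalgam_embr am x y.
- move=> s xs z ks /(amalgam_prel am ks) h; rewrite map_comp.
  exact: value_of_iso h.
- move=> s xs z ks /(amalgam_prer am ks) h; rewrite map_comp.
  exact: value_of_iso h.
- by move=> c; rewrite /= (amalgam_comm am).
- by move=> a b /phie; exact: amalgam_interl am a b.
- by move=> a b /phie; exact: amalgam_interr am a b.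
- move=> fA fB; apply: (finite_inj (can_inj psiK)).
  exact: amalgam_finite am fA fB.
Qed.

End BaseAmalgamation.

(** * A common normal form for the properties *)

Section Patterns.
Variables (T : Type) (le : T -> T -> Prop).

(** Places before [i] may increase, the last [j] places may decrease, and
the others stay fixed. *)
Definition pattern_le (i j n : nat) (x y : n.-tuple T) : Prop :=
  forall p : 'I_n, if (p < i)%N then le (tnth x p) (tnth y p)
    else if (n - j <= p)%N then le (tnth y p) (tnth x p)
    else tnth x p = tnth y p.

Lemma pattern_le_refl i j n (x : n.-tuple T) :
  is_order le -> pattern_le i j x x.
Proof. by move=> ord p; case: ifP => _; [|case: ifP => // _]; exact: ord_refl. Qed.

Lemma pattern_le_trans i j n (y x z : n.-tuple T) :
  is_order le -> pattern_le i j x y -> pattern_le i j y z -> pattern_le i j x z.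
Proof.
move=> ord xy yz p; have := (xy p, yz p).
by case: ifP => _ [h h']; [|case: ifP h h' => _ h h'];
  [exact: ord_trans h' | exact: ord_trans h | rewrite h].
Qed.

End Patterns.

Lemma pattern_le_map (T U : Type) (le : T -> T -> Prop) (leU : U -> U -> Prop)
    (h : T -> U) i j n (x y : n.-tuple T) :
  injective h -> order_embedding le leU h ->
  pattern_le leU i j (map_tuple h x) (map_tuple h y) <-> pattern_le le i j x y.
Proof.
move=> hi he; split=> xy p; move: (xy p); rewrite !tnth_map.
  by case: ifP => _; [|case: ifP => _]; [move/he | move/he | move/hi].
by case: ifP => _; [|case: ifP => _]; [move/he | move/he | move->].
Qed.

(** Passing from [x] to [y] one place at a time turns monotonicity in each
variable into monotonicity for the pattern order. *)
Lemma monotone_patternP (d : Order.disp_t) (T : porderType d) (i j n : nat)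
    (F : n.-tuple T -> T) : (i + j <= n)%N ->
  monotone_pattern i j F <->
  (forall x y, pattern_le ole i j x y -> ole (F x) (F y)).
Proof.
move=> ijn; split=> [[Fi Fj] x y xy|Fij].
  (* The first [m] places of [z m] are already those of [y]. *)
  pose z m := [tuple if (p < m)%N then tnth y p else tnth x p | p < n].
  have z0 : z 0 = x by apply: eq_from_tnth => p; rewrite tnth_mktuple.
  have zn : z n = y by apply: eq_from_tnth => p; rewrite tnth_mktuple ltn_ord.
  rewrite -[in F x]z0 -[in F y]zn.
  elim: {-2}n (leqnn n) => [|m IHm] mn; first exact: ord_refl (ole_order T) _.
  apply: (ord_trans (ole_order T) (IHm (ltnW mn))).
  have other (q : 'I_n) : q != Ordinal mn -> tnth (z m) q = tnth (z m.+1) q.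
    rewrite !tnth_mktuple ltnS [(q <= m)%N]leq_eqVlt -val_eqE /=.
    by move=> /negPf->.
  have zm : tnth (z m) (Ordinal mn) = tnth x (Ordinal mn).
    by rewrite tnth_mktuple ltnn.
  have zm1 : tnth (z m.+1) (Ordinal mn) = tnth y (Ordinal mn).
    by rewrite tnth_mktuple ltnSn.
  have := xy (Ordinal mn); rewrite /=; case: ifP => [mi|_].
    by move=> h; apply: (Fi (Ordinal mn)) => //; rewrite zm zm1.
  case: ifP => [mj|_] h.
    apply: (Fj (Ordinal mn)) => //; last by rewrite zm zm1.
    by move=> q /other.
  have -> : z m = z m.+1; last exact: lexx.
  apply: eq_from_tnth => q; have [->|/other//] := eqVneq q (Ordinal mn).
  by rewrite zm zm1.
split=> p hp x y xy xyp; apply: Fij => q.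
  have [->|/xy->] := eqVneq q p; first by rewrite hp.
  by case: ifP => _; [|case: ifP => // _]; exact: lexx.
have [->|/xy->] := eqVneq q p; last first.
  by case: ifP => _; [|case: ifP => // _]; exact: lexx.
rewrite hp; case: ifP => // pi; move: hp; rewrite leqNgt.
by rewrite (leq_trans pi) // leq_subRL ?(leq_trans (leq_addl _ _) ijn) // addnC.
Qed.

Section LatticeTerms.
Variables (d : Order.disp_t).

Lemma lterm_eval_mono (L : latticeType d) (i : nat) (t : lterm i)
    (v v' : 'I_i -> L) :
  (forall p, v p <= v' p) -> lterm_eval v t <= lterm_eval v' t.
Proof. by move=> vv'; elim: t => * /=; [exact: vv' | exact: leI2 | exact: leU2]. Qed.

Lemma lterm_eval_morph (L M : latticeType d) (h : L -> M) (i : nat)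
    (t : lterm i) (v : 'I_i -> L) :
  {morph h : x y / Order.meet x y} -> {morph h : x y / Order.join x y} ->
  h (lterm_eval v t) = lterm_eval (fun p => h (v p)) t.
Proof.
by move=> hM hJ; elim: t => [p|t1 IH1 t2 IH2|t1 IH1 t2 IH2] //=;
  rewrite ?hM ?hJ IH1 IH2.
Qed.

(** The value is produced as a function, uniformly in the kind, because
[lterm_le] only makes sense as a relation for a variable kind. *)
Lemma lterm_value (k : kind) (i : nat) (t : lterm i) : lattice_ordered k ->
  exists ev : forall A : base d k, ('I_i -> A) -> A,
    [/\ forall (A : base d k) (v : 'I_i -> A) z, lterm_le t v z <-> ole (ev A v) z,
        forall (A : base d k) (v v' : 'I_i -> A),
          (forall p, ole (v p) (v' p)) -> ole (ev A v) (ev A v') &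
        forall (A B : base d k) (h : A -> B) (v : 'I_i -> A),
          base_embedding h -> h (ev A v) = ev B (fun p => h (v p))].
Proof.
case: k => // _.
- exists (fun (A : latticeType d) (v : 'I_i -> A) => lterm_eval v t).
  split=> [//|A v v'|A B h v]; first exact: lterm_eval_mono.
  by move=> [_ /(base_morphismP (k := Lattices))[hM hJ]]; exact: lterm_eval_morph.
- exists (fun (A : ctbDistrLatticeType d) (v : 'I_i -> A) => lterm_eval v t).
  split=> [//|A v v'|A B h v]; first exact: lterm_eval_mono.
  move=> [_ /(base_morphismP (k := BooleanAlgebras))[hM hJ _ _ _]].
  exact: lterm_eval_morph.
- exists (fun (A : heytingType d) (v : 'I_i -> A) => lterm_eval v t).
  split=> [//|A v v'|A B h v]; first exact: lterm_eval_mono.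
  move=> [_ /(base_morphismP (k := HeytingAlgebras))[hM hJ _ _ _]].
  exact: lterm_eval_morph.
Qed.

End LatticeTerms.

Definition is_monotone (w : property) : bool :=
  match w with A1e | A1c | A2 | A2e | A2c | A3 => false | _ => true end.

Definition isotone_places (w : property) : nat :=
  match w with
  | B1 | B1e | B1c | B2 | B3 | B4 => 1
  | C1 i _ _ | C2 i _ _ _ | C3 i _ _ _ _ => i
  | _ => 0
  end.

Definition antitone_places (w : property) : nat :=
  match w with
  | B5 => 1
  | C1 _ j _ | C2 _ j _ _ | C3 _ j _ _ _ => j
  | _ => 0
  end.

Definition is_idempotent (w : property) : bool :=
  match w with A2 | A2e | A2c | B2 | B3 | B4 => true | _ => false end.

Definition is_contractive (w : property) : bool :=
  match w with A1c | A2c | B1c | B4 => true | _ => false end.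

Definition is_involutive (w : property) : bool :=
  match w with A3 => true | _ => false end.

Definition wpattern_le (T : Type) (le : T -> T -> Prop) (w : property) :
    (arity w).-tuple T -> (arity w).-tuple T -> Prop :=
  @pattern_le T le (isotone_places w) (antitone_places w) (arity w).

Section PropertyNormalForm.
Variables (d : Order.disp_t) (k : kind).

(** The elements that a property prescribes below the value at [x].  For a
lattice term it is the whole principal ideal of the value of the term, which
is defined for every kind. *)
Definition lower_values (w : property) (A : base d k) :
    (arity w).-tuple A -> set A :=
  match w return (arity w).-tuple A -> set A with
  | A1e | A2e | B1e | B3 => fun x => [set y | exists p, y = tnth x p]
  | C2 i j n h => fun x => [set y | exists2 p : 'I_n, (p < h)%N & y = tnth x p]
  | C3 i j n le_i_n t => fun x => [set y | forall z,
      lterm_le t (fun p => tnth x (widen_ord le_i_n p)) z -> ole y z]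
  | _ => fun _ => set0
  end.

Definition diag (T : Type) (w : property) (y : T) : (arity w).-tuple T :=
  nseq_tuple (arity w) y.

(** Every property is a conjunction of some of five clauses, selected by
the property, in a form that applies to operations of all arities. *)
Record normal_form (w : property) (A : base d k) (F : (arity w).-tuple A -> A) :
    Prop := NormalForm {
  nf_monotone : is_monotone w ->
    forall x y, wpattern_le ole x y -> ole (F x) (F y);
  nf_lower : forall x y, lower_values x y -> ole y (F x);
  nf_contractive : is_contractive w -> forall x p, ole (F x) (tnth x p);
  nf_idempotent : is_idempotent w -> forall x, F (diag w (F x)) = F x;
  nf_involutive : is_involutive w -> forall x p, F (diag w (F x)) = tnth x p }.

Lemma tuple1E (T : Type) (x : 1.-tuple T) : x = [tuple tnth x ord0].
Proof. by apply: eq_from_tnth => p; rewrite (ord1 p). Qed.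

Lemma nseq_tuple1 (T : Type) (y : T) : nseq_tuple 1 y = [tuple y].
Proof. exact: val_inj. Qed.

Lemma pattern_places (w : property) : admissible k w ->
  (isotone_places w + antitone_places w <= arity w)%N.
Proof.
by case: w => //= [i j n|i j n h|i j n h t]; [case/andP | case/and3P | case/and3P].
Qed.

Lemma isotone1P (A : base d k) (F : 1.-tuple A -> A) :
  isotone (fun x => F [tuple x]) <->
  (forall x y, pattern_le ole 1 0 x y -> ole (F x) (F y)).
Proof.
split=> [K x y /(_ ord0) /= xy|K x y xy].
  by rewrite (tuple1E x) (tuple1E y); exact: K.
by apply: K => p; rewrite (ord1 p).
Qed.

Lemma antitone1P (A : base d k) (F : 1.-tuple A -> A) :
  antitone (fun x => F [tuple x]) <->
  (forall x y, pattern_le ole 0 1 x y -> ole (F x) (F y)).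
Proof.
split=> [K x y /(_ ord0) /= xy|K x y xy].
  by rewrite (tuple1E x) (tuple1E y); exact: K.
by apply: K => p; rewrite (ord1 p).
Qed.

Lemma contractive1P (A : base d k) (F : 1.-tuple A -> A) :
  contractive (fun x => F [tuple x]) <-> (forall x p, ole (F x) (tnth x p)).
Proof.
split=> [K x p|K x]; last exact: K [tuple x] ord0.
by rewrite (ord1 p) {1}(tuple1E x); exact: K.
Qed.

Lemma extensive1P (A : base d k) (F : 1.-tuple A -> A) :
  extensive (fun x => F [tuple x]) <->
  (forall x y, (exists p, y = tnth x p) -> ole y (F x)).
Proof.
split=> [K x y [p ->]|K x]; last by apply: K; exists ord0.
by rewrite (ord1 p) {2}(tuple1E x); exact: K.
Qed.

Lemma idempotent1P (A : base d k) (F : 1.-tuple A -> A) :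
  idempotent_fun (fun x => F [tuple x]) <->
  (forall x, F (nseq_tuple 1 (F x)) = F x).
Proof.
split=> [K x|K]; first by rewrite nseq_tuple1 (tuple1E x); exact: (K (tnth x ord0)).
by move=> x /=; rewrite -nseq_tuple1 K.
Qed.

Lemma involutive1P (A : base d k) (F : 1.-tuple A -> A) :
  involutive (fun x => F [tuple x]) <->
  (forall x p, F (nseq_tuple 1 (F x)) = tnth x p).
Proof.
split=> [K x p|K x]; last by rewrite -nseq_tuple1 (K _ ord0).
by rewrite nseq_tuple1 (ord1 p) (tuple1E x); exact: (K (tnth x ord0)).
Qed.

Lemma satisfiesP (w : property) (A : base d k) (F : (arity w).-tuple A -> A) :
  admissible k w -> @satisfies d k A w F <-> normal_form F.
Proof.
move=> adm; have places := pattern_places adm.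
have monoP := monotone_patternP F places.
case: w F adm places monoP => [||||||||||||| i j n|i j n h|i j n le_i_n t] F adm _ monoP.
- rewrite /= extensive1P; split=> [h|[//]]; by split.
- rewrite /= contractive1P; split=> [h|[]]; last by move=> _ _ /(_ isT).
  by split=> // x y [].
- rewrite /= idempotent1P; split=> [h|[]]; last by move=> _ _ _ /(_ isT).
  by split=> // x y [].
- rewrite /= idempotent1P extensive1P; split=> [[h1 h2]|[]]; first by split.
  by move=> _ h _ /(_ isT).
- rewrite /= idempotent1P contractive1P; split=> [[h1 h2]|[]].
    by split=> // x y [].
  by move=> _ h /(_ isT) + /(_ isT).
- rewrite /= involutive1P; split=> [h|[]]; last by move=> _ _ _ _ /(_ isT).
  by split=> // x y [].
- rewrite /= isotone1P; split=> [h|[]]; last by move/(_ isT).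
  by split=> // x y [].
- rewrite /= isotone1P extensive1P; split=> [[h1 h2]|[]]; first by split.
  by move/(_ isT).
- rewrite /= isotone1P contractive1P; split=> [[h1 h2]|[]].
    by split=> // x y [].
  by move=> /(_ isT) + _ /(_ isT).
- rewrite /= isotone1P idempotent1P; split=> [[h1 h2]|[]].
    by split=> // x y [].
  by move=> /(_ isT) + _ _ /(_ isT).
- split=> [[/isotone1P h1 /extensive1P h2 /idempotent1P h3]|[]]; first by split.
  by move=> /(_ isT)/isotone1P ? /extensive1P ? _ /(_ isT)/idempotent1P ? _; split.
- split=> [[/isotone1P h1 /contractive1P h2 /idempotent1P h3]|[]].
    by split=> // x y [].
  move=> /(_ isT)/isotone1P ? _ /(_ isT)/contractive1P ? /(_ isT)/idempotent1P ? _.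
  by split.
- rewrite /= antitone1P; split=> [h|[]]; last by move/(_ isT).
  by split=> // x y [].
- rewrite /= monoP; split=> [h|[]]; last by move/(_ isT).
  by split=> // x y [].
- rewrite /= monoP; split=> [[h1 h2]|[/(_ isT) h1 h2 _ _ _]].
    by split=> // x y [p ph ->]; exact: h2.
  by split=> // x p ph; apply: h2; exists p.
- have lat : lattice_ordered k by case/and3P: adm.
  have [ev [evP _ _]] := lterm_value d t lat.
  rewrite /= monoP; split=> [[h1 h2]|[/(_ isT) h1 h2 _ _ _]].
    by split=> // x y; apply; exact: h2.
  by split=> // x; apply/evP/h2 => z /evP.
Qed.

Section LowerValues.
Variable w : property.
Hypothesis adm : admissible k w.

Lemma lower_values_mono (D : base d k) (x x' : (arity w).-tuple D) y :
  is_monotone w -> wpattern_le ole x x' -> lower_values x y ->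
  exists2 y', lower_values x' y' & ole y y'.
Proof.
case: w adm x x' => //= [||i j n h|i j n le_i_n t] wadm x x' _ xx'.
- by move=> [p ->]; exists (tnth x' p); [exists p | have := xx' p; rewrite (ord1 p)].
- by move=> [p ->]; exists (tnth x' p); [exists p | have := xx' p; rewrite (ord1 p)].
- move=> [p ph ->]; exists (tnth x' p); first by exists p.
  have := xx' p; rewrite (leq_trans ph) //.
  by case/and3P: wadm.
have lat : lattice_ordered k by case/and3P: wadm.
have [ev [evP ev_mono _]] := lterm_value d t lat.
move=> h; pose v (u : n.-tuple D) p := tnth u (widen_ord le_i_n p).
exists (ev D (v x')); first by move=> z /evP.
apply: (ord_trans (ole_order D)) (ev_mono D (v x) (v x') _).
  by apply: h; apply/evP; exact: ord_refl (ole_order D) _.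
by move=> p; have := xx' (widen_ord le_i_n p); rewrite /= ltn_ord.
Qed.

(** Prescribed lower bounds at a tuple of [A] computed in [D] are bounded by
those computed in [A], because embeddings preserve lattice terms. *)
Lemma lower_values_map (A D : base d k) (e : A -> D) (x : (arity w).-tuple A) y :
  base_embedding e -> lower_values (map_tuple e x) y ->
  exists2 u, lower_values x u & ole y (e u).
Proof.
have r z : @ole d D z z by exact: ord_refl (ole_order D) _.
case: w adm x => //= [|||| i j n h|i j n le_i_n t] wadm x he.
1-4: by move=> [p ->]; exists (tnth x p); [exists p | rewrite tnth_map].
- by move=> [p ph ->]; exists (tnth x p); [exists p | rewrite tnth_map].
have lat : lattice_ordered k by case/and3P: wadm.
have [ev [evP _ ev_emb]] := lterm_value d t lat.
move=> h; pose v p := tnth x (widen_ord le_i_n p).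
exists (ev A v); first by move=> z /evP.
apply: h; apply/evP; rewrite (ev_emb _ _ _ _ he).
have -> : (fun p => tnth (map_tuple e x) (widen_ord le_i_n p)) = fun p => e (v p).
  by apply/funext => p; rewrite tnth_map.
exact: r.
Qed.

Lemma lower_values_emb (A D : base d k) (e : A -> D) (x : (arity w).-tuple A) y :
  base_embedding e -> lower_values x y -> lower_values (map_tuple e x) (e y).
Proof.
case: w adm x => //= [|||| i j n h|i j n le_i_n t] wadm x he.
1-4: by move=> [p ->]; exists p; rewrite tnth_map.
- by move=> [p ph ->]; exists p; rewrite ?tnth_map.
have lat : lattice_ordered k by case/and3P: wadm.
have [ev [evP _ ev_emb]] := lterm_value d t lat.
move=> h z; pose v p := tnth x (widen_ord le_i_n p).
have -> : (fun p => tnth (map_tuple e x) (widen_ord le_i_n p)) = fun p => e (v p).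
  by apply/funext => p; rewrite tnth_map.
move/evP; rewrite -(ev_emb _ _ _ _ he); apply: (ord_trans (ole_order D)).
by apply/he.1; apply: h; apply/evP; exact: ord_refl (ole_order A) _.
Qed.

Lemma lower_values_nonmono (D : base d k) (x : (arity w).-tuple D) y :
  ~~ is_monotone w -> lower_values x y -> exists p, y = tnth x p.
Proof. by case: w adm x => //= _ x _ []. Qed.

Lemma lower_values_contractive (D : base d k) (x : (arity w).-tuple D) y :
  is_contractive w -> ~ lower_values x y.
Proof. by case: w adm x => //= _ x _ []. Qed.

Lemma lower_values_idempotent (D : base d k) (x : (arity w).-tuple D) y e :
  is_monotone w -> is_idempotent w -> lower_values x y -> ole y e ->
  exists2 y', lower_values (diag w e) y' & ole y y'.
Proof.
by case: w x => //= x _ _ [p ->] xe; exists e => //; exists ord0.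
Qed.

Lemma unary_arity :
  [|| ~~ is_monotone w, is_contractive w, is_idempotent w | is_involutive w] ->
  arity w = 1.
Proof. by case: w. Qed.

Lemma unary_isotone :
  is_monotone w -> is_contractive w || is_idempotent w ->
  isotone_places w = 1.
Proof. by case: w. Qed.

Lemma involutive_not_monotone : is_involutive w -> ~~ is_monotone w.
Proof. by case: w. Qed.

End LowerValues.

End PropertyNormalForm.

(** * Extending operations to a complete amalgam *)

Lemma base_amalgam_sym (k : kind) (A B C D : Type) (leA : A -> A -> Prop)
    (leB : B -> B -> Prop) (f : C -> A) (g : C -> B) (le : D -> D -> Prop)
    (f' : A -> D) (g' : B -> D) :
  base_amalgam k leA leB f g le f' g' -> base_amalgam k leB leA g f le g' f'.
Proof. by case=> *; split => //; auto. Qed.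

Lemma tuple_choice (T U : Type) (n : nat) (x : n.-tuple T) (P : 'I_n -> U -> Prop) :
  (forall p, exists c, P p c) -> exists y : n.-tuple U, forall p, P p (tnth y p).
Proof.
move=> /choice[c cP]; exists [tuple c p | p < n] => p.
by rewrite tnth_mktuple.
Qed.

Section ExtendOperation.
Variables (d : Order.disp_t) (k : kind) (w : property) (D : base d k).
Hypothesis cD : complete_order (@ole d D).
Hypothesis adm : admissible k w.

Let sup (X : set D) : D := projT1 (cid (cD X)).
Let supP (X : set D) u : ole (sup X) u <-> (forall x, X x -> ole x u).
Proof. by rewrite /sup; case: cid. Qed.

Let inf (X : set D) : D := projT1 (cid (complete_inf (ole_order D) cD X)).
Let infP (X : set D) u : ole u (inf X) <-> (forall x, X x -> ole u x).
Proof. by rewrite /inf; case: cid. Qed.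

Let r := ord_refl (ole_order D).
Let t := ord_trans (ole_order D).
Let anti := ord_anti (ole_order D).

Let sup_ub (X : set D) x : X x -> ole x (sup X).
Proof. by move=> Xx; exact: (supP X (sup X)).1 (r _) x Xx. Qed.

Let inf_lb (X : set D) x : X x -> ole (inf X) x.
Proof. by move=> Xx; exact: (infP X (inf X)).1 (r _) x Xx. Qed.

Definition below_values (A : base d k) (f' : A -> D)
    (FA : (arity w).-tuple A -> A) (x : (arity w).-tuple D) : set D :=
  [set y | exists2 a, wpattern_le ole (map_tuple f' a) x & y = f' (FA a)].

Section Formula.
Variables (A B : base d k) (f' : A -> D) (g' : B -> D).
Variables (FA : (arity w).-tuple A -> A) (FB : (arity w).-tuple B -> B).

(** For a unary operation the supremum in the last case is the argument
itself; in this form the definition makes sense for all arities. *)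
Definition freeze_ext (x : (arity w).-tuple D) : D :=
  if pselect (exists a, x = map_tuple f' a) is left e then f' (FA (projT1 (cid e)))
  else if pselect (exists b, x = map_tuple g' b) is left e
  then g' (FB (projT1 (cid e)))
  else sup [set y | exists p, y = tnth x p].

(** The least operation, monotone for the pattern, that lies above the
required values and lower bounds. *)
Definition join_ext (x : (arity w).-tuple D) : D :=
  sup (below_values f' FA x `|` below_values g' FB x `|` lower_values x).

(** The elements [e] that [join_ext] does not raise form a set closed under
infima, and [closure_ext] sends [x] to the least of them above [join_ext x].
The operation [join_ext] itself need not be idempotent, because an element of
[A] may lie below a supremum without lying below any of its members. *)
Definition closure_ext (x : (arity w).-tuple D) : D :=
  inf [set e | ole (join_ext x) e /\ ole (join_ext (diag w e)) e].

Definition extend_op : (arity w).-tuple D -> D :=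
  if ~~ is_monotone w then freeze_ext
  else if is_idempotent w then closure_ext else join_ext.

End Formula.

Lemma extend_op_mono (A B : base d k) (f' : A -> D) (g' : B -> D)
    (FA FA' : (arity w).-tuple A -> A) (FB FB' : (arity w).-tuple B -> B) x :
  order_embedding ole ole f' -> order_embedding ole ole g' ->
  (forall a, ole (FA a) (FA' a)) -> (forall b, ole (FB b) (FB' b)) ->
  ole (extend_op f' g' FA FB x) (extend_op f' g' FA' FB' x).
Proof.
move=> fe ge FAA' FBB'; rewrite /extend_op.
have join u : ole (join_ext f' g' FA FB u) (join_ext f' g' FA' FB' u).
  apply/supP => y [[[a ax ->]|[b bx ->]]|xy]; last by apply: sup_ub; right.
    apply: t (sup_ub (x := f' (FA' a)) _); first exact/fe.
    by left; left; exists a.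
  apply: t (sup_ub (x := g' (FB' b)) _); first exact/ge.
  by left; right; exists b.
case: ifP => _; last case: ifP => _; last exact: join.
  rewrite /freeze_ext; case: pselect => [e|_]; first exact/fe.
  by case: pselect => [e|_]; [exact/ge | exact: r].
apply/infP => e [xe ee]; apply: inf_lb; split; first exact: t xe.
exact: t ee.
Qed.

Lemma diag_map (T U : Type) (e : T -> U) u : diag w (e u) = map_tuple e (diag w u).
Proof. by apply: eq_from_tnth => p; rewrite tnth_map !tnth_nseq. Qed.

Lemma unary_ord p q : arity w = 1 -> p = q :> 'I_(arity w).
Proof. by move=> w1; apply: val_inj; case: p q => [[|p] +] [[|q] +] /=; rewrite w1. Qed.

Lemma unary_tuple (T : Type) (x : (arity w).-tuple T) y p :
  arity w = 1 -> tnth x p = y -> x = diag w y.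
Proof.
by move=> w1 xy; apply: eq_from_tnth => q; rewrite tnth_nseq (unary_ord q p w1).
Qed.

Lemma unary_pattern (x y : (arity w).-tuple D) p : arity w = 1 ->
  isotone_places w = 1 -> wpattern_le ole x y <-> ole (tnth x p) (tnth y p).
Proof.
move=> w1 i1; split=> [/(_ p)|xy q].
  by rewrite i1 -{1}w1 ltn_ord.
by rewrite i1 -{1}w1 ltn_ord (unary_ord q p w1).
Qed.

Section Correctness.
Variables (A B C : base d k) (f : C -> A) (g : C -> B) (f' : A -> D) (g' : B -> D).
Hypothesis am : base_amalgam k ole ole f g ole f' g'.
Variables (FA : (arity w).-tuple A -> A) (FB : (arity w).-tuple B -> B)
  (FC : (arity w).-tuple C -> C).
Hypotheses (nfA : normal_form FA) (nfB : normal_form FB).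
Hypotheses (fF : forall c, f (FC c) = FA (map_tuple f c))
  (gF : forall c, g (FC c) = FB (map_tuple g c)).

Let fe' : base_embedding f' := conj (amalgam_embl am) (amalgam_prel am).
Let ge' : base_embedding g' := conj (amalgam_embr am) (amalgam_prer am).

Lemma embedding_inj (T U : base d k) (e : T -> U) :
  order_embedding ole ole e -> injective e.
Proof.
by move=> ee x y exy; apply: (ord_anti (ole_order T)); apply/ee; rewrite exy;
  exact: ord_refl (ole_order U) _.
Qed.

Let f'_inj := embedding_inj (amalgam_embl am).
Let g'_inj := embedding_inj (amalgam_embr am).

(** Interpolating both inequalities between [f' a] and [g' b] yields [c] and
[c'] with [a <= f c], [g c <= b <= g c'] and [f c' <= a]; so all are equal. *)
Lemma amalgam_meet a b : f' a = g' b -> exists c, f c = a /\ g c = b.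
Proof.
move=> ab; have [|c [ac cb]] := amalgam_interl am (a := a) (b := b).
  by rewrite ab; exact: r.
have [|c' [bc' c'a]] := amalgam_interr am (a := a) (b := b).
  by rewrite ab; exact: r.
have e : g' (g c) = f' a.
  apply: anti; first by rewrite ab; apply/(amalgam_embr am).
  by rewrite -(amalgam_comm am); apply/(amalgam_embl am).
exists c; split; first by apply: f'_inj; rewrite (amalgam_comm am).
by apply: g'_inj; rewrite e.
Qed.

(** If a tuple [b] of [B] is comparable to [a] for the pattern, interpolating
place by place gives a tuple of [C] in between, where the two operations
agree; so the value at [b] is bounded by the value at [a]. *)
Lemma join_extE a : is_monotone w -> join_ext f' g' FA FB (map_tuple f' a) = f' (FA a).
Proof.
move=> mono; have places := pattern_places adm.
apply: anti; last first.
  apply: sup_ub; left; left; exists a => //.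
  exact: pattern_le_refl (ole_order D).
apply/supP => y [[[a' a'a ->]|[b ba ->]]|ya]; last first.
- have [u ua yu] := lower_values_map adm fe' ya.
  by apply: t yu _; apply/(amalgam_embl am)/(nf_lower nfA).
- have [c cP] : exists c : (arity w).-tuple C,
      wpattern_le ole b (map_tuple g c) /\ wpattern_le ole (map_tuple f c) a.
    (* The interpolant required at place [p] by the pattern. *)
    pose P (p : 'I_(arity w)) c :=
      if (p < isotone_places w)%N then ole (tnth b p) (g c) /\ ole (f c) (tnth a p)
      else if (arity w - antitone_places w <= p)%N
      then ole (tnth a p) (f c) /\ ole (g c) (tnth b p)
      else f c = tnth a p /\ g c = tnth b p.
    have [p|c cP] := @tuple_choice _ C (arity w) b P; last first.
      by exists c; split=> p; rewrite tnth_map; move: (cP p); rewrite /P;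
        (case: ifP => _; [by case | case: ifP => _; by case]).
    have := ba p; rewrite !tnth_map /P; case: ifP => _.
      by move/(amalgam_interr am).
    case: ifP => _; first by move/(amalgam_interl am).
    by move/esym/amalgam_meet.
  have [bc ca] := cP.
  apply: (t (y := g' (FB (map_tuple g c)))).
    by apply/(amalgam_embr am)/(nf_monotone nfB).
  rewrite -gF -(amalgam_comm am) fF; apply/(amalgam_embl am).
  exact: (nf_monotone nfA).
apply/(amalgam_embl am)/(nf_monotone nfA) => //.
exact: (pattern_le_map _ _ _ _ f'_inj (amalgam_embl am)).1 a'a.
Qed.

Lemma freeze_extE a : freeze_ext f' g' FA FB (map_tuple f' a) = f' (FA a).
Proof.
rewrite /freeze_ext; case: pselect => [e|[]]; last by exists a.
case: cid => a' /= aa'; congr (f' (FA _)); apply: eq_from_tnth => p; apply: f'_inj.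
by have := congr1 (fun u => tnth u p) aa'; rewrite !tnth_map.
Qed.

(** The two sides enter the formulas symmetrically, except that the
definition by cases looks at [A] first; the order of the cases is immaterial,
as a tuple of both [A] and [B] comes from [C]. *)
Lemma freeze_ext_swap : freeze_ext f' g' FA FB = freeze_ext g' f' FB FA.
Proof.
apply/funext => x; rewrite /freeze_ext.
case: pselect => [ea|//]; case: pselect => [eb|//].
case: cid => a /= xa; case: cid => b /= xb.
have ab : map_tuple f' a = map_tuple g' b by rewrite -xa.
have [p|c cP] := @tuple_choice _ C (arity w) a
    (fun p c => f c = tnth a p /\ g c = tnth b p).
  apply: amalgam_meet.
  by have := congr1 (fun u => tnth u p) ab; rewrite !tnth_map.
have -> : a = map_tuple f c.
  by apply: eq_from_tnth => p; rewrite tnth_map; case: (cP p).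
have -> : b = map_tuple g c.
  by apply: eq_from_tnth => p; rewrite tnth_map; case: (cP p).
by rewrite -fF -gF (amalgam_comm am).
Qed.

Lemma join_ext_swap : join_ext f' g' FA FB = join_ext g' f' FB FA.
Proof. by apply/funext => x; rewrite /join_ext (setUC (below_values f' FA x)). Qed.

Lemma join_closure x : ole (join_ext f' g' FA FB x) (closure_ext f' g' FA FB x).
Proof. by apply/infP => e []. Qed.

Lemma extend_opE a : extend_op f' g' FA FB (map_tuple f' a) = f' (FA a).
Proof.
rewrite /extend_op; case: (boolP (is_monotone w)) => mono /=; last exact: freeze_extE.
case: ifP => [idem|_]; last exact: join_extE.
apply: anti; last by rewrite -{1}(join_extE _ mono); exact: join_closure.
apply: inf_lb; split; first by rewrite (join_extE _ mono); exact: r.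
by rewrite diag_map (join_extE _ mono) (nf_idempotent nfA idem); exact: r.
Qed.

Lemma extend_op_swap : extend_op f' g' FA FB = extend_op g' f' FB FA.
Proof.
rewrite /extend_op; case: ifP => _; first exact: freeze_ext_swap.
case: ifP => _; last exact: join_ext_swap.
by apply/funext => x; rewrite /closure_ext join_ext_swap.
Qed.

End Correctness.

Section NormalForm.
Variables (A B C : base d k) (f : C -> A) (g : C -> B) (f' : A -> D) (g' : B -> D).
Hypothesis am : base_amalgam k ole ole f g ole f' g'.
Variables (FA : (arity w).-tuple A -> A) (FB : (arity w).-tuple B -> B)
  (FC : (arity w).-tuple C -> C).
Hypotheses (nfA : normal_form FA) (nfB : normal_form FB).
Hypotheses (fF : forall c, f (FC c) = FA (map_tuple f c))
  (gF : forall c, g (FC c) = FB (map_tuple g c)).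

Let fe' : base_embedding f' := conj (amalgam_embl am) (amalgam_prel am).
Let ge' : base_embedding g' := conj (amalgam_embr am) (amalgam_prer am).

Lemma freeze_ext_normal : ~~ is_monotone w -> normal_form (freeze_ext f' g' FA FB).
Proof.
move=> nmono; have w1 : arity w = 1 by apply: unary_arity; rewrite nmono.
have p0 : 'I_(arity w) by rewrite w1; exact: ord0.
set K := freeze_ext f' g' FA FB.
have KA a : K (map_tuple f' a) = f' (FA a) by exact: (freeze_extE am).
have KB b : K (map_tuple g' b) = g' (FB b).
  rewrite /K (freeze_ext_swap am fF gF).
  exact: (freeze_extE (base_amalgam_sym am)).
have cases (P : (arity w).-tuple D -> Prop) : (forall a, P (map_tuple f' a)) ->
    (forall b, P (map_tuple g' b)) ->
    (forall x, (forall p, K x = tnth x p) -> P x) -> forall x, P x.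
  move=> hA hB h x; have [[a ->]//|nA] := pselect (exists a, x = map_tuple f' a).
  have [[b ->]//|nB] := pselect (exists b, x = map_tuple g' b).
  apply: h => p; rewrite /K /freeze_ext.
  case: pselect => // _; case: pselect => // _.
  apply: anti; last by apply: sup_ub; exists p.
  by apply/supP => _ [q ->]; rewrite (unary_ord q p w1); exact: r.
split=> [mono|||idem|inv].
- by rewrite mono in nmono.
- apply: cases => [a y|b y|x Kx y]; rewrite ?KA ?KB.
  + move=> /(lower_values_map adm fe')[u au yu]; apply: t yu _.
    exact/(amalgam_embl am)/(nf_lower nfA).
  + move=> /(lower_values_map adm ge')[u au yu]; apply: t yu _.
    exact/(amalgam_embr am)/(nf_lower nfB).
  + by move=> /(lower_values_nonmono adm nmono)[p ->]; rewrite -Kx; exact: r.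
- move=> con; apply: cases => [a p|b p|x Kx p]; rewrite ?KA ?KB ?tnth_map.
  + exact/(amalgam_embl am)/(nf_contractive nfA).
  + exact/(amalgam_embr am)/(nf_contractive nfB).
  + by rewrite (Kx p); exact: r.
- apply: cases => [a|b|x Kx]; rewrite ?KA ?KB.
  + by rewrite diag_map KA (nf_idempotent nfA).
  + by rewrite diag_map KB (nf_idempotent nfB).
  + by rewrite (Kx p0) -(unary_tuple w1 (erefl (tnth x p0))) (Kx p0).
- apply: cases => [a p|b p|x Kx p]; rewrite ?KA ?KB.
  + by rewrite diag_map KA (nf_involutive nfA inv _ p) tnth_map.
  + by rewrite diag_map KB (nf_involutive nfB inv _ p) tnth_map.
  + by rewrite (Kx p) -(unary_tuple w1 (erefl (tnth x p))) (Kx p).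
Qed.

Lemma join_ext_pattern x x' : is_monotone w -> wpattern_le ole x x' ->
  ole (join_ext f' g' FA FB x) (join_ext f' g' FA FB x').
Proof.
move=> mono xx'; apply/supP => y [[[a ax ->]|[b bx ->]]|xy].
- apply: sup_ub; left; left; exists a => //.
  exact: (pattern_le_trans (ole_order D)) xx'.
- apply: sup_ub; left; right; exists b => //.
  exact: (pattern_le_trans (ole_order D)) xx'.
have [y' x'y' yy'] := lower_values_mono adm mono xx' xy.
by apply: t yy' _; apply: sup_ub; right.
Qed.

Lemma join_ext_lower x y : lower_values x y -> ole y (join_ext f' g' FA FB x).
Proof. by move=> xy; apply: sup_ub; right. Qed.

Lemma join_ext_contractive x p : is_monotone w -> is_contractive w ->
  ole (join_ext f' g' FA FB x) (tnth x p).
Proof.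
move=> mono con; have w1 : arity w = 1 by apply: unary_arity; rewrite con orbT.
have i1 : isotone_places w = 1 by apply: unary_isotone => //; rewrite con.
apply/supP => y [[[a ax ->]|[b bx ->]]|/(lower_values_contractive adm con)//].
  move/(unary_pattern _ _ p w1 i1): ax; rewrite tnth_map; apply: t.
  exact/(amalgam_embl am)/(nf_contractive nfA).
move/(unary_pattern _ _ p w1 i1): bx; rewrite tnth_map; apply: t.
exact/(amalgam_embr am)/(nf_contractive nfB).
Qed.

Lemma join_ext_normal : is_monotone w -> ~~ is_idempotent w ->
  normal_form (join_ext f' g' FA FB).
Proof.
move=> mono nidem; split=> [_|||idem|inv].
- by move=> x y; exact: join_ext_pattern.
- exact: join_ext_lower.
- by move=> con x p; exact: join_ext_contractive.
- by rewrite idem in nidem.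
- by have := involutive_not_monotone inv; rewrite mono.
Qed.

(** Values of idempotent operations are fixed points, so they still count
below the value at [join_ext x]. *)
Lemma join_ext_increases x : is_monotone w -> is_idempotent w ->
  ole (join_ext f' g' FA FB x)
      (join_ext f' g' FA FB (diag w (join_ext f' g' FA FB x))).
Proof.
move=> mono idem; have w1 : arity w = 1 by apply: unary_arity; rewrite idem !orbT.
have i1 : isotone_places w = 1 by apply: unary_isotone => //; rewrite idem orbT.
have p0 : 'I_(arity w) by rewrite w1; exact: ord0.
apply/supP => y [[[a ax ->]|[b bx ->]]|xy].
- apply: sup_ub; left; left; exists (diag w (FA a)); last by rewrite nf_idempotent.
  rewrite -diag_map; apply/(unary_pattern _ _ p0 w1 i1); rewrite !tnth_nseq.
  by apply: sup_ub; left; left; exists a.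
- apply: sup_ub; left; right; exists (diag w (FB b)); last by rewrite nf_idempotent.
  rewrite -diag_map; apply/(unary_pattern _ _ p0 w1 i1); rewrite !tnth_nseq.
  by apply: sup_ub; left; right; exists b.
have [y' ey' yy'] := lower_values_idempotent mono idem xy (join_ext_lower xy).
by apply: t yy' _; exact: join_ext_lower.
Qed.

(** For idempotence, an element that [join_ext] does not raise and that
lies above [join_ext] of the value at [x] already lies above [join_ext x], by
[join_ext_increases]. *)
Lemma closure_ext_normal : is_monotone w -> is_idempotent w ->
  normal_form (closure_ext f' g' FA FB).
Proof.
move=> mono idem; have w1 : arity w = 1 by apply: unary_arity; rewrite idem !orbT.
have i1 : isotone_places w = 1 by apply: unary_isotone => //; rewrite idem orbT.
have p0 : 'I_(arity w) by rewrite w1; exact: ord0.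
set J := join_ext f' g' FA FB; set K := closure_ext f' g' FA FB.
have J_mono x y : wpattern_le ole x y -> ole (J x) (J y) by exact: join_ext_pattern.
have J_diag u v : ole u v -> ole (J (diag w u)) (J (diag w v)).
  by move=> uv; apply/J_mono/(unary_pattern _ _ p0 w1 i1); rewrite !tnth_nseq.
have JK x : ole (J x) (K x) by apply/infP => e [].
have KJ x : ole (J (diag w (K x))) (K x).
  by apply/infP => e [xe ee]; apply: t (ee); apply: J_diag; apply: inf_lb; split.
split=> [_ x y xy|x y xy|con x p|_ x|inv].
- apply/infP => e [ye ee]; apply: inf_lb; split=> //; apply: t ye; exact: (J_mono _ _ xy).
- by apply: t (JK x); exact: (join_ext_lower xy).
- apply: t (join_ext_contractive x p mono con); apply: inf_lb; split.
    exact: r.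
  have := join_ext_contractive (diag w (J x)) p mono con.
  by rewrite tnth_nseq.
- apply: anti; first by apply: inf_lb; split; exact: KJ.
  apply/infP => e [Ke ee]; apply: inf_lb; split=> //; apply: t Ke.
  by apply: t (join_ext_increases x mono idem) _; exact: J_diag (JK x).
- by have := involutive_not_monotone inv; rewrite mono.
Qed.

Lemma extend_op_normal : normal_form (extend_op f' g' FA FB).
Proof.
rewrite /extend_op; case: ifP => [|/negbFE mono]; first exact: freeze_ext_normal.
by case: ifP => [|/negbT]; [exact: closure_ext_normal | exact: join_ext_normal].
Qed.

End NormalForm.
End ExtendOperation.

(** * Superamalgamation of the classes of expansions *)

(** The equality of the properties is used to compare operations whose
arities are only propositionally equal. *)
Lemma extend_op_compare (d : Order.disp_t) (k : kind) (w w' : property)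
    (D : base d k) (cD : complete_order (@ole d D)) (A B : base d k)
    (f' : A -> D) (g' : B -> D)
    (FA : (arity w).-tuple A -> A) (FA' : (arity w').-tuple A -> A)
    (FB : (arity w).-tuple B -> B) (FB' : (arity w').-tuple B -> B) :
  w = w' -> order_embedding ole ole f' -> order_embedding ole ole g' ->
  (forall x y, tval x = tval y -> ole (FA x) (FA' y)) ->
  (forall x y, tval x = tval y -> ole (FB x) (FB' y)) ->
  forall x y, tval x = tval y ->
    ole (extend_op cD f' g' FA FB x) (extend_op cD f' g' FA' FB' y).
Proof.
move=> e; case: w' / e FA' FB' => FA' FB' fe ge hA hB x y /val_inj <-.
by apply: extend_op_mono => // u; [exact: hA | exact: hB].
Qed.

Section Embeddings.
Variables (d : Order.disp_t) (k : kind) (I : Type) (ar : I -> nat).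
Notation str := (expansion d k ar).

Lemma embeddingP (A B : str) (f : A -> B) :
  embedding f <-> base_embedding f /\
    forall i (x : (ar i).-tuple A), f (op A i x) = op B i (map_tuple f x).
Proof.
split=> [[fe fm fo]|[[fe fp] fo]].
  split=> //; split; last exact/base_morphismP.
  by move=> x y; rewrite /ole fe.
split=> //; last exact/base_morphismP.
by move=> x y; apply/idP/idP => /fe.
Qed.

End Embeddings.

Section ExpansionAmalgamation.
Variables (d : Order.disp_t) (k : kind) (I : Type) (W : I -> property)
  (cmp : I -> I -> Prop).
Hypotheses (adm : forall i, admissible k (W i))
  (cmpW : forall i j, cmp i j -> W i = W j).
Notation str := (expansion d k (fun i => arity (W i))).

Theorem expansion_amalgamation (A B C : str) (f : C -> A) (g : C -> B) :
  expansion_class cmp A -> expansion_class cmp B ->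
  embedding f -> embedding g ->
  exists (D : str) (f' : A -> D) (g' : B -> D),
    [/\ expansion_class cmp D, embedding f', embedding g' &
        base_amalgam k ole ole f g ole f' g'].
Proof.
move=> [sA cA] [sB cB] /embeddingP[fb fF] /embeddingP[gb gF].
have [D [f' [g' am]]] := base_superamalgamation fb gb.
have cD := amalgam_complete am.
have nA i := (satisfiesP _ (adm i)).1 (sA i).
have nB i := (satisfiesP _ (adm i)).1 (sB i).
pose opD i := @extend_op d k (W i) D cD A B f' g' (op A i) (op B i).
exists (@Expansion d k I (fun i => arity (W i)) D opD), f', g'; split=> //.
- split=> [i|i j ij x y xy].
    apply/satisfiesP => //=.
    exact: (extend_op_normal cD (adm i) am (nA i) (nB i) (fF i) (gF i)).
  apply: (extend_op_compare cD (cmpW ij) (amalgam_embl am) (amalgam_embr am)) xy.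
    exact: cA.
  exact: cB.
- apply/embeddingP; split=> [|i x].
    by split; [exact: amalgam_embl am | exact: amalgam_prel am].
  by rewrite /= /opD (extend_opE cD (adm i) am (nA i) (nB i) (fF i) (gF i)).
apply/embeddingP; split=> [|i x].
  by split; [exact: amalgam_embr am | exact: amalgam_prer am].
rewrite /= /opD (extend_op_swap cD am (fF i) (gF i)).
by rewrite (extend_opE cD (adm i) (base_amalgam_sym am) (nB i) (nA i) (gF i) (fF i)).
Qed.

Theorem expansion_superamalgamation : superamalgamation (@expansion_class d k I W cmp).
Proof.
move=> A B C f g HA HB _ fe ge.
have [D [f' [g' [HD fe' ge' am]]]] := expansion_amalgamation HA HB fe ge.
exists D, f', g'; split=> // [|a b _ _]; last first.
  by split; [exact: amalgam_interl am a b | exact: amalgam_interr am a b].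
by split=> //; [exact: amalgam_comm am | exact: amalgam_meet am].
Qed.

End ExpansionAmalgamation.

Lemma super_strong (d : Order.disp_t) (k : kind) (I : Type) (ar : I -> nat)
    (H : expansion d k ar -> Prop) :
  superamalgamation H -> strong_amalgamation H.
Proof.
move=> sup A B C f g HA HB HC fe ge.
by have [D [f' [g' [HD am _]]]] := sup A B C f g HA HB HC fe ge; exists D, f', g'.
Qed.

(** * Embeddings, subuniverses and substructures *)

Section Structures.
Variables (d : Order.disp_t) (k : kind) (I : Type) (ar : I -> nat).
Notation str := (expansion d k ar).

Lemma emb_ole (A B : str) (f : A -> B) :
  embedding f -> order_embedding ole ole f.
Proof. by move=> /embeddingP[[]]. Qed.

Lemma emb_values (A B : str) (f : A -> B) :
  embedding f -> preserves_values k ole ole f.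
Proof. by move=> /embeddingP[[]]. Qed.

Lemma emb_op (A B : str) (f : A -> B) i (x : (ar i).-tuple A) :
  embedding f -> f (op A i x) = op B i (map_tuple f x).
Proof. by move=> /embeddingP[_ ->]. Qed.

Lemma emb_inj (A B : str) (f : A -> B) : embedding f -> injective f.
Proof. by move=> /emb_ole; exact: embedding_inj. Qed.

Lemma map_tuple_comp (T U V : Type) (f : T -> U) (g : U -> V) n (x : n.-tuple T) :
  map_tuple (g \o f) x = map_tuple g (map_tuple f x).
Proof. by apply: eq_from_tnth => p; rewrite !tnth_map. Qed.

Lemma embedding_id (A : str) : embedding (@id A).
Proof.
apply/embeddingP; split=> [|i x]; last first.
  by congr (op A i _); apply: eq_from_tnth => p; rewrite tnth_map.
by split=> // s xs z _; rewrite map_id.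
Qed.

Lemma embedding_comp (A B E : str) (f : A -> B) (g : B -> E) :
  embedding f -> embedding g -> embedding (g \o f).
Proof.
move=> hf hg; apply/embeddingP; split=> [|i x]; last first.
  by rewrite /= (emb_op _ hf) (emb_op _ hg) map_tuple_comp.
split=> [x y|s xs z ks zP]; first by rewrite /= (emb_ole hg) (emb_ole hf).
by rewrite map_comp; apply: (emb_values hg) => //; exact: (emb_values hf).
Qed.

(** The map [h] reflects what [g] preserves, as values in [B] exist and are
unique. *)
Lemma embedding_factor (A B M : str) (f : A -> B) (h : B -> M) (g : A -> M) :
  embedding h -> embedding g -> (forall a, h (f a) = g a) -> embedding f.
Proof.
move=> hh hg hfg; apply/embeddingP; split=> [|i x]; last first.
  apply: (emb_inj hh); rewrite hfg (emb_op _ hg) (emb_op _ hh) -map_tuple_comp.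
  by congr (op M i _); apply: eq_from_tnth => p; rewrite !tnth_map /= hfg.
split=> [x y|s xs z ks zP]; first by rewrite -(emb_ole hh) !hfg (emb_ole hg).
have [|u uP] := @base_has_values d k B s (map f xs) ks.
  by rewrite size_map; exact: value_of_size zP.
have -> : f z = u; last exact: uP.
apply: (emb_inj hh); rewrite hfg.
apply: (value_of_uniq (ole_order M)) (emb_values hg ks zP) _.
have := emb_values hh ks uP; rewrite -map_comp.
by rewrite (@eq_map _ _ (h \o f) g).
Qed.

Lemma embedding_inverse (A B : str) (f : A -> B) (g : B -> A) :
  embedding f -> cancel g f -> embedding g.
Proof. by move=> hf gK; apply: embedding_factor hf (embedding_id B) gK. Qed.

Lemma subuniverse_range (A B : str) (f : A -> B) (X : set A) :
  embedding f -> subuniverse X -> subuniverse (f @` X).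
Proof.
move=> hf [/base_closedP cX oX]; split.
  apply/base_closedP => s xs z ks zP xsX.
  have [ys [ysX exs]] : exists ys, (forall y, y \in ys -> X y) /\ xs = map f ys.
    elim: xs xsX {zP} => [|x xs IH] h; first by exists [::].
    have [y Xy yx] := h x (mem_head _ _).
    have [|ys [ysX ->]] := IH; first by move=> u uxs; apply: h; rewrite inE uxs orbT.
    by exists (y :: ys); rewrite /= yx; split=> // u; rewrite inE => /orP[/eqP->|/ysX].
  have [|u uP] := @base_has_values d k A s ys ks.
    by have := value_of_size zP; rewrite exs size_map.
  exists u; first exact: cX uP ysX.
  apply: (value_of_uniq (ole_order B)) (emb_values hf ks uP) _.
  by rewrite -exs.
move=> i x xX; have [p|y yP] := @tuple_choice _ A _ x
    (fun p a => X a /\ f a = tnth x p).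
  by have [a Xa ax] := xX p; exists a.
exists (op A i y); first by apply: oX => p; case: (yP p).
rewrite (emb_op _ hf); congr (op B i _); apply: eq_from_tnth => p.
by rewrite tnth_map; case: (yP p).
Qed.

Lemma subuniverse_preimage (A B : str) (f : A -> B) (X : set B) :
  embedding f -> subuniverse X -> subuniverse (f @^-1` X).
Proof.
move=> hf [/base_closedP cX oX]; split.
  apply/base_closedP => s xs z ks zP xsX.
  apply: cX ks (emb_values hf ks zP) _ => y /mapP[x xxs ->].
  exact: xsX.
move=> i x xX; rewrite /preimage /= (emb_op _ hf); apply: oX => p.
by rewrite tnth_map; exact: xX.
Qed.

Lemma subuniverse_setT (A : str) : subuniverse [set: A].
Proof. by split=> //; apply/base_closedP => s xs z. Qed.

Lemma generated_subuniverse (A : str) (G : set A) : subuniverse (generated G).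
Proof.
split.
  apply/base_closedP => s xs z ks zP xsG X [sX GX].
  have [/base_closedP cX _] := sX; apply: cX ks zP _ => x xxs.
  exact: (xsG x xxs X (conj sX GX)).
move=> i x xG X [sX GX]; have [_ oX] := sX; apply: oX => p.
exact: (xG p X (conj sX GX)).
Qed.

Lemma generated_sub (A : str) (G : set A) : G `<=` generated G.
Proof. by move=> x Gx X [_]; apply. Qed.

Lemma generated_min (A : str) (G X : set A) :
  subuniverse X -> G `<=` X -> generated G `<=` X.
Proof. by move=> sX GX x; apply; split. Qed.

Lemma generated_image (A B : str) (f : A -> B) (G : set A) : embedding f ->
  generated (f @` G) = f @` generated G.
Proof.
move=> hf; apply/seteqP; split.
  apply: generated_min; last by apply: image_subset; exact: generated_sub.
  by apply: subuniverse_range => //; exact: generated_subuniverse.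
move=> _ [x xG <-].
apply: (generated_min (X := f @^-1` generated (f @` G))) xG.
  by apply: subuniverse_preimage => //; exact: generated_subuniverse.
by move=> y Gy; apply: generated_sub; exists y.
Qed.

Lemma realize_structure (T : Type) (le : T -> T -> Prop)
    (opT : forall i, (ar i).-tuple T -> T) :
  is_order le -> has_values le k ->
  exists (M : str) (phi : T -> M), [/\ bijective phi,
    order_embedding le ole phi, preserves_values k le ole phi &
    forall i x, phi (opT i x) = op M i (map_tuple phi x)].
Proof.
move=> ord ex; have [M [phi [phib phie]]] := realize d ord ex.
have [psi phiK psiK] := phib.
exists (@Expansion d k I ar M (fun i x => phi (opT i (map_tuple psi x)))), phi.
split=> // [s xs z ks|i x] /=; first exact: value_of_iso.
congr (phi (opT i _)); apply: eq_from_tnth => p.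
by rewrite !tnth_map phiK.
Qed.

Lemma has_meets s : has_sym k s -> s = SImp \/ s = SCompl -> has_sym k SMeet.
Proof. by case: k s => [] [] //= _ []. Qed.

(** The description of an implication quantifies over all elements below
the given ones, and so need not be inherited by a subset; but it suffices to
test it at meets, which a subuniverse contains.  The same applies to
complements. *)
Lemma substructure (N : str) (X : set N) : subuniverse X ->
  exists (S : str) (e : S -> N), embedding e /\ range e = X.
Proof.
move=> [/base_closedP cX oX].
pose T := {x | X x}; pose le (x y : T) := ole (sval x) (sval y).
have ordN := ole_order N.
have ord : is_order le.
  split=> [x|y x z|[x Xx] [y Xy] xy yx]; first exact: (ord_refl ordN).
    exact: (ord_trans ordN).
  by apply: eq_exist; exact: (ord_anti ordN).
have val s (xs : seq T) : has_sym k s -> size xs = sym_arity s ->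
    exists z, value_of le s xs z /\ value_of ole s (map sval xs) (sval z).
  move=> ks sxs; have [|z zP] := @base_has_values d k N s (map sval xs) ks.
    by rewrite size_map.
  have Xz : X z.
    apply: cX ks zP _; elim: xs {sxs} => //= x xs IH y; rewrite inE.
    by move=> /orP[/eqP->|/IH//]; exact: svalP.
  exists (exist _ z Xz); split=> //.
  have meet (x y : T) : has_sym k SMeet ->
      exists v : T, [/\ le v x, le v y & forall u,
        ole u (sval x) -> ole u (sval y) -> ole u (sval v)].
    move=> kM; have [v vP] := @base_has_values d k N SMeet [:: sval x; sval y] kM erefl.
    have Xv : X v.
      by apply: cX kM vP _ => u; rewrite !inE => /orP[] /eqP->; apply: svalP.
    have [vx vy] := (vP v).1 (ord_refl ordN v).
    by exists (exist _ v Xv); split=> // u ux uy; apply/vP.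
  case: s xs ks sxs zP => [] [|x [|y [|? ?]]] //= ks _ zP.
  - by move=> w; exact: zP.
  - by move=> w; exact: zP.
  - move=> w; split=> [wz v vw vx|h]; first exact: (zP (sval w)).1 wz _ vw vx.
    have [v [vw vx vP]] := meet w x (has_meets ks (or_introl erefl)).
    apply/zP => u uw ux; apply: (ord_trans ordN) (vP u uw ux) _.
    exact: h.
  - by move=> w; exact: zP.
  - by move=> w; exact: zP.
  have [zP1 zP2] := zP; split=> w; last first.
    by move=> xw zw u; exact: (zP2 (sval w)).
  split=> [wz v vw vx u|h]; first exact: (zP1 (sval w)).1 wz _ vw vx _.
  have [v [vw vx vP]] := meet w x (has_meets ks (or_intror erefl)).
  have vz : le v (exist _ z Xz) by exact: h.
  apply/zP1 => u uw ux u'.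
  have /zP1 zv : ole (sval v) z by [].
  apply: (ord_trans ordN) (vP u uw ux) _.
  exact: (zv _ (ord_refl ordN _) vx).
have opX i (x : (ar i).-tuple T) : X (op N i (map_tuple sval x)).
  by apply: oX => p; rewrite tnth_map; exact: svalP.
have [|S [phi [[psi phiK psiK] phie phiv phio]]] :=
  realize_structure (fun i x => exist _ _ (opX i x)) ord.
  by move=> s xs ks sxs; have [z [zP _]] := val s xs ks sxs; exists z.
exists S, (sval \o psi); split.
  apply/embeddingP; split=> [|i x]; last first.
    have xE : x = map_tuple phi (map_tuple psi x).
      by apply: eq_from_tnth => p; rewrite !tnth_map psiK.
    by rewrite {1}xE -phio /= phiK /= map_tuple_comp.
  split=> [x y|s xs z ks zP] /=.
    by rewrite -/(le _ _) -(phie (psi x)) !psiK.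
  have [|u [uP uN]] := val s (map psi xs) ks.
    by rewrite size_map; exact: value_of_size zP.
  have zu : z = phi u.
    apply: (value_of_uniq (ole_order S)) zP _.
    have := phiv s _ _ ks uP; rewrite -map_comp.
    by rewrite (@eq_map _ _ (phi \o psi) id) ?map_id.
  by rewrite zu phiK map_comp.
apply/seteqP; split=> [_ [x _ <-]|x Xx]; first exact: svalP.
by exists (phi (exist _ x Xx)) => //=; rewrite phiK.
Qed.

End Structures.

(** * Unions of chains *)

(** The stages of the chain are given with compatible injections in one type
[U], so that the union is a subset of [U] rather than a quotient of a
dependent sum.  With [U] the natural numbers the union is countable. *)
Section DirectedUnion.
Variables (d : Order.disp_t) (k : kind) (I : Type) (ar : I -> nat).
Notation str := (expansion d k ar).
Variables (U : Type) (A : nat -> str) (u : forall n, A n -> U).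
Hypothesis u_inj : forall n, injective (@u n).
Hypothesis u_step : forall n, exists e : A n -> A n.+1,
  embedding e /\ forall a, u (e a) = u a.

Lemma union_lift n m : (n <= m)%N -> exists e : A n -> A m,
  embedding e /\ forall a, u (e a) = u a.
Proof.
elim: m => [|m IH]; first by case: n => // _; exists id; split=> //; exact: embedding_id.
rewrite leq_eqVlt => /orP[/eqP->|]; first by exists id; split=> //; exact: embedding_id.
rewrite ltnS => /IH[e [he ue]]; have [e' [he' ue']] := u_step m.
exists (e' \o e); split; first exact: embedding_comp.
by move=> a; rewrite /= ue' ue.
Qed.

Let T := {x | exists n (a : A n), u a = x}.
Definition inj_stage n (a : A n) : T := exist _ (u a) (ex_intro _ n (ex_intro _ a erefl)).

Let T_ext (x y : T) : sval x = sval y -> x = y.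
Proof. by case: x y => [x ?] [y ?] /= e; exact: eq_exist. Qed.

Definition union_le (x y : T) : Prop :=
  exists n (a b : A n), [/\ inj_stage a = x, inj_stage b = y & ole a b].

Let stage_inj n : injective (@inj_stage n).
Proof. by move=> a b /(congr1 sval) /= /u_inj. Qed.

Let stage_lift n m : (n <= m)%N -> exists e : A n -> A m,
  embedding e /\ forall a, inj_stage (e a) = inj_stage a.
Proof.
move=> /union_lift[e [he ue]]; exists e; split=> // a.
by apply: T_ext => /=; rewrite ue.
Qed.

Let common n (x : n.-tuple T) N : exists m (a : n.-tuple (A m)),
  (N <= m)%N /\ x = map_tuple (@inj_stage m) a.
Proof.
have [f fP] : exists f : 'I_n -> nat, forall p, exists a : A (f p), inj_stage a = tnth x p.
  have /choice[f fP] : forall p, exists m, exists a : A m, inj_stage a = tnth x p.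
    by move=> p; case: (tnth x p) => y [m [a ay]]; exists m, a; exact: T_ext.
  by exists f.
pose m := maxn N (\max_p f p); exists m.
have [p|a aP] := @tuple_choice _ (A m) _ x (fun p a => inj_stage a = tnth x p).
  have [a <-] := fP p; have [|e [_ ue]] := @stage_lift (f p) m.
    by rewrite leq_max (leq_bigmax p) orbT.
  by exists (e a).
exists a; split; first exact: leq_maxl.
by apply: eq_from_tnth => p; rewrite tnth_map aP.
Qed.

Let common_seq (xs : seq T) : exists m (ys : seq (A m)), xs = map (@inj_stage m) ys.
Proof.
have [m [a [_ /(congr1 val) e]]] := common (in_tuple xs) 0.
by exists m, a.
Qed.

Let common1 (x : T) N : exists m (a : A m), (N <= m)%N /\ inj_stage a = x.
Proof.
have [m [a [Nm /(congr1 (fun t => tnth t ord0))]]] := common [tuple x] N.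
by rewrite tnth_map => e; exists m, (tnth a ord0).
Qed.

Let stage_le n (a b : A n) : union_le (inj_stage a) (inj_stage b) <-> ole a b.
Proof.
split=> [[m [a' [b' [ea eb ab]]]]|ab]; last by exists n, a, b.
have [e [he ue]] := stage_lift (leq_maxl n m).
have [e' [he' ue']] := stage_lift (leq_maxr n m).
have aa : e a = e' a' by apply: stage_inj; rewrite ue ue'.
have bb : e b = e' b' by apply: stage_inj; rewrite ue ue'.
by rewrite -(emb_ole he) aa bb (emb_ole he').
Qed.

Let union_order : is_order union_le.
Proof.
split=> [x|y x z xy yz|x y xy yx].
- by have [m [a [_ <-]]] := common1 x 0; apply/stage_le; exact: ord_refl (ole_order _) _.
- have [m [a [_ /(congr1 val)]]] := common [tuple x; y; z] 0.
  case: a => [[|a [|b [|c [|? ?]]]] sa] //= [ex ey ez].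
  move: xy yz; rewrite ex ey ez !stage_le; exact: ord_trans (ole_order _) _ _ _.
have [m [a [_ /(congr1 val)]]] := common [tuple x; y] 0.
case: a => [[|a [|b [|? ?]]] sa] //= [ex ey].
move: xy yx; rewrite ex ey !stage_le => ab ba.
by congr inj_stage; exact: (ord_anti (ole_order _)).
Qed.

Let stage_values n : preserves_values k ole union_le (@inj_stage n).
Proof.
move=> s xs z ks zP.
have all (P : T -> Prop) :
    (forall m (e : A n -> A m), embedding e -> (forall a, inj_stage (e a) = inj_stage a) ->
       forall w : A m, P (inj_stage w)) -> forall w, P w.
  move=> h w; have [m [a [nm <-]]] := common1 w n.
  by have [e [he ue]] := stage_lift nm; exact: h ue a.
have {}zP m (e : A n -> A m) : embedding e -> value_of ole s (map e xs) (e z).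
  by move=> he; exact: emb_values he _ _ _ ks zP.
case: s xs ks zP => [] [|x [|y [|? ?]]] //= ks zP; try by case: (zP n id (embedding_id _)).
- apply: all => m e he ue w; have := zP m e he.
  by rewrite -!ue !stage_le; apply.
- apply: all => m e he ue w; have := zP m e he.
  by rewrite -!ue !stage_le; apply.
- move=> w; split; last first.
    move: w; apply: all => m e he ue w; have := zP m e he.
    rewrite -!ue => /(_ w) h hw; apply/stage_le/h => v vw vx.
    by apply/stage_le/hw; apply/stage_le.
  move=> wz v vw vx.
  have [m [a [nm /(congr1 val)]]] := common [tuple w; v] n.
  case: a => [[|a [|b [|? ?]]] sa] //= [ew ev].
  have [e [he ue]] := stage_lift nm; have := zP m e he.
  move: wz vw vx; rewrite ew ev -!ue !stage_le => az ba bx h.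
  exact: (h a).1 az b ba bx.
- apply: all => m e he ue w; have := zP m e he.
  by rewrite -!ue !stage_le; apply.
- apply: all => m e he ue w; have := zP m e he.
  by rewrite -!ue !stage_le; apply.
split; last first.
  apply: all => m e he ue w; have [_ zP2] := zP m e he.
  rewrite -!ue !stage_le => xw zw v.
  have [q [a [mq <-]]] := common1 v m; have [e' [he' ue']] := stage_lift mq.
  rewrite -(ue' w); apply/stage_le.
  have [_ zq] := zP q (e' \o e) (embedding_comp he he').
  by apply: zq; rewrite /= (emb_ole he').
move=> w; split; last first.
  move: w; apply: all => m e he ue w; have [zP1 _] := zP m e he.
  rewrite -!ue => hw; apply/stage_le/zP1 => v vw vx v'.
  by apply/stage_le/hw; apply/stage_le.
move=> wz v vw vx v'.
have [m [a [nm /(congr1 val)]]] := common [tuple w; v; v'] n.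
case: a => [[|a [|b [|c [|? ?]]]] sa] //= [ew ev ev'].
have [e [he ue]] := stage_lift nm; have [zP1 _] := zP m e he.
move: wz vw vx; rewrite ew ev ev' -!ue !stage_le => az ba bx.
exact: (zP1 a).1 az b ba bx c.
Qed.

Let union_values : has_values union_le k.
Proof.
move=> s xs ks sxs; have [m [ys exs]] := common_seq xs.
have [|z zP] := @base_has_values d k (A m) s ys ks.
  by rewrite -sxs exs size_map.
by exists (inj_stage z); rewrite exs; exact: stage_values.
Qed.

Let union_op : exists opT : forall i, (ar i).-tuple T -> T,
  forall i n (a : (ar i).-tuple (A n)),
    opT i (map_tuple (@inj_stage n) a) = inj_stage (op (A n) i a).
Proof.
have H i (x : (ar i).-tuple T) : exists z, forall n (a : (ar i).-tuple (A n)),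
    x = map_tuple (@inj_stage n) a -> z = inj_stage (op (A n) i a).
  have [m [b [_ xb]]] := common x 0; exists (inj_stage (op (A m) i b)) => n a xa.
  have [e [he ue]] := stage_lift (leq_maxl n m).
  have [e' [he' ue']] := stage_lift (leq_maxr n m).
  rewrite -ue -ue' (emb_op _ he) (emb_op _ he'); congr (inj_stage (op _ i _)).
  apply: eq_from_tnth => p; apply: stage_inj; rewrite !tnth_map ue ue'.
  have := congr1 (fun t => tnth t p) xa; rewrite {1}xb !tnth_map.
  by [].
exists (fun i x => projT1 (cid (H i x))) => i n a.
by case: cid => z /= /(_ n a erefl).
Qed.

Theorem directed_union : exists (M : str) (c : forall n, A n -> M) (v : M -> U),
  [/\ forall n, embedding (c n), injective v, forall n a, v (c n a) = u a &
      forall x : M, exists n a, c n a = x].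
Proof.
have [opT opTP] := union_op.
have [M [phi [[psi phiK psiK] phie phiv phio]]] :=
  realize_structure d opT union_order union_values.
exists M, (fun n a => phi (inj_stage a)), (fun x => sval (psi x)); split.
- move=> n; apply/embeddingP; split=> [|i x].
    split=> [x y|s xs z ks zP]; first by rewrite phie stage_le.
    by rewrite (map_comp phi); exact/phiv/stage_values.
  rewrite -opTP phio; congr (op M i _).
  by apply: eq_from_tnth => p; rewrite !tnth_map.
- by move=> x y /T_ext; exact: can_inj psiK _ _.
- by move=> n a; rewrite phiK.
- move=> x; have [n [a [_ ea]]] := common1 (psi x) 0.
  by exists n, a; rewrite ea psiK.
Qed.

End DirectedUnion.

(** * Countably many finite structures *)

Lemma dependent_choice_nat (T : nat -> Type) (R : forall n, T n -> T n.+1 -> Prop) :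
  (forall n t, exists t', R n t t') ->
  forall t0 : T 0, exists s : forall n, T n, s 0 = t0 /\ forall n, R n (s n) (s n.+1).
Proof.
move=> tot t0; exists (nat_rect T t0 (fun n t => projT1 (cid (tot n t)))).
by split=> // n /=; case: cid.
Qed.

Lemma finite_functions (A B : Type) : finite_set [set: A] -> finite_set [set: B] ->
  finite_set [set: A -> B].
Proof.
move=> fA fB; have := finite_powerset (finite_prod fA fB).
apply: (@finite_inj _ _ (fun f => [set ab | ab.2 = f ab.1])) => f g fg.
by apply/funext => a; have : [set ab | ab.2 = g ab.1] (a, f a) by rewrite -fg.
Qed.

(** The new elements are numbered after all numbers in use; only finitely
many are in use, which leaves room for the next stages of a chain. *)
Lemma extend_injection (X Y : Type) (x : X -> Y) (u : X -> nat) :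
  finite_set [set: X] -> finite_set [set: Y] -> injective x -> injective u ->
  exists v : Y -> nat, injective v /\ forall a, v (x a) = u a.
Proof.
move=> /finite_ordinal[n [h [h' hK h'K]]] /finite_ordinal[m [l [l' lK l'K]]] xi ui.
pose N := (\max_(p < n) u (h p)).+1.
have uN a : (u a < N)%N by rewrite ltnS -(h'K a); exact: (leq_bigmax (h' a)).
exists (fun y => if pselect (exists a, x a = y) is left e then u (projT1 (cid e))
  else (N + l' y)%N); split=> [y z|a]; last first.
  case: pselect => [e|[]]; last by exists a.
  by case: cid => b /= /xi->.
case: pselect => [e|ne]; case: pselect => [e'|ne'].
- by case: cid => a /= <-; case: cid => b /= <- /ui->.
- by case: cid => a /= ay uE; have := uN a; rewrite uE ltnNge leq_addr.
- by case: cid => a /= ay uE; have := uN a; rewrite -uE ltnNge leq_addr.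
- by move=> /addnI/val_inj/(can_inj l'K).
Qed.

Section Representatives.
Variables (d : Order.disp_t) (k : kind) (I : Type) (ar : I -> nat).
Notation str := (expansion d k ar).
Variables (r : nat) (iota : 'I_r -> I).
Hypothesis iota_surj : forall i, exists p, iota p = i.

(** A structure on an initial segment of the natural numbers.  The codes form
a countable type because the tables are finite. *)
Definition code := {n : nat & ({ffun 'I_n * 'I_n -> bool} *
  {dffun forall p : 'I_r, {ffun (ar (iota p)).-tuple 'I_n -> 'I_n}})%type}.

Definition coded (A : str) (c : code) : Prop :=
  exists alpha : 'I_(tag c) -> A, [/\ bijective alpha,
    forall p q, (alpha p <= alpha q) = (tagged c).1 (p, q) &
    forall i x, op A (iota i) (map_tuple alpha x) = alpha ((tagged c).2 i x)].

Lemma coded_exists (A : str) : finite_set [set: A] -> exists c, coded A c.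
Proof.
move=> /finite_ordinal[n [h [h' hK h'K]]].
exists (existT _ n ([ffun pq => h pq.1 <= h pq.2],
  [ffun i => [ffun x => h' (op A (iota i) (map_tuple h x))]])), h; split.
- by exists h'.
- by move=> p q; rewrite ffunE.
- by move=> i x; rewrite !ffunE h'K.
Qed.

Lemma coded_iso (A B : str) c : coded A c -> coded B c ->
  exists (phi : A -> B) psi, [/\ embedding phi, cancel phi psi & cancel psi phi].
Proof.
move=> [al [[al' alK al'K] al_le al_op]] [be [[be' beK be'K] be_le be_op]].
have phiK : cancel (be \o al') (al \o be') by move=> a; rewrite /= beK al'K.
have psiK : cancel (al \o be') (be \o al') by move=> a; rewrite /= alK be'K.
exists (be \o al'), (al \o be'); split=> //.
have phi_le : order_embedding (@ole d A) (@ole d B) (be \o al').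
  by move=> x y; rewrite /ole /= be_le -al_le !al'K.
apply/embeddingP; split=> [|i x].
  by split=> // s xs z _; apply: value_of_iso => //; exists (al \o be').
case: (iota_surj i) x => p <- x.
have -> : x = map_tuple al (map_tuple al' x).
  by apply: eq_from_tnth => q; rewrite !tnth_map al'K.
rewrite al_op /= alK -be_op; congr (op B _ _).
by apply: eq_from_tnth => q; rewrite !tnth_map /= alK.
Qed.

(** Isomorphic members share a code, so choosing a member for each code
meets every isomorphism class. *)
Lemma representatives (H : str -> Prop) (Z : str) : H Z ->
  (forall A, H A -> finite_set [set: A]) ->
  exists S : nat -> str, (forall n, H (S n)) /\ forall A, H A ->
    exists n (phi : S n -> A) psi, [/\ embedding phi, cancel phi psi & cancel psi phi].
Proof.
move=> HZ Hfin; have [n|S SP] := @choice nat str (fun n A => H A /\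
    forall c : code, unpickle n = Some c -> forall B, H B -> coded B c -> coded A c).
  case en : (unpickle n : option code) => [c|]; last by exists Z; split.
  have [[A [HA cA]]|no] := pselect (exists A, H A /\ coded A c).
    by exists A; split=> // _ [<-].
  by exists Z; split=> // _ [<-] B HB cB; case: no; exists B.
exists S; split=> [n|A HA]; first by case: (SP n).
have [c cA] := coded_exists (Hfin A HA).
have [_ /(_ c (pickleK c) A HA cA) cS] := SP (pickle c).
by exists (pickle c); exact: coded_iso cS cA.
Qed.

End Representatives.

(** * Limits of amalgamation classes of finite structures *)

(** Two compatible families of embeddings of a chain, the first of which
covers [N], define an embedding of [N]. *)
Section Glue.
Variables (d : Order.disp_t) (k : kind) (I : Type) (ar : I -> nat).
Notation str := (expansion d k ar).
Variables (P : nat -> str) (N M : str) (p : forall n, P n -> N) (q : forall n, P n -> M).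
Hypotheses (hp : forall n, embedding (@p n)) (hq : forall n, embedding (@q n)).
Hypothesis step : forall n, exists j : P n -> P n.+1,
  (forall a, p (j a) = p a) /\ (forall a, q (j a) = q a).
Hypothesis cover : forall x, exists n (a : P n), p a = x.

Let lift n m : (n <= m)%N -> exists j : P n -> P m,
  (forall a, p (j a) = p a) /\ (forall a, q (j a) = q a).
Proof.
elim: m => [|m IH]; first by case: n => // _; exists id.
rewrite leq_eqVlt => /orP[/eqP->|]; first by exists id.
rewrite ltnS => /IH[j [pj qj]]; have [j' [pj' qj']] := step m.
by exists (j' \o j); split=> a /=; rewrite ?pj' ?qj'.
Qed.

Let common n (x : n.-tuple N) : exists m (a : n.-tuple (P m)), x = map_tuple (@p m) a.
Proof.
have [f fP] := choice (fun i => cover (tnth x i)).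
pose m := \max_i f i; exists m.
have [i|a aP] := @tuple_choice _ (P m) _ x (fun i a => p a = tnth x i).
  have [a <-] := fP i; have [j [pj _]] := lift (leq_bigmax (F := f) i).
  by exists (j a).
by exists a; apply: eq_from_tnth => i; rewrite tnth_map aP.
Qed.

Lemma glue : exists h : N -> M, embedding h /\ forall n a, h (@p n a) = q a.
Proof.
have [h hP] : exists h : N -> M, forall n a, h (@p n a) = q a.
  have [|h hP] := @choice N M (fun x y => forall n a, @p n a = x -> q a = y).
    move=> x; have [m [b bx]] := cover x; exists (q b) => n a ax.
    have [j [pj qj]] := lift (leq_maxl n m); have [j' [pj' qj']] := lift (leq_maxr n m).
    rewrite -qj -qj'; congr q; apply: (emb_inj (hp _)).
    by rewrite pj pj' ax bx.
  by exists h => n a; rewrite -(hP _ n a erefl).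
exists h; split=> //; apply/embeddingP; split=> [|i x]; last first.
  have [m [a ->]] := common x; rewrite -(emb_op _ (hp m)) hP (emb_op _ (hq m)).
  by congr (op M i _); apply: eq_from_tnth => l; rewrite !tnth_map hP.
split=> [x y|s xs z ks zP].
  have [m [a /(congr1 val)]] := common [tuple x; y].
  case: a => [[|a [|b [|? ?]]] sa] //= [-> ->].
  by rewrite !hP (emb_ole (hq m)) (emb_ole (hp m)).
have [m [a exs]] : exists m (ys : seq (P m)), xs = map (@p m) ys.
  by have [m [a /(congr1 val)]] := common (in_tuple xs); exists m, a.
have [|u uP] := @base_has_values d k (P m) s a ks.
  by have := value_of_size zP; rewrite exs size_map.
have <- : p u = z.
  apply: (value_of_uniq (ole_order N)) (emb_values (hp m) ks uP) _.
  by rewrite -exs.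
rewrite hP exs -map_comp (@eq_map _ _ (h \o @p m) (@q m)); last exact: hP.
exact: (emb_values (hq m)).
Qed.

End Glue.

Section Fraisse.
Variables (d : Order.disp_t) (k : kind) (I : Type) (ar : I -> nat).
Notation str := (expansion d k ar).
Variables (H : str -> Prop) (Z : str).
Hypothesis I_fin : finite_set [set: I].
Hypothesis H_fin : forall A, H A -> finite_set [set: A].
Hypothesis H_her : forall (A B : str) (f : A -> B), embedding f -> H B -> H A.
Hypothesis H_amalg : forall (A B C : str) (f : C -> A) (g : C -> B),
  H A -> H B -> H C -> embedding f -> embedding g ->
  exists (D : str) (f' : A -> D) (g' : B -> D),
    [/\ H D, embedding f', embedding g' & forall c, f' (f c) = g' (g c)].
Hypothesis HZ : H Z.
Hypothesis Z_initial : forall A, H A -> exists e : Z -> A, embedding e.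

(** One amalgamation step solves one extension problem over [X], and a
solution is not lost in later steps; so finitely many problems can be solved
in a row. *)
Section Tasks.
Variable X : str.
Implicit Type Q : forall Y : str, (X -> Y) -> Prop.

Definition achievable Q := forall (Y : str) (x : X -> Y), H Y -> embedding x ->
  exists (Y' : str) (y : Y -> Y'), [/\ H Y', embedding y & Q Y' (y \o x)].

Definition persistent Q := forall (Y Y' : str) (x : X -> Y) (y : Y -> Y'),
  embedding y -> Q Y x -> Q Y' (y \o x).

Lemma achievable_forall (T : Type) (Q : T -> forall Y : str, (X -> Y) -> Prop) :
  finite_set [set: T] -> (forall t, achievable (Q t)) ->
  (forall t, persistent (Q t)) -> achievable (fun Y x => forall t, Q t Y x).
Proof.
move=> /finite_ordinal[n [h [h' hK h'K]]] ach per.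
suff list (s : seq 'I_n) : achievable (fun Y x => forall p, p \in s -> Q (h p) Y x).
  move=> Y x HY hx; have [Y' [y [HY' hy yQ]]] := list (enum 'I_n) Y x HY hx.
  by exists Y', y; split=> // t; rewrite -(h'K t); apply: yQ; rewrite mem_enum.
elim: s => [|p s IH] Y x HY hx; first by exists Y, id; split=> //; exact: embedding_id.
have [Y1 [y1 [HY1 hy1 Q1]]] := IH Y x HY hx.
have [Y2 [y2 [HY2 hy2 Q2]]] := ach (h p) Y1 (y1 \o x) HY1 (embedding_comp hx hy1).
exists Y2, (y2 \o y1); split=> //; first exact: embedding_comp.
move=> l; rewrite inE => /orP[/eqP->//|ls].
exact: (per _ _ _ (y1 \o x)) hy2 (Q1 l ls).
Qed.

Lemma persistent_forall (T : Type) (Q : T -> forall Y : str, (X -> Y) -> Prop) :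
  (forall t, persistent (Q t)) -> persistent (fun Y x => forall t, Q t Y x).
Proof. by move=> per Y Y' x y hy h t; exact: (per t _ _ x). Qed.

Definition solved (A B : str) (e : A -> B) (f : A -> X) (Y : str) (x : X -> Y) : Prop :=
  embedding e -> embedding f ->
  exists f' : B -> Y, embedding f' /\ forall a, f' (e a) = x (f a).

Lemma solved_persistent (A B : str) (e : A -> B) (f : A -> X) : persistent (solved e f).
Proof.
move=> Y Y' x y hy sol he hf; have [f' [hf' f'e]] := sol he hf.
exists (y \o f'); split=> [|a]; first exact: embedding_comp.
by rewrite /= f'e.
Qed.

Lemma solved_achievable (A B : str) (e : A -> B) (f : A -> X) : H A -> H B ->
  achievable (solved e f).
Proof.
move=> HA HB Y x HY hx; have [[he hf]|no] := pselect (embedding e /\ embedding f).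
  have [D [f' [g' [HD hf' hg' fg]]]] :=
    H_amalg HB HY HA he (embedding_comp hf hx).
  exists D, g'; split=> // _ _; by exists f'.
exists Y, id; split=> //; first exact: embedding_id.
by move=> he hf; case: no.
Qed.

End Tasks.

Lemma solve_all (S : nat -> str) (n : nat) (X : str) : (forall m, H (S m)) -> H X ->
  exists (Y : str) (x : X -> Y), [/\ H Y, embedding x &
    forall a b, (a < n)%N -> (b < n)%N ->
      forall (e : S a -> S b) (f : S a -> X), solved e f x].
Proof.
move=> HS HX; have fS m := H_fin (HS m).
(* The problems are indexed by two numbers below [n] and two maps, all ranging
   over finite types. *)
have ach : achievable (fun (Y : str) (x : X -> Y) => forall (a b : 'I_n) (e : S a -> S b)
    (f : S a -> X), solved e f x).
  apply: achievable_forall => [|a|a]; first exact: finite_finset; last first.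
    by do 3 (apply: persistent_forall => ?); exact: solved_persistent.
  apply: achievable_forall => [|b|b]; first exact: finite_finset; last first.
    by do 2 (apply: persistent_forall => ?); exact: solved_persistent.
  apply: achievable_forall => [|e|e]; first exact: finite_functions; last first.
    by apply: persistent_forall => f; exact: solved_persistent.
  apply: achievable_forall => [|f|f]; last exact: solved_persistent.
    by apply: finite_functions => //; exact: H_fin.
  exact: solved_achievable.
have [Y [y [HY hy yP]]] := ach X id HX (embedding_id X).
exists Y, y; split=> // a b an bn e f.
exact: (yP (Ordinal an) (Ordinal bn) e f).
Qed.

(** Stage [n] solves all problems between the first [n] representatives.
A problem that is posed at some stage is posed again at all later ones, after
composition, so none is missed. *)
Lemma rich_chain (S : nat -> str) : (forall n, H (S n)) ->
  exists (A : nat -> str) (u : forall n, A n -> nat),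
    [/\ forall n, H (A n), forall n, injective (@u n) &
      forall n, exists x : A n -> A n.+1,
        [/\ embedding x, forall a, u _ (x a) = u _ a &
          forall a b, (a < n)%N -> (b < n)%N ->
            forall (e : S a -> S b) (f : S a -> A n), solved e f x]].
Proof.
move=> HS.
(* A stage carries an injective numbering of its elements. *)
pose state := {Xu : {X : str & X -> nat} | H (projT1 Xu) /\ injective (projT2 Xu)}.
pose R n (s t : state) := exists x : projT1 (sval s) -> projT1 (sval t),
  [/\ embedding x, forall a, projT2 (sval t) (x a) = projT2 (sval s) a &
    forall a b, (a < n)%N -> (b < n)%N ->
      forall (e : S a -> S b) (f : S a -> projT1 (sval s)), solved e f x].
have [u0 u0i] : exists u0 : Z -> nat, injective u0.
  have [n [h [h' _ h'K]]] := finite_ordinal (H_fin HZ).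
  by exists (fun z => h' z) => x y /val_inj/(can_inj h'K).
pose s0 : state := exist _ (existT _ Z u0) (conj HZ u0i).
have [|s [_ sR]] := @dependent_choice_nat (fun _ => state) R _ s0.
  move=> n [[X u] [/= HX ui]]; have [Y [x [HY hx sol]]] := solve_all n HS HX.
  have [v [vi vx]] := extend_injection (H_fin HX) (H_fin HY) (emb_inj hx) ui.
  by exists (exist _ (existT _ Y v) (conj HY vi)), x.
exists (fun n => projT1 (sval (s n))), (fun n => projT2 (sval (s n))); split.
- by move=> n; case: (svalP (s n)).
- by move=> n; case: (svalP (s n)).
- exact: sR.
Qed.

Definition extension_property (M : str) : Prop :=
  forall (A B : str) (e : A -> B) (f : A -> M),
    H A -> H B -> embedding e -> embedding f ->
    exists f' : B -> M, embedding f' /\ forall a, f' (e a) = f a.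

Definition exhausted (M : str) : Prop :=
  exists (A : nat -> str) (c : forall n, A n -> M),
    [/\ forall n, H (A n), forall n, embedding (c n),
      forall n m, (n <= m)%N -> forall a : A n, exists b : A m, c m b = c n a &
      forall x : M, exists n a, c n a = x].

(** Finitely many generators lie in one stage, and the stage is a
subuniverse. *)
Lemma lands_in_stage (M : str) (A : nat -> str) (c : forall n, A n -> M) (B : str)
    (f : B -> M) n0 :
  (forall n, embedding (c n)) ->
  (forall n m, (n <= m)%N -> forall a : A n, exists b : A m, c m b = c n a) ->
  (forall x : M, exists n a, c n a = x) ->
  finitely_generated B -> embedding f ->
  exists n (f0 : B -> A n), [/\ (n0 <= n)%N, embedding f0 & forall b, c n (f0 b) = f b].
Proof.
move=> hc cup cover [G [/finite_seqP[s Gs] gG]] hf.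
have [n [n0n sn]] : exists n, (n0 <= n)%N /\ forall x, x \in s -> exists a, c n a = f x.
  elim: s {Gs} => [|x s [n [n0n IH]]]; first by exists n0.
  have [m [a ax]] := cover (f x); exists (maxn n m).
  split=> [|y]; first by rewrite leq_max n0n.
  rewrite inE => /orP[/eqP->|/IH[b <-]].
    by rewrite -ax; exact: cup (leq_maxr n m) a.
  exact: cup (leq_maxl n m) b.
have all x : exists a, c n a = f x.
  suff [a _ ax] : (f @^-1` range (c n)) x by exists a.
  have : generated G x by rewrite gG.
  apply: generated_min => [|y]; last by rewrite Gs => /sn[a ay]; exists a.
  apply: subuniverse_preimage => //; apply: subuniverse_range => //.
  exact: subuniverse_setT.
have [f0 f0P] := choice all; exists n, f0; split=> //.
exact: embedding_factor (hc n) hf f0P.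
Qed.

Lemma finite_finitely_generated (A : str) : finite_set [set: A] -> finitely_generated A.
Proof.
by move=> fA; exists setT; split=> //; apply/seteqP; split=> // x _; exact: generated_sub.
Qed.

Lemma rich_limit : exists M : str,
  [/\ countable [set: M], exhausted M & extension_property M].
Proof.
have [r [iota [iota' _ iotaK]]] := finite_ordinal I_fin.
have [|S [HS rep]] := representatives (iota := iota) _ HZ H_fin.
  by move=> i; exists (iota' i).
have [A [u [HA ui chain]]] := rich_chain HS.
have [|M [c [v [hc vi vc cover]]]] := directed_union ui.
  by move=> n; have [x [hx ux _]] := chain n; exists x.
have cstep n m : (n <= m)%N -> forall a : A n, exists b : A m, c m b = c n a.
  elim: m => [|m IH]; first by case: n => // _ a; exists a.
  rewrite leq_eqVlt => /orP[/eqP-> a|]; first by exists a.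
  rewrite ltnS => /IH h a; have [b <-] := h a; have [x [_ ux _]] := chain m.
  by exists (x b); apply: vi; rewrite !vc ux.
exists M; split.
- apply/countable_injP; exists v; first by move=> x y _ _; exact: vi.
- by exists A, c.
move=> B E e f HB HE he hf.
have [b [phi [psi [hphi phiK psiK]]]] := rep B HB.
have [b' [phi' [psi' [hphi' phiK' psiK']]]] := rep E HE.
have [n [f0 [bn hf0 f0c]]] := lands_in_stage (maxn b b').+1 hc cstep cover
  (finite_finitely_generated (H_fin HB)) hf.
have [x [hx ux sol]] := chain n.
have [b_lt b'_lt] : (b < n)%N /\ (b' < n)%N.
  by split; apply: leq_trans bn; rewrite ltnS ?leq_maxl ?leq_maxr.
have hpsi' : embedding psi' := embedding_inverse hphi' psiK'.
have [||f1 [hf1 f1P]] := sol b b' b_lt b'_lt (psi' \o e \o phi) (f0 \o phi).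
- by apply: embedding_comp => //; exact: embedding_comp.
- exact: embedding_comp.
exists (c n.+1 \o f1 \o psi'); split.
  by apply: embedding_comp => //; exact: embedding_comp.
move=> y; have := f1P (psi y); rewrite /= psiK => ->.
by apply: vi; rewrite vc ux -vc f0c.
Qed.

Section Limit.
Variable M : str.
Hypotheses (M_exh : exhausted M) (M_ext : extension_property M).

Lemma limit_embeds (A : str) : H A -> exists f : A -> M, embedding f.
Proof.
move=> HA; have [e he] := Z_initial HA.
have [B [c [HB hc _ _]]] := M_exh; have [z hz] := Z_initial (HB 0).
have [f [hf _]] := M_ext HZ HA he (embedding_comp hz (hc 0)).
by exists f.
Qed.

Lemma limit_age (A : str) : age M A <-> H A.
Proof.
split=> [[fgA [f hf]]|HA]; last first.
  by split; [exact/finite_finitely_generated/H_fin | exact: limit_embeds].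
have [B [c [HB hc cup cover]]] := M_exh.
have [n [f0 [_ hf0 _]]] := lands_in_stage 0 hc cup cover fgA hf.
exact: H_her hf0 (HB n).
Qed.

(** Here [P] is the domain of a partial isomorphism [p x |-> q x] of [M].  Its
domain is enlarged to a whole stage of the chain, which contains the range of
[p]; the extension property then provides the new images. *)
Lemma back_and_forth_step (n : nat) (P : str) (p q : P -> M) :
  H P -> embedding p -> embedding q ->
  forall (B : nat -> str) (c : forall n, B n -> M), (forall n, H (B n)) ->
  (forall n, embedding (c n)) ->
  (forall n m, (n <= m)%N -> forall a : B n, exists b : B m, c m b = c n a) ->
  (forall x : M, exists n a, c n a = x) ->
  exists (P' : str) (p' q' : P' -> M) (j : P -> P'),
    [/\ H P', embedding p', embedding q',
      (forall a, p' (j a) = p a) /\ (forall a, q' (j a) = q a) &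
      range (c n) `<=` range p'].
Proof.
move=> HP hp hq B c HB hc cup cover.
have [m [p0 [nm hp0 p0P]]] := lands_in_stage n hc cup cover
  (finite_finitely_generated (H_fin HP)) hp.
have [q' [hq' q'P]] := M_ext HP (HB m) hp0 hq.
exists (B m), (c m), q', p0; split=> // _ [a _ <-].
by have [b <-] := cup _ _ nm a; exists b.
Qed.

(** Both the domain and the range of the partial isomorphism absorb the
[n]th stage at step [n], so that the union of all steps is an automorphism. *)
Lemma limit_homogeneous : homogeneous M.
Proof.
move=> A f g fgA hf hg.
have HA : H A by apply/limit_age; split=> //; exists f.
have [B [c [HB hc cup cover]]] := M_exh.
(* A partial isomorphism of [M], given by two embeddings of one structure. *)
pose state := {P : {P : str & (P -> M) * (P -> M)}%type |
  [/\ H (projT1 P), embedding (projT2 P).1 & embedding (projT2 P).2]}.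
pose dom (s : state) : str := projT1 (sval s).
pose p (s : state) : dom s -> M := (projT2 (sval s)).1.
pose q (s : state) : dom s -> M := (projT2 (sval s)).2.
pose R n (s t : state) := [/\ exists j : dom s -> dom t,
    (forall a, p t (j a) = p s a) /\ (forall a, q t (j a) = q s a),
  range (c n) `<=` range (p t) & range (c n) `<=` range (q t)].
pose mk (P : str) (p0 q0 : P -> M) : {P : str & (P -> M) * (P -> M)}%type :=
  existT _ P (p0, q0).
pose s0 : state := exist _ (mk A f g) (And3 HA hf hg).
have [|s [s00 sR]] := @dependent_choice_nat (fun _ => state) R _ s0.
  move=> n [[P [p0 q0]] [/= HP hp hq]].
  have [P1 [p1 [q1 [j1 [HP1 hp1 hq1 [pj1 qj1] cp1]]]]] :=
    back_and_forth_step n HP hp hq HB hc cup cover.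
  have [P2 [q2 [p2 [j2 [HP2 hq2 hp2 [qj2 pj2] cq2]]]]] :=
    back_and_forth_step n HP1 hq1 hp1 HB hc cup cover.
  exists (exist _ (mk P2 p2 q2) (And3 HP2 hp2 hq2)).
  split=> //.
    by exists (j2 \o j1); split=> a; rewrite /p /q /= ?pj2 ?qj2.
  by move=> x /cp1[a _ <-]; exists (j2 a); rewrite // /p /= pj2.
have hp n : embedding (p (s n)) by case: (svalP (s n)).
have hq n : embedding (q (s n)) by case: (svalP (s n)).
have step n : exists j : dom (s n) -> dom (s n.+1),
    (forall a, p _ (j a) = p _ a) /\ (forall a, q _ (j a) = q _ a).
  by case: (sR n).
have step' n : exists j : dom (s n) -> dom (s n.+1),
    (forall a, q _ (j a) = q _ a) /\ (forall a, p _ (j a) = p _ a).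
  by have [j []] := step n; exists j.
have cover_p x : exists n (a : dom (s n)), p _ a = x.
  have [n [a ax]] := cover x; have xr : range (c n) x by exists a.
  by have [_ /(_ x xr)[b _ bx] _] := sR n; exists n.+1, b.
have cover_q x : exists n (a : dom (s n)), q _ a = x.
  have [n [a ax]] := cover x; have xr : range (c n) x by exists a.
  by have [_ _ /(_ x xr)[b _ bx]] := sR n; exists n.+1, b.
have [h [hh hP]] := glue hp hq step cover_p.
have [h' [_ h'P]] := glue hq hp step' cover_q.
exists h; split=> //.
- by exists h' => x; [have [n [a <-]] := cover_p x; rewrite hP h'P |
                      have [n [a <-]] := cover_q x; rewrite h'P hP].
- have : forall a, h (p (s 0) a) = q (s 0) a by move=> a; exact: hP.
  by rewrite s00.
Qed.

(** A countable structure is the union of the substructures generated by its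
first [n] elements.  These belong to the class, and the extension property
embeds them successively. *)
Lemma limit_universal : universal H M.
Proof.
move=> N /countable_injP[v /in2TT v_inj] ageN.
(* The first [n] elements of [N] for the enumeration [v]. *)
pose G n : set N := [set x | (v x < n)%N].
have sub n : exists Se : {S : str & S -> N},
    embedding (projT2 Se) /\ range (projT2 Se) = generated (G n).
  have [S0 [e0 he0]] := substructure (generated_subuniverse (G n)).
  by exists (existT _ S0 e0).
have [S SP] := choice sub.
pose D n := projT1 (S n); pose e n : D n -> N := projT2 (S n).
have he n : embedding (e n) by case: (SP n).
have re n : range (e n) = generated (G n) by case: (SP n).
have e_inj n := emb_inj (he n).
have GR n : G n `<=` range (e n) by rewrite re; exact: generated_sub.
have fgD n : finitely_generated (D n).
  exists (e n @^-1` G n); split.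
    apply: (@finite_preimage _ _ `I_n (v \o e n)); last exact: finite_II.
    by move=> x y _ _ /v_inj/e_inj.
  apply/seteqP; split=> // x _; have : range (e n) (e n x) by exists x.
  have Gim : e n @` (e n @^-1` G n) = G n.
    apply/seteqP; split=> [_ [y Gy <-] //|y Gy].
    by have [z _ zy] := GR n y Gy; exists z => //; rewrite /preimage /= zy.
  by rewrite re -{1}Gim (generated_image _ (he n)) => -[y yG /e_inj<-].
have HD n : H (D n) by apply: ageN; split=> //; exists (e n).
have jex n (x : D n) : exists y : D n.+1, e n.+1 y = e n x.
  have : range (e n.+1) (e n x); last by move=> [y _ yx]; exists y.
  rewrite re; apply: (generated_min (G := G n)) => [|y Gy|].
  - exact: generated_subuniverse.
  - by apply: generated_sub; exact: leq_trans Gy _.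
  - by rewrite -re; exists x.
have [j jP] : exists j : forall n, D n -> D n.+1, forall n x, e n.+1 (j n x) = e n x.
  by exists (fun n x => projT1 (cid (jex n x))) => n x; case: cid.
have hj n : embedding (j n) by exact: embedding_factor (he n.+1) (he n) (jP n).
have [g0 hg0] := limit_embeds (HD 0).
have [|g [_ gR]] := @dependent_choice_nat (fun n => {g : D n -> M | embedding g})
    (fun n g g' => forall x, sval g' (j n x) = sval g x) _ (exist _ g0 hg0).
  move=> n [g hg]; have [g' [hg' g'P]] := M_ext (HD n) (HD n.+1) (hj n) hg.
  by exists (exist _ g' hg').
have [|x|h [hh _]] := glue he (fun n => svalP (g n)).
- by move=> n; exists (j n); split.
- have : range (e (v x).+1) x by rewrite re; apply: generated_sub; exact: ltnSn.
  by move=> [y _ yx]; exists (v x).+1, y.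
by exists h.
Qed.

End Limit.

Theorem fraisse : has_fraisse_limit H.
Proof.
have [M [M_count M_exh M_ext]] := rich_limit.
exists M; split=> //.
- exact: limit_universal.
- exact: limit_homogeneous.
- exact: limit_age.
Qed.

End Fraisse.

(** * Finite members of the classes of expansions *)

(** All clauses of the normal form are universal sentences, hence pass to
substructures. *)
Lemma normal_form_reflect (d : Order.disp_t) (k : kind) (w : property)
    (A B : base d k) (e : A -> B) (FA : (arity w).-tuple A -> A)
    (FB : (arity w).-tuple B -> B) :
  admissible k w -> base_embedding e ->
  (forall x, e (FA x) = FB (map_tuple e x)) -> normal_form FB -> normal_form FA.
Proof.
move=> adm he eF nfB; have [ee _] := he; have e_inj := embedding_inj ee.
split=> [mono x y xy|x y xy|con x p|idem x|inv x p].
- apply/ee; rewrite !eF; apply: (nf_monotone nfB) => //.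
  exact: (pattern_le_map _ _ _ _ e_inj ee).2 xy.
- by apply/ee; rewrite eF; apply: (nf_lower nfB); exact: lower_values_emb.
- by apply/ee; rewrite eF -tnth_map; exact: (nf_contractive nfB).
- by apply: e_inj; rewrite !eF -diag_map eF (nf_idempotent nfB).
- by apply: e_inj; rewrite eF -diag_map eF (nf_involutive nfB inv _ p) tnth_map.
Qed.

Lemma empty_structure (d : Order.disp_t) (k : kind) (I : Type) (ar : I -> nat) :
  (forall s, has_sym k s -> (0 < sym_arity s)%N) -> (forall i, (0 < ar i)%N) ->
  exists Z : expansion d k ar, Z -> False.
Proof.
move=> k0 ar0; have [||Z [phi [[psi _ _] _ _ _]]] := @realize_structure d k I ar void
    (fun _ _ => True) (fun i x => tnth x (Ordinal (ar0 i))).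
- by split=> [[]|[]|[]].
- by move=> s [|[]//] /k0; case: sym_arity.
by exists Z => /psi.
Qed.

Section FiniteMembers.
Variables (d : Order.disp_t) (k : kind) (I : Type) (W : I -> property)
  (cmp : I -> I -> Prop).
Hypotheses (adm : forall i, admissible k (W i))
  (cmpW : forall i j, cmp i j -> W i = W j) (I_fin : finite_set [set: I]).
Notation str := (expansion d k (fun i => arity (W i))).
Notation K := (@expansion_class d k I W cmp).

Lemma arity_gt0 w : admissible k w -> (0 < arity w)%N.
Proof. by case: w => //= [i j n|i j n h|i j n h t] /andP[]. Qed.

Lemma expansion_class_hereditary (A B : str) (f : A -> B) :
  embedding f -> K B -> K A.
Proof.
move=> hf [sB cB]; split=> [i|i j ij x y xy].
  apply/satisfiesP => //; have /(satisfiesP _ (adm i)) := sB i.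
  have [he ho] := (embeddingP f).1 hf.
  exact: normal_form_reflect (adm i) he (ho i).
apply/(emb_ole hf); rewrite !(emb_op _ hf); apply: cB ij _ _ _.
by rewrite /= xy.
Qed.

Lemma finite_amalgamation (A B C : str) (f : C -> A) (g : C -> B) :
  finite_members K A -> finite_members K B -> embedding f -> embedding g ->
  exists (D : str) (f' : A -> D) (g' : B -> D),
    [/\ finite_members K D, embedding f', embedding g' &
        forall c, f' (f c) = g' (g c)].
Proof.
move=> [KA fA] [KB fB] hf hg.
have [D [f' [g' [KD hf' hg' am]]]] := expansion_amalgamation adm cmpW KA KB hf hg.
exists D, f', g'; split=> //; last exact: amalgam_comm am.
by split=> //; exact: amalgam_finite am fA fB.
Qed.

(** The elements generated by the constants are the same in a structure and
in its extensions. *)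
Lemma zero_part_reflect (E A B : str) (f : A -> B) :
  embedding f -> zero_generated_part E B -> zero_generated_part E A.
Proof.
move=> hf [h [hh rh]]; have gB : generated set0 = f @` generated (set0 : set A).
  by rewrite -generated_image // image_set0.
have ex x : exists a, f a = h x.
  have : range h (h x) by exists x.
  by rewrite rh gB => -[a _ ax]; exists a.
have [e eP] := choice ex; exists e; split; first exact: embedding_factor hf hh eP.
apply/seteqP; split=> [_ [x _ <-]|a ag].
  have : range h (h x) by exists x.
  by rewrite rh gB -eP => -[a ag /(emb_inj hf)<-].
have : range h (f a) by rewrite rh gB; exists a.
by move=> [x _ xa]; exists x => //; apply: (emb_inj hf); rewrite eP.
Qed.

Lemma zero_part_extend (E A B : str) (f : A -> B) :
  embedding f -> zero_generated_part E A -> zero_generated_part E B.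
Proof.
move=> hf [h [hh rh]]; exists (f \o h); split; first exact: embedding_comp.
by rewrite -(image_comp h f) rh -generated_image // image_set0.
Qed.

(** The empty structure is a member and embeds in all others, as no symbol
and no operation has arity zero. *)
Lemma fraisse_without_constants :
  (forall s, has_sym k s -> (0 < sym_arity s)%N) ->
  has_fraisse_limit (finite_members K).
Proof.
move=> k0; have ar0 i := arity_gt0 (adm i).
have [Z Z0] := empty_structure d k0 ar0.
have Zt i : (arity (W i)).-tuple Z -> False.
  by move=> x; apply: Z0; exact: tnth x (Ordinal (ar0 i)).
apply: (fraisse (Z := Z)) => //.
- by move=> A [].
- move=> A B f hf [KB fB]; split; first exact: expansion_class_hereditary hf KB.
  exact: finite_inj (emb_inj hf) fB.
- by move=> A B C f g HA HB _; exact: finite_amalgamation.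
- split; last by apply: sub_finite_set (finite_set0 Z) => z; case: (Z0 z).
  split=> [i|i j _ x]; last by case: (Zt i x).
  by apply/satisfiesP => //; split=> [_ x|x|_ x|_ x|_ x]; case: (Zt i x).
move=> A _; exists (fun z => False_rect A (Z0 z)); apply/embeddingP.
split=> [|i x]; last by case: (Zt i x).
by split=> [z|s xs z]; case: (Z0 z).
Qed.

(** The structure [E] is itself a member, being a substructure of one, and
embeds in all members by definition. *)
Lemma fraisse_over_zero_part (E : str) :
  (exists A, finite_members (with_zero_generated_part E K) A) ->
  has_fraisse_limit (finite_members (with_zero_generated_part E K)).
Proof.
have her (A B : str) (f : A -> B) : embedding f ->
    finite_members (with_zero_generated_part E K) B ->
    finite_members (with_zero_generated_part E K) A.
  move=> hf [[KB zB] fB]; split; last exact: finite_inj (emb_inj hf) fB.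
  by split; [exact: expansion_class_hereditary hf KB | exact: zero_part_reflect hf zB].
move=> [A0 HA0]; have [[_ [e [he _]]] _] := HA0.
apply: (fraisse (Z := E)) => //.
- by move=> A [].
- move=> A B C f g [[KA zA] fA] [[KB zB] fB] _ hf hg.
  have [D [f' [g' [[KD fD] hf' hg' fg]]]] :=
    finite_amalgamation (conj KA fA) (conj KB fB) hf hg.
  exists D, f', g'; split=> //; split=> //; split=> //.
  exact: zero_part_extend hf' zA.
- exact: her he HA0.
by move=> A [[_ [h [hh _]]] _]; exists h.
Qed.

End FiniteMembers.

Theorem finite_members_limit (d : Order.disp_t) (k : kind) (I : Type)
    (W : I -> property) (cmp : I -> I -> Prop) :
  finite_set [set: I] -> (forall i, admissible k (W i)) ->
  (forall i j, cmp i j -> W i = W j) ->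
  finite_members_have_fraisse_limit (@expansion_class d k I W cmp).
Proof.
move=> I_fin adm cmpW.
have zero := @fraisse_over_zero_part d k I W cmp adm cmpW I_fin.
have noconst := @fraisse_without_constants d k I W cmp adm cmpW I_fin.
rewrite /finite_members_have_fraisse_limit; move: zero noconst; clear.
by case: k cmp => cmp zero noconst; do ?[exact: zero]; apply: noconst; case.
Qed.

Theorem corollary4p3 (d : Order.disp_t) (k : kind) :
  (forall w : property, admissible k w ->
     superamalgamation (@single_class d k w) /\
     strong_amalgamation (@single_class d k w)) /\
  (forall (I : Type) (W : I -> property) (cmp : I -> I -> Prop),
     (forall i, admissible k (W i)) ->
     (forall i j, cmp i j -> W i = W j) ->
     superamalgamation (@expansion_class d k I W cmp)) /\
  (forall w : property, admissible k w ->
     finite_members_have_fraisse_limit (@single_class d k w)) /\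
  (forall (I : Type) (W : I -> property) (cmp : I -> I -> Prop),
     finite_set [set: I]%classic ->
     (forall i, admissible k (W i)) ->
     (forall i j, cmp i j -> W i = W j) ->
     finite_members_have_fraisse_limit (@expansion_class d k I W cmp)).
Proof.
split; last split; last split.
- move=> w adm; have sup : superamalgamation (@single_class d k w).
    exact: expansion_superamalgamation.
  by split; last exact: super_strong.
- by move=> I W cmp adm cmpW; exact: expansion_superamalgamation.
- by move=> w adm; apply: finite_members_limit => //; exact: finite_finset.
by move=> I W cmp I_fin adm cmpW; exact: finite_members_limit.
Qed.
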